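(* Let $d\ge 2$ and let $V\subset\mathbb{R}^d$ be any nonempty open set. If $f\in\mathcal{E}'(\mathbb{R}^d)$ satisfies $f|_V=0$ and $Xf$ vanishes on all lines that intersect $V$, then $f=0$.
   Context: $\mathcal{E}$ denotes smooth functions, $\mathcal{D}$ compactly supported smooth functions, and $\mathcal{E}'(\mathbb{R}^d)$ the compactly supported distributions on $\mathbb{R}^d$. X-ray transform: let $\Gamma$ be the manifold of oriented lines in $\mathbb{R}^d$, parametrized by $\{(z,\theta):\theta\in S^{d-1},\ z\in\theta^\perp\}$ (identified with $TS^{d-1}$). For $\varphi\in\mathcal{D}(\mathbb{R}^d)$, $X\varphi(z,\theta)=\int_{\mathbb{R}}\varphi(z+s\theta)\,ds$; for $\psi\in\mathcal{E}(\Gamma)$, $X^*\psi(x)=\int_{S^{d-1}}\psi(x-(x\cdot\theta)\theta,\theta)\,d\theta$. For $f\in\mathcal{E}'(\mathbb{R}^d)$, $Xf\in\mathcal{E}'(\Gamma)$ is defined by $\langle Xf,\eta\rangle=\langle f,X^*\eta\rangle$ for all $\eta\in\mathcal{E}(\Gamma)$. For an open set $V$, ''$Xf$ vanishes on all lines that intersect $V$'' means that $Xf|_{\Gamma_V}=0$ as a distribution, where $\Gamma_V\subset\Gamma$ is the (open) set of all lines intersecting $V$. *)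

(* Defs.v *)
From HB Require Import structures.
From mathcomp Require Import all_boot all_order all_algebra.
From mathcomp Require Import complex.
From mathcomp Require Import all_classical all_reals all_analysis.

Set Implicit Arguments.
Unset Strict Implicit.
Unset Printing Implicit Defensive.

Import Order.TTheory GRing.Theory Num.Theory.
Import numFieldNormedType.Exports.

Local Open Scope classical_set_scope.
Local Open Scope ring_scope.

Section Smooth.
Context {R : realType} {V : normedModType R}.

Definition iterD (s : seq V) (g : V -> R) : V -> R :=
  foldr (fun v h => 'D_v h) g s.

(* In finite dimension, C^infty on an open U means that the iterated
   directional derivatives of all orders exist and are continuous on U. *)
Definition smooth_on (U : set V) (g : V -> R) : Prop :=
  forall (s : seq V) (x : V), U x ->
    {for x, continuous (iterD s g)} /\ forall v, derivable (iterD s g) x v.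

Definition csmooth_on (U : set V) (g : V -> R[i]) : Prop :=
  smooth_on U (fun x => complex.Re (g x)) /\
  smooth_on U (fun x => complex.Im (g x)).

Definition csmooth (g : V -> R[i]) : Prop := csmooth_on setT g.

Definition iterDc (s : seq V) (g : V -> R[i]) (x : V) : R[i] :=
  Complex (iterD s (fun y => complex.Re (g y)) x)
          (iterD s (fun y => complex.Im (g y)) x).

(* Smoothness on a subset A of V that is not open (here a submanifold): near
   each point of A, g agrees on A with a smooth function on an open set. *)
Definition csmooth_within (A : set V) (g : V -> R[i]) : Prop :=
  forall p, A p -> exists (U : set V) (h : V -> R[i]),
    [/\ open U, U p, csmooth_on U h & forall q, U q -> A q -> g q = h q].

Definition support_within (A : set V) (g : V -> R[i]) : set V :=
  closure [set p | A p /\ g p != 0].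

End Smooth.

Section Distributions.
Context {R : realType} {d : nat}.
Local Notation V := 'rV[R]_d.

Definition partials (s : seq 'I_d) : (V -> R[i]) -> V -> R[i] :=
  iterDc [seq delta_mx 0 i | i <- s].

Definition smooth_seminorm (K : set V) (N : nat) (phi : V -> R[i]) : R :=
  \sum_(k < N.+1) \sum_(s : k.-tuple 'I_d)
    sup [set ComplexField.Normc.normc (partials s phi x) | x in K].

Definition linear_on_smooth (u : (V -> R[i]) -> R[i]) : Prop :=
  forall (a : R[i]) (phi psi : V -> R[i]), csmooth phi -> csmooth psi ->
    u (fun x => a * phi x + psi x) = a * u phi + u psi.

Definition continuous_on_smooth (u : (V -> R[i]) -> R[i]) : Prop :=
  exists (K : set V) (N : nat) (c : R), compact K /\
    forall phi, csmooth phi ->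
      ComplexField.Normc.normc (u phi) <= c * smooth_seminorm K N phi.

(* E'(R^d) as the dual of E(R^d) with its Frechet topology.  The pairing is a
   function on all maps V -> R[i], but only its values on smooth functions are
   constrained and meaningful. *)
Record cdistribution := CDistribution {
  pairing :> (V -> R[i]) -> R[i];
  _ : linear_on_smooth pairing;
  _ : continuous_on_smooth pairing }.

Definition distr_eq0 (f : cdistribution) : Prop :=
  forall phi, csmooth phi -> f phi = 0.

Definition distr_vanishes_on (W : set V) (f : cdistribution) : Prop :=
  forall phi, csmooth phi -> compact (support_within setT phi) ->
    support_within setT phi `<=` W -> f phi = 0.

End Distributions.

Arguments cdistribution : clear implicits.

(* Lebesgue integral over R^d, as an iterated integral. *)
Fixpoint rVintegral {R : realType} (d : nat) : ('rV[R]_d -> R) -> R :=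
  match d with
  | 0 => fun g => g 0
  | d'.+1 => fun g =>
      \int[lebesgue_measure]_t
        rVintegral (fun y : 'rV[R]_d' => g (row_mx (t%:M : 'rV[R]_1) y))
  end.

Section Xray.
Context {R : realType} {d : nat}.
Local Notation V := 'rV[R]_d.

Definition dotv (x y : V) : R := \sum_(i < d) x 0 i * y 0 i.

(* The norm of 'rV[R]_d in the library is the sup norm. *)
Definition enorm (x : V) : R := Num.sqrt (dotv x x).

(* The surface measure of S^{d-1} is the cone measure
   sigma(A) = d * Leb {r theta | 0 < r <= 1, theta in A}; hence the integral of
   g is d times the integral over the punctured unit ball of x |-> g(x/|x|). *)
Definition sphere_integral (g : V -> R) : R :=
  d%:R * rVintegral (fun x : V =>
    if 0 < enorm x <= 1 then g ((enorm x)^-1 *: x) else 0).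

(* The pair (z, theta) is the oriented line {z + s theta | s in R}. *)
Definition oriented_lines : set (V * V) :=
  [set p | enorm p.2 = 1 /\ dotv p.1 p.2 = 0].

Definition lines_meeting (W : set V) : set (V * V) :=
  [set p | oriented_lines p /\ exists s : R, W (p.1 + s *: p.2)].

Definition line_through (x theta : V) : V * V :=
  (x - dotv x theta *: theta, theta).

Definition Xstar (psi : V * V -> R[i]) (x : V) : R[i] :=
  Complex
    (sphere_integral (fun theta => complex.Re (psi (line_through x theta))))
    (sphere_integral (fun theta => complex.Im (psi (line_through x theta)))).

Definition Xdistr (f : cdistribution R d) (eta : V * V -> R[i]) : R[i] :=
  f (Xstar eta).

Definition Xdistr_vanishes_on (G : set (V * V)) (f : cdistribution R d) : Prop :=
  forall eta : V * V -> R[i], csmooth_within oriented_lines eta ->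
    compact (support_within oriented_lines eta) ->
    support_within oriented_lines eta `<=` G -> Xdistr f eta = 0.

End Xray.

(* Main.v *)
(* Fix x0 in V and a direction theta. A function a that is invariant under
   translations along theta and supported in a thin tube around x0 + R theta is
   annihilated by f: test Xf against a(z) b(theta'), which is supported on lines
   through V when b is supported near theta, and let b concentrate at theta.

   In a plane through x0 with coordinates X, Y centred at x0, superpose such
   tubes along all the tangent lines of the circle of small centre c and radius
   |c|. As the tubes shrink, the superposition tends, up to a factor and up to
   functions supported in V, where f vanishes, to
   (|(X,Y) - c|^2 - |c|^2)^(-1/2) = (X^2 + Y^2 - 2 c.(X,Y))^(-1/2), times a cutoff
   in the remaining coordinates. The derivatives at c = 0 give, with m = 1/|(X,Y)|,
   that f annihilates X^a Y^b m^(2(a+b)+1), hence X^a Y^b m^(2k+1) for every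
   k >= a+b because (X^2 + Y^2) m^2 = 1. If a positive sigma satisfies
   f(psi sigma^j) = 0 for all j >= 1, then expanding psi (1 - g sigma)^n, which
   tends to 0 on the support of f for small g > 0, gives f(psi) = 0. With
   sigma = m^2 this brings the exponent down to m, so f annihilates m times every
   polynomial times the cutoff, and, by the density of polynomials (Landau
   kernels), m times every smooth function times the cutoff.

   These weights are positive on the plane. Every point of the support of f lies
   on such a plane, so by compactness a finite sum sigma of weights is positive on
   the support and f(sigma phi) = 0 for all phi; the same expansion gives f = 0. *)
From Pilot Require Import Defs.
From mathcomp Require Import all_boot all_order all_algebra.
From mathcomp Require Import complex ring lra.
From mathcomp Require Import all_classical all_reals all_analysis.
From mathcomp Require Import measurable_realfun.
(* Imported last: iterD is also the name of a lemma of ssrnat. *)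
Import Pilot.Defs.
Set Implicit Arguments.
Unset Strict Implicit.
Unset Printing Implicit Defensive.
Import Order.TTheory GRing.Theory Num.Theory.
Import numFieldNormedType.Exports.
Local Open Scope classical_set_scope.
Local Open Scope ring_scope.

(** * Smooth functions and parameters *)

Section Projections.
Context {S T : topologicalType}.

(** The weight that arises from the tubes is singular on X = Y = 0. Two choices make it usable. The
    circle passes through x0, so |c|^2 cancels and the argument of the power -1/2 is affine in c: up
    to a constant, each derivative in c brings down one factor X or Y, which gives pure monomials
    rather than Legendre-type combinations. The cutoff in the remaining coordinates is as narrow as
    the hole around x0, so the singular region lies in V; there m is replaced by a smooth positive
    function, and (X^2 + Y^2) m^2 = 1 is only used off the hole.

    The power -1/2 is a density of tangent lines: with r = |(X,Y) - c| and p = |c|, the substitution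
    v = r cos(psi) - p gives |d psi| = dv / sqrt(r^2 - (v + p)^2). The argument is affine, so X and
    Y may be slanted coordinates, written down directly from a point of the plane.

    Continuity of f involves derivatives, so every limit (directions, thin tubes, difference
    quotients, Landau kernels) has to hold with derivatives. Each is an average over a parameter
    concentrating at one value, and averages commute with derivatives in x. *)

Lemma continuous_fst (p : S * T) : {for p, continuous fst}.
Proof. by case: p => x t; exact: cvg_fst. Qed.

Lemma continuous_snd (p : S * T) : {for p, continuous snd}.
Proof. by case: p => x t; exact: cvg_snd. Qed.

Lemma continuous_pair {U : topologicalType} (f : U -> S) (g : U -> T) (x : U) :
  {for x, continuous f} -> {for x, continuous g} ->
  {for x, continuous (fun y => (f y, g y))}.
Proof.
move=> cf cg; exact: (@cvg_pair _ _ _ (nbhs x) (nbhs (f x)) (nbhs (g x))).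
Qed.

End Projections.

Section LineDerivative.
Context {R : realType} {V : normedModType R}.
Implicit Types (f : V -> R) (x v : V) (df : R).

Lemma derive_line f x v : 'D_v f x = 'D_1 (fun h : R => f (h *: v + x)) 0.
Proof.
rewrite /derive; set g1 := fun h => h^-1 *: _; set g2 := fun h => h^-1 *: _.
suff -> : g1 = g2 by [].
by rewrite funeqE /g1 /g2 => h /=; rewrite addr0 scale0r add0r [_%:A]mulr1.
Qed.

Lemma is_derive_lineP f x v df :
  is_derive x v f df <-> is_derive (0 : R) 1 (fun h : R => f (h *: v + x)) df.
Proof.
split=> [[dfx <-]|[dfx <-]].
  by split; [exact: (derivable1P f x v).1|rewrite -derive_line].
by split; [exact: (derivable1P f x v).2|rewrite derive_line].
Qed.

End LineDerivative.

Section LineCalculus.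
Context {R : realType} {V : normedModType R}.
Implicit Types (f : V -> R) (x v : V) (df : R).

Lemma is_derive_line f x v df (t : R) :
  is_derive (t *: v + x) v f df ->
  is_derive t 1 (fun h : R => f (h *: v + x)) df.
Proof.
move=> /is_derive_lineP H; apply: (is_derive_lineP (V := R^o) _ t 1 df).2.
rewrite (_ : (fun h => _) = (fun h : R => f (h *: v + (t *: v + x)))) //.
by apply/funext => h; rewrite [h *: 1]mulr1 scalerDl addrA.
Qed.

Lemma is_derive_comp1 f x v df (g : R -> R) dg :
  is_derive x v f df -> is_derive (f x) 1 g dg ->
  is_derive x v (fun y => g (f y)) (dg * df).
Proof.
move=> /is_derive_lineP Hf Hg; apply/is_derive_lineP.
have Hg' : is_derive ((fun h : R => f (h *: v + x)) 0) 1 g dg.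
  by rewrite scale0r add0r.
exact: (@is_derive1_comp _ g (fun h : R => f (h *: v + x))).
Qed.

Lemma mean_value_line f (x v : V) (h : R) :
  (forall t : R, derivable f (t *: v + x) v) ->
  exists2 c, `|c| <= `|h| & f (h *: v + x) - f x = 'D_v f (c *: v + x) * h.
Proof.
move=> df; pose g (t : R) := f (t *: v + x).
have dg (t : R) : is_derive t 1 g ('D_v f (t *: v + x)).
  exact/is_derive_line/derivableP.
have cg (A : set R) : {within A, continuous g}.
  apply: continuous_subspaceT => t; apply: differentiable_continuous.
  by apply/derivable1_diffP; apply: (@ex_derive _ _ _ _ _ _ _ (dg t)).
have [h0|h0] := leP 0 h.
- have [c] := MVT_segment h0 (fun t _ => dg t) (cg _).
  rewrite in_itv/= => /andP[c0 ch] E; exists c.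
    by rewrite !ger0_norm.
  by move: E; rewrite subr0 /g scale0r add0r.
- have [c] := MVT_segment (ltW h0) (fun t _ => dg t) (cg _).
  rewrite in_itv/= => /andP[c0 ch] E; exists c.
    by rewrite !ler0_norm ?lerN2 // ltW.
  move: E; rewrite /g scale0r add0r sub0r => E.
  by rewrite -opprB E mulrN opprK.
Qed.

Lemma iterD_rcons (s : seq V) v f : iterD (rcons s v) f = iterD s ('D_v f).
Proof. by elim: s => //= w s ->. Qed.

End LineCalculus.

Section Smooth1.
Context {R : realType}.
Implicit Types f g : R -> R.

(** The class C^n, by recursion on the derivative, so that closure properties go by induction on
    n. *)
Fixpoint diff1n (n : nat) f : Prop :=
  continuous f /\
  if n is n'.+1 then (forall x : R, derivable f x 1) /\ diff1n n' (f^`()%classic) else True.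

(* This predicate, smooth and psmooth are locked because unification would
   otherwise unfold them. *)
Definition smooth1 f : Prop := locked (fun f => forall n, diff1n n f) f.

Lemma smooth1E f : smooth1 f = (forall n, diff1n n f).
Proof. by rewrite /smooth1 -lock. Qed.

Lemma diff1n_continuous n f : diff1n n f -> continuous f.
Proof. by case: n => [|n] []. Qed.

Lemma smooth1_continuous f : smooth1 f -> continuous f.
Proof. by rewrite smooth1E => /(_ 0%N) []. Qed.

Lemma smooth1_derivable f : smooth1 f -> forall x : R, derivable f x 1.
Proof. by rewrite smooth1E => /(_ 1%N) [_ []]. Qed.

Lemma smooth1_derive f : smooth1 f -> smooth1 (f^`()%classic).
Proof. by rewrite !smooth1E => H n; have [_ []] := H n.+1. Qed.

Lemma smooth1_is_derive f (x : R) : smooth1 f -> is_derive x 1 f (f^`()%classic x).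
Proof. by move=> H; rewrite derive1E; apply/derivableP/smooth1_derivable. Qed.

Lemma derivable_continuous1 f : (forall x : R, derivable f x 1) -> continuous f.
Proof. by move=> H x; apply/differentiable_continuous/derivable1_diffP. Qed.

Lemma diff1nS n f df : (forall x : R, is_derive x 1 f (df x)) ->
  diff1n n df -> diff1n n.+1 f.
Proof.
move=> H Hdf; have D x : derivable f x 1 by exact: (@ex_derive _ _ _ _ _ _ _ (H x)).
split; first exact: derivable_continuous1.
split => //; rewrite (_ : f^`()%classic = df)//; apply/funext => x.
by rewrite derive1E; exact: (@derive_val _ _ _ _ _ _ _ (H x)).
Qed.

End Smooth1.

Section SmoothLocked.
Context {R : realType} {V : normedModType R}.

Definition smooth (g : V -> R) : Prop := locked (smooth_on setT) g.

Lemma smoothE g : smooth g = smooth_on setT g.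
Proof. by rewrite /smooth -lock. Qed.

Lemma smooth_derive (g : V -> R) v : smooth g -> smooth ('D_v g).
Proof. by rewrite !smoothE => H s x _; rewrite -iterD_rcons; exact: H. Qed.

Lemma smooth_continuous (g : V -> R) : smooth g -> continuous g.
Proof. by rewrite smoothE => H x; have [] := H [::] x I. Qed.

Lemma smooth_derivable (g : V -> R) x v : smooth g -> derivable g x v.
Proof. by rewrite smoothE => H; have [_] := H [::] x I. Qed.

Lemma smooth_iterD s (g : V -> R) : smooth g -> smooth (iterD s g).
Proof. by elim: s => [//|v s IH] /IH; exact: smooth_derive. Qed.

End SmoothLocked.

Section ParameterSmooth.
Context {R : realType} {V : normedModType R} {T : topologicalType}.
Implicit Types (G H : V -> T -> R) (n : nat).

(** C^n in x with all derivatives jointly continuous in (x, t); the parameter space T carries only a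
    topology. Joint continuity gives uniformity for t in a compact set, which is what moves
    derivatives under averages over t. *)
Fixpoint pdiffn n G : Prop :=
  continuous (fun p : V * T => G p.1 p.2) /\
  if n is n'.+1 then
    forall v, (forall x t, derivable (G^~ t) x v) /\
              pdiffn n' (fun x t => 'D_v (G^~ t) x)
  else True.

Definition psmooth G : Prop := locked (fun G => forall n, pdiffn n G) G.

Lemma psmoothE G : psmooth G = (forall n, pdiffn n G).
Proof. by rewrite /psmooth -lock. Qed.

Lemma pdiffn_continuous n G : pdiffn n G -> continuous (fun p : V * T => G p.1 p.2).
Proof. by case: n => [|n] []. Qed.

Lemma pdiffnW n G : pdiffn n.+1 G -> pdiffn n G.
Proof.
elim: n G => [G [? _]|n IH G [cG HG]]; first by split.
split => // v; have [dG dG'] := HG v; split => //; exact: IH.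
Qed.

Lemma pdiffnS n G (dG : V -> V -> T -> R) :
  continuous (fun p : V * T => G p.1 p.2) ->
  (forall v x t, is_derive x v (G^~ t) (dG v x t)) ->
  (forall v, pdiffn n (dG v)) -> pdiffn n.+1 G.
Proof.
move=> cG D HdG; split => // v; split => [x t|].
  exact: (@ex_derive _ _ _ _ _ _ _ (D v x t)).
rewrite (_ : (fun x t => _) = dG v) //; apply/funext => x; apply/funext => t.
exact: (@derive_val _ _ _ _ _ _ _ (D v x t)).
Qed.

Lemma pdiffn_is_derive n G v x t : pdiffn n.+1 G ->
  is_derive x v (G^~ t) ('D_v (G^~ t) x).
Proof. by move=> [_ /(_ v) [D _]]; exact/derivableP. Qed.

Lemma pdiffn_derive n G v : pdiffn n.+1 G -> pdiffn n (fun x t => 'D_v (G^~ t) x).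
Proof. by move=> [_ /(_ v) []]. Qed.

Lemma psmooth_continuous G : psmooth G -> continuous (fun p : V * T => G p.1 p.2).
Proof. by rewrite psmoothE => /(_ 0%N) []. Qed.

Lemma psmooth_derivable G x v t : psmooth G -> derivable (G^~ t) x v.
Proof. by rewrite psmoothE => /(_ 1%N) [_ /(_ v) []]. Qed.

Lemma psmooth_derive G v : psmooth G -> psmooth (fun x t => 'D_v (G^~ t) x).
Proof. by rewrite !psmoothE => H n; exact: (@pdiffn_derive _ _ _ (H n.+1)). Qed.

Lemma psmooth_iterD G s : psmooth G -> psmooth (fun x t => iterD s (G^~ t) x).
Proof.
elim: s => [//|v s IH] /IH; exact: psmooth_derive.
Qed.

Lemma pdiffn_param n (c : T -> R) : continuous c -> pdiffn n (fun _ t => c t).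
Proof.
elim: n c => [|n IH] c cc.
  by split => // p; apply: (@continuous_comp _ _ _ snd c); [exact: continuous_snd|exact: cc].
apply: (@pdiffnS _ _ (fun _ _ _ => 0)).
- by move=> p; apply: (@continuous_comp _ _ _ snd c); [exact: continuous_snd|exact: cc].
- by move=> v x t; exact: is_derive_cst.
- by move=> v; apply: IH => ?; exact: cvg_cst.
Qed.

Lemma pdiffn_linear n (l : V -> R) : linear l -> continuous l ->
  pdiffn n (fun x _ => l x).
Proof.
move=> ll cl; have c : continuous (fun p : V * T => l p.1).
  by move=> p; apply: (@continuous_comp _ _ _ fst l); [exact: continuous_fst|exact: cl].
case: n => [|n]; first by split.
apply: (@pdiffnS _ _ (fun v _ _ => l v)) => //.
- move=> v x _; apply/is_derive_lineP.
  rewrite (_ : (fun h => _) = (fun h : R => h * l v + l x)); last first.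
    by apply/funext => h; rewrite ll.
  by apply: is_derive_eq; rewrite /GRing.scale/= ?mulr0 ?addr0 ?add0r ?mulr1 ?mul1r.
- by move=> v; apply: pdiffn_param => ?; exact: cvg_cst.
Qed.

Lemma pdiffnD n G H : pdiffn n G -> pdiffn n H ->
  pdiffn n (fun x t => G x t + H x t).
Proof.
elim: n G H => [|n IH] G H hG hH.
  by split => // p; apply: cvgD; [exact: (pdiffn_continuous hG)|exact: (pdiffn_continuous hH)].
apply: (@pdiffnS _ _ (fun v x t => 'D_v (G^~ t) x + 'D_v (H^~ t) x)).
- by move=> p; apply: cvgD; [exact: (pdiffn_continuous hG)|exact: (pdiffn_continuous hH)].
- move=> v x t; apply: is_deriveD; [exact: (pdiffn_is_derive _ _ _ hG)|exact: (pdiffn_is_derive _ _ _ hH)].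
- by move=> v; apply: IH; [exact: pdiffn_derive hG|exact: pdiffn_derive hH].
Qed.

Lemma pdiffnM n G H : pdiffn n G -> pdiffn n H ->
  pdiffn n (fun x t => G x t * H x t).
Proof.
elim: n G H => [|n IH] G H hG hH.
  by split => // p; apply: cvgM; [exact: (pdiffn_continuous hG)|exact: (pdiffn_continuous hH)].
apply: (@pdiffnS _ _ (fun v x t => G x t * 'D_v (H^~ t) x + H x t * 'D_v (G^~ t) x)).
- by move=> p; apply: cvgM; [exact: (pdiffn_continuous hG)|exact: (pdiffn_continuous hH)].
- move=> v x t; apply: is_deriveM; [exact: (pdiffn_is_derive _ _ _ hG)|exact: (pdiffn_is_derive _ _ _ hH)].
- move=> v; have [? ?] := (pdiffnW hG, pdiffnW hH).
  have [? ?] := (pdiffn_derive v hG, pdiffn_derive v hH).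
  by apply: pdiffnD; apply: IH.
Qed.

Lemma pdiffn_comp1 n (f : R -> R) G : diff1n n f -> pdiffn n G ->
  pdiffn n (fun x t => f (G x t)).
Proof.
have C m (g : R -> R) K : diff1n m g -> pdiffn m K ->
    continuous (fun p : V * T => g (K p.1 p.2)).
  move=> hg hK p; apply: (@continuous_comp _ _ _ (fun p : V * T => K p.1 p.2) g).
    exact: (pdiffn_continuous hK).
  exact: (diff1n_continuous hg).
elim: n f G => [|n IH] f G hf hG; first by split => //; exact: C hf hG.
apply: (@pdiffnS _ _ (fun v x t => f^`()%classic (G x t) * 'D_v (G^~ t) x)).
- exact: C hf hG.
- move=> v x t; apply: is_derive_comp1; first exact: (pdiffn_is_derive _ _ _ hG).
  by case: hf => _ [df _]; rewrite derive1E; exact/derivableP.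
- move=> v; apply: pdiffnM; last exact: pdiffn_derive hG.
  by apply: IH; [case: hf => _ []|exact: pdiffnW].
Qed.

Lemma psmooth_param (c : T -> R) : continuous c -> psmooth (fun _ t => c t).
Proof. by rewrite psmoothE => cc n; exact: pdiffn_param. Qed.

Lemma psmooth_cst (c : R) : psmooth (fun _ _ => c).
Proof. by apply: psmooth_param => ?; exact: cvg_cst. Qed.

Lemma psmooth_linear (l : V -> R) : linear l -> continuous l ->
  psmooth (fun x _ => l x).
Proof. by rewrite psmoothE => ll cl n; exact: pdiffn_linear. Qed.

Lemma psmoothD G H : psmooth G -> psmooth H -> psmooth (fun x t => G x t + H x t).
Proof. by rewrite !psmoothE => hG hH n; exact: pdiffnD. Qed.

Lemma psmoothM G H : psmooth G -> psmooth H -> psmooth (fun x t => G x t * H x t).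
Proof. by rewrite !psmoothE => hG hH n; exact: pdiffnM. Qed.

Lemma psmoothZ (a : R) G : psmooth G -> psmooth (fun x t => a * G x t).
Proof. by move=> hG; apply: psmoothM => //; exact: psmooth_cst. Qed.

Lemma psmoothB G H : psmooth G -> psmooth H -> psmooth (fun x t => G x t - H x t).
Proof.
move=> hG hH; rewrite (_ : (fun x t => _) = (fun x t => G x t + (-1) * H x t)).
  by apply: psmoothD => //; exact: psmoothZ.
by apply/funext => x; apply/funext => t; rewrite mulN1r.
Qed.

Lemma psmoothX G k : psmooth G -> psmooth (fun x t => G x t ^+ k).
Proof.
move=> hG; elim: k => [|k IH].
  rewrite (_ : (fun x t => _) = (fun _ _ => 1)); first exact: psmooth_cst.
  by apply/funext => x; apply/funext => t; rewrite expr0.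
rewrite (_ : (fun x t => _) = (fun x t => G x t * G x t ^+ k)); first exact: psmoothM.
by apply/funext => x; apply/funext => t; rewrite exprS.
Qed.

Lemma psmooth_sum (I : Type) (r : seq I) (P : pred I) (G : I -> V -> T -> R) :
  (forall i, P i -> psmooth (G i)) -> psmooth (fun x t => \sum_(i <- r | P i) G i x t).
Proof.
move=> hG; elim: r => [|i r IH].
  rewrite (_ : (fun x t => _) = (fun _ _ => 0)); first exact: psmooth_cst.
  by apply/funext => x; apply/funext => t; rewrite big_nil.
case Pi : (P i).
  rewrite (_ : (fun x t => _) = (fun x t => G i x t + \sum_(i <- r | P i) G i x t)).
    by apply: psmoothD => //; exact: hG.
  by apply/funext => x; apply/funext => t; rewrite big_cons Pi.
rewrite (_ : (fun x t => _) = (fun x t => \sum_(i <- r | P i) G i x t)) //.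
by apply/funext => x; apply/funext => t; rewrite big_cons Pi.
Qed.

Lemma psmooth_prod (I : Type) (r : seq I) (P : pred I) (G : I -> V -> T -> R) :
  (forall i, P i -> psmooth (G i)) -> psmooth (fun x t => \prod_(i <- r | P i) G i x t).
Proof.
move=> hG; elim: r => [|i r IH].
  rewrite (_ : (fun x t => _) = (fun _ _ => 1)); first exact: psmooth_cst.
  by apply/funext => x; apply/funext => t; rewrite big_nil.
case Pi : (P i).
  rewrite (_ : (fun x t => _) = (fun x t => G i x t * \prod_(i <- r | P i) G i x t)).
    by apply: psmoothM => //; exact: hG.
  by apply/funext => x; apply/funext => t; rewrite big_cons Pi.
rewrite (_ : (fun x t => _) = (fun x t => \prod_(i <- r | P i) G i x t)) //.
by apply/funext => x; apply/funext => t; rewrite big_cons Pi.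
Qed.

Lemma psmooth_comp1 (f : R -> R) G : smooth1 f -> psmooth G ->
  psmooth (fun x t => f (G x t)).
Proof. by rewrite !psmoothE smooth1E => hf hG n; exact: pdiffn_comp1. Qed.

Lemma psmooth_smooth G t : psmooth G -> smooth (G^~ t).
Proof.
rewrite smoothE => hG s x _; have hs := psmooth_iterD s hG; split.
  move: (psmooth_continuous hs) => C.
  apply: (@continuous_comp _ _ _ (fun y : V => (y, t)) (fun p : V * T => iterD s (G^~ p.2) p.1)).
    by apply: continuous_pair; [exact: cvg_id|exact: cvg_cst].
  exact: C.
by move=> v; exact: (@psmooth_derivable (fun x t => iterD s (G^~ t) x)).
Qed.

End ParameterSmooth.

Section SmoothOnParameter.
Context {R : realType} {V : normedModType R}.

(** The derivative along v has the same form, with ['D_(P v) g] in place of g, so the induction on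
    the order closes. *)
Lemma psmooth_affine {T : topologicalType} (g : V -> R) (P : V -> V) (b : T -> V) :
  smooth g -> linear P -> continuous P -> continuous b ->
  psmooth (fun x t => g (P x + b t)).
Proof.
rewrite psmoothE => hg lP cP cb n; elim: n g hg => [|n IH] g hg.
  split => // p; apply: (@continuous_comp _ _ _ (fun p : V * T => P p.1 + b p.2) g).
    apply: cvgD.
      by apply: (@continuous_comp _ _ _ fst P); [exact: continuous_fst|exact: cP].
    by apply: (@continuous_comp _ _ _ snd b); [exact: continuous_snd|exact: cb].
  exact: smooth_continuous.
apply: (@pdiffnS _ _ _ _ _ (fun v x t => 'D_(P v) g (P x + b t))).
- move=> p; apply: (@continuous_comp _ _ _ (fun p : V * T => P p.1 + b p.2) g).
    apply: cvgD.
      by apply: (@continuous_comp _ _ _ fst P); [exact: continuous_fst|exact: cP].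
    by apply: (@continuous_comp _ _ _ snd b); [exact: continuous_snd|exact: cb].
  exact: smooth_continuous.
- move=> v x t; apply/is_derive_lineP.
  rewrite (_ : (fun h => _) = (fun h : R => g (h *: P v + (P x + b t)))).
    apply: (is_derive_lineP g (P x + b t) (P v) _).1.
    by apply/derivableP; exact: smooth_derivable.
  by apply/funext => h; rewrite lP addrA.
- by move=> v; apply: (IH ('D_(P v) g)); exact: smooth_derive.
Qed.

Lemma psmooth_const {T : topologicalType} (g : V -> R) : smooth g ->
  psmooth (fun x (_ : T) => g x).
Proof.
move=> hg; rewrite (_ : (fun x _ => _) = (fun x (t : T) => g (id x + cst 0 t))).
  by apply: psmooth_affine => //; move=> ?; [exact: cvg_id|exact: cvg_cst].
by apply/funext => x; apply/funext => t; rewrite addr0.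
Qed.

End SmoothOnParameter.

(** Dividing by M + 1 instead of M covers M = 0 in the recurring choice of epsilon. *)
Lemma mulr_div_succ_le {R : realFieldType} (M e : R) : 0 <= M -> 0 < e -> M * (e / (M + 1)) <= e.
Proof.
move=> M0 e0; rewrite mulrA ler_pdivrMr; last by rewrite ltr_wpDl.
by nra.
Qed.

Section UniformContinuity.
Context {R : realType} {S T : topologicalType}.

Lemma compact_le_bound (C : set T) (g : T -> R) : compact C -> continuous g ->
  exists2 B, 0 <= B & forall t, C t -> `|g t| <= B.
Proof.
move=> cC cg; have : compact (g @` C).
  by apply: continuous_compact => //; exact: continuous_subspaceT.
move=> /compact_bounded /ex_strict_bound_gt0[B B0 HB].
by exists B; [exact: ltW|move=> t Ct; apply/ltW/HB; exists t].
Qed.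

(** The tube lemma, from the near-covering form of compactness. *)
Lemma near_uniform (C : set T) (g : S * T -> R) (a : S) (e : R) :
  compact C -> continuous g -> 0 < e ->
  \forall x \near a, forall t, C t -> `|g (x, t) - g (a, t)| < e.
Proof.
move=> /compact_near_coveringP cC cg e0.
have := cC S (nbhs a) (fun x t => `|g (x, t) - g (a, t)| < e) _.
apply => t Ct.
have c1 : {for (t, a), continuous (fun q : T * S => g (q.2, q.1))}.
  apply: (@continuous_comp _ _ _ (fun q : T * S => (q.2, q.1)) g); last exact: cg.
  by apply: continuous_pair; [exact: continuous_snd|exact: continuous_fst].
have c2 : {for (t, a), continuous (fun q : T * S => g (a, q.1))}.
  apply: (@continuous_comp _ _ _ (fun q : T * S => (a, q.1)) g); last exact: cg.
  by apply: continuous_pair; [exact: cvg_cst|exact: continuous_fst].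
have : {for (t, a), continuous (fun q : T * S => g (q.2, q.1) - g (a, q.1))}.
  by apply: cvgB.
move=> /cvgrPdist_lt /(_ e e0) /=; rewrite subrr.
by apply: filterS => q; rewrite sub0r normrN.
Qed.

End UniformContinuity.

Section SmoothFunctions.
Context {R : realType} {V : normedModType R}.
Implicit Types (phi psi : V -> R) (s : seq V).

(** With [bool] as a dummy parameter space, the closure properties of [psmooth] pass to [smooth]. *)
Lemma smooth_of_psmooth (G : V -> bool -> R) : psmooth G -> smooth (G^~ true).
Proof. exact: psmooth_smooth. Qed.

Lemma smoothM phi psi : smooth phi -> smooth psi ->
  smooth (fun x => phi x * psi x).
Proof.
move=> h1 h2; apply: (@smooth_of_psmooth (fun x _ => phi x * psi x)).
by apply: psmoothM; exact: psmooth_const.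
Qed.

Lemma smoothD phi psi : smooth phi -> smooth psi ->
  smooth (fun x => phi x + psi x).
Proof.
move=> h1 h2; apply: (@smooth_of_psmooth (fun x _ => phi x + psi x)).
by apply: psmoothD; exact: psmooth_const.
Qed.

Lemma smoothB phi psi : smooth phi -> smooth psi ->
  smooth (fun x => phi x - psi x).
Proof.
move=> h1 h2; apply: (@smooth_of_psmooth (fun x _ => phi x - psi x)).
by apply: psmoothB; exact: psmooth_const.
Qed.

Lemma smoothX phi n : smooth phi -> smooth (fun x => phi x ^+ n).
Proof.
move=> h1; apply: (@smooth_of_psmooth (fun x _ => phi x ^+ n)).
by apply: psmoothX; exact: psmooth_const.
Qed.

Lemma smooth_cst (c : R) : smooth (fun _ : V => c).
Proof. by apply: (@smooth_of_psmooth (fun _ _ => c)); exact: psmooth_cst. Qed.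

Lemma smooth_comp1 (f : R -> R) phi : smooth1 f -> smooth phi ->
  smooth (fun x => f (phi x)).
Proof.
move=> hf h; apply: (@smooth_of_psmooth (fun x _ => f (phi x))).
by apply: psmooth_comp1 => //; exact: psmooth_const.
Qed.

Lemma smooth_sum (I : Type) (r : seq I) (P : pred I) (phi : I -> V -> R) :
  (forall i, P i -> smooth (phi i)) ->
  smooth (fun x => \sum_(i <- r | P i) phi i x).
Proof.
move=> H; apply: (@smooth_of_psmooth (fun x _ => \sum_(i <- r | P i) phi i x)).
by apply: psmooth_sum => i Pi; apply: psmooth_const; exact: H.
Qed.

Lemma smooth_prod (I : Type) (r : seq I) (P : pred I) (phi : I -> V -> R) :
  (forall i, P i -> smooth (phi i)) ->
  smooth (fun x => \prod_(i <- r | P i) phi i x).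
Proof.
move=> H; apply: (@smooth_of_psmooth (fun x _ => \prod_(i <- r | P i) phi i x)).
by apply: psmooth_prod => i Pi; apply: psmooth_const; exact: H.
Qed.

Lemma iterD_eq_on (O : set V) s phi psi : open O -> (forall x, O x -> phi x = psi x) ->
  forall x, O x -> iterD s phi x = iterD s psi x.
Proof.
move=> oO E; elim: s => [//|v s IH] x Ox /=; apply: near_eq_derive.
have : nbhs x O by rewrite nbhsE; exists O.
by apply: filterS => y /IH.
Qed.

Lemma iterD_lincomb s a phi psi x : smooth phi -> smooth psi ->
  iterD s (fun x => a * phi x + psi x) x = a * iterD s phi x + iterD s psi x.
Proof.
move=> h1 h2; elim: s x => [//|v s IH] x /=.
rewrite (_ : iterD s _ = a *: iterD s phi + iterD s psi); last by apply/funext => y; rewrite IH.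
have [d1 d2] : derivable (iterD s phi) x v /\ derivable (iterD s psi) x v.
  by split; apply: smooth_derivable; exact: smooth_iterD.
exact: (@derive_val _ _ _ _ _ _ _ (is_deriveD (is_deriveZ a (derivableP d1)) (derivableP d2))).
Qed.

End SmoothFunctions.

(** * Averages over a parameter and differentiation under them *)

Section Averages.
Context {R : realType} {V : normedModType R} {T : topologicalType}.
Implicit Types (C : set T) (Lam : (T -> R) -> R) (G : V -> T -> R).

(** Plays the role of a signed measure carried by the compact set C. Sphere integrals, weighted
    interval integrals and normalised kernels are all of this kind. *)
Definition average C Lam : Prop :=
  [/\ compact C,
      forall (a : R) (g h : T -> R), continuous g -> continuous h ->
        Lam (fun t => a * g t + h t) = a * Lam g + Lam h &
      exists2 M, 0 <= M & forall (g : T -> R) e, continuous g -> 0 <= e ->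
        (forall t, C t -> `|g t| <= e) -> `|Lam g| <= M * e].

Lemma psmooth_slice G x : psmooth G -> continuous (G x).
Proof.
move=> hG t; apply: (@continuous_comp _ _ _ (fun t => (x, t)) (fun p : V * T => G p.1 p.2)).
  by apply: continuous_pair; [exact: cvg_cst|exact: cvg_id].
exact: psmooth_continuous.
Qed.

Lemma averageB C Lam (g h : T -> R) : average C Lam -> continuous g -> continuous h ->
  Lam (fun t => g t - h t) = Lam g - Lam h.
Proof.
move=> [_ L _] cg ch; rewrite (_ : (fun t => _) = (fun t => (-1) * h t + g t)).
  by rewrite L // mulN1r addrC.
by apply/funext => t; rewrite mulN1r addrC.
Qed.

Lemma averageZ C Lam a (g : T -> R) : average C Lam -> continuous g ->
  Lam (fun t => a * g t) = a * Lam g.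
Proof.
move=> [_ L _] cg.
have c0 : continuous (fun _ : T => (0 : R)) by move=> ?; exact: cvg_cst.
have L0 : Lam (fun=> 0) = 0.
  have := L 1 _ _ c0 c0; rewrite /= mulr0 addr0 mul1r.
  by move/eqP; rewrite -subr_eq subrr eq_sym => /eqP.
rewrite (_ : (fun t => _) = (fun t => a * g t + (fun _ => 0) t)).
  by rewrite L // L0 addr0.
by apply/funext => t; rewrite addr0.
Qed.

Lemma average_continuous C Lam G : average C Lam ->
  continuous (fun p : V * T => G p.1 p.2) -> continuous (fun x => Lam (G x)).
Proof.
move=> hL cG x.
have sl y : continuous (G y).
  move=> t; apply: (@continuous_comp _ _ _ (fun t => (y, t)) (fun p : V * T => G p.1 p.2)).
    by apply: continuous_pair; [exact: cvg_cst|exact: cvg_id].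
  exact: cG.
have [cC _ [M M0 HM]] := hL.
apply/cvgrPdist_le => e e0.
have e'0 : 0 < e / (M + 1) by rewrite divr_gt0 // ltr_wpDl.
have := near_uniform x cC cG e'0; apply: filterS => y /= Hy.
rewrite -(averageB hL) //; apply: le_trans (HM _ (e / (M + 1)) _ (ltW e'0) _) _.
- by move=> t; apply: cvgB; exact: sl.
- by move=> t Ct; rewrite distrC; apply/ltW/Hy.
- exact: mulr_div_succ_le.
Qed.

(** By the mean value theorem the difference quotient is a derivative at a point between x and x + h
    v, and [near_uniform] makes it close to the derivative at x uniformly for t in C. *)
Lemma average_is_derive C Lam G x v : average C Lam -> psmooth G ->
  is_derive x v (fun x => Lam (G x)) (Lam (fun t => 'D_v (G^~ t) x)).
Proof.
move=> hL hG; have [cC L [M M0 HM]] := hL.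
have hdG := psmooth_derive v hG.
suff H : (fun h : R => h^-1 *: (((fun x => Lam (G x)) \o shift x) (h *: v) - Lam (G x))) @ 0^'
    --> Lam (fun t => 'D_v (G^~ t) x).
  by split; [apply/cvg_ex; eexists; exact: H|exact: cvg_lim H].
apply/cvgrPdist_le => e e0.
have e'0 : 0 < e / (M + 1) by rewrite divr_gt0 // ltr_wpDl.
have /nbhs_ballP[r /= r0 Hr] := near_uniform x cC (psmooth_continuous hdG) e'0.
have d0 : 0 < r / (`|v| + 1) by rewrite divr_gt0 // ltr_wpDl.
near=> h.
have h0 : h != 0 by near: h; exact: nbhs_dnbhs_neq.
have hr : `|h| < r / (`|v| + 1).
  near: h; apply: dnbhs0_lt; exact: d0.
rewrite /= /GRing.scale /= -(averageB hL); [|exact: psmooth_slice..].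
rewrite -(averageZ _ hL); last by move=> t; apply: cvgB; exact: psmooth_slice.
rewrite -(averageB hL); first last.
- by move=> t; apply: cvgM; [exact: cvg_cst|apply: cvgB; exact: psmooth_slice].
- exact: psmooth_slice hdG.
apply: le_trans (HM _ (e / (M + 1)) _ (ltW e'0) _) _.
- move=> t; apply: cvgB; first exact: (@psmooth_slice _ x hdG t).
  by apply: cvgM; [exact: cvg_cst|apply: cvgB; exact: psmooth_slice].
- move=> t Ct.
  have [c ch ->] := @mean_value_line _ _ (G^~ t) x v h (fun u => @psmooth_derivable R V T G _ v t hG).
  rewrite mulrCA mulVf // mulr1 distrC; apply/ltW/(Hr (c *: v + x)) => //.
  rewrite -ball_normE /= opprD addrCA subrr addr0 normrN normrZ.
  apply: le_lt_trans (_ : `|h| * `|v| < r); first by rewrite ler_wpM2r.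
  move: hr; rewrite ltr_pdivlMr; last by rewrite ltr_wpDl.
  by apply: le_lt_trans; rewrite ler_wpM2l // lerDl.
- exact: mulr_div_succ_le.
Unshelve. all: by end_near. Qed.

Lemma average_iterD C Lam G s : average C Lam -> psmooth G ->
  iterD s (fun x => Lam (G x)) = fun x => Lam (fun t => iterD s (G^~ t) x).
Proof.
(* The last vector of s is differentiated first, so peeling s from the end moves the innermost
   derivative under the average. *)
move=> hL; elim/last_ind: s G => [//|s v IH] G hG.
rewrite iterD_rcons (_ : 'D_v _ = fun x => Lam (fun t => 'D_v (G^~ t) x)).
  rewrite (IH _ (psmooth_derive v hG)); apply/funext => x; congr Lam.
  by apply/funext => t; rewrite iterD_rcons.
apply/funext => x; exact: (@derive_val _ _ _ _ _ _ _ (average_is_derive x v hL hG)).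
Qed.

Lemma average_smooth C Lam G : average C Lam -> psmooth G ->
  smooth (fun x => Lam (G x)).
Proof.
rewrite smoothE => hL hG s x _; have hs := psmooth_iterD s hG; rewrite (average_iterD s hL hG); split.
  exact: (average_continuous hL (psmooth_continuous hs)).
by move=> v; exact: (@ex_derive _ _ _ _ _ _ _ (average_is_derive x v hL hs)).
Qed.

End Averages.

(** * Functionals on smooth functions *)

Section Functionals.
Context {R : realType} {V : normedModType R}.
Implicit Types (phi psi : V -> R) (s : seq V) (u : (V -> R) -> R) (K : set V).

(* The real part, or the imaginary part, of a compactly supported distribution
   restricted to real test functions. *)
Definition smooth_functional K u : Prop :=
  [/\ compact K,
      forall (a : R) phi psi, smooth phi -> smooth psi ->
        u (fun x => a * phi x + psi x) = a * u phi + u psi &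
      exists (S : seq (seq V)) (M : R), 0 <= M /\
        forall phi e, smooth phi -> 0 <= e ->
          (forall s x, s \in S -> K x -> `|iterD s phi x| <= e) -> `|u phi| <= M * e].

Lemma functional0 K u : smooth_functional K u -> u (fun=> 0) = 0.
Proof.
move=> [_ L _]; have := L 1 _ _ (smooth_cst 0) (smooth_cst 0).
by rewrite /= mulr0 addr0 mul1r => /eqP; rewrite -subr_eq subrr eq_sym => /eqP.
Qed.

Lemma functionalZ K u a phi : smooth_functional K u -> smooth phi ->
  u (fun x => a * phi x) = a * u phi.
Proof.
move=> hu hphi; have [_ L _] := hu.
rewrite (_ : (fun x => _) = (fun x => a * phi x + (fun=> 0) x)).
  by rewrite L ?(functional0 hu) ?addr0//; exact: smooth_cst.
by apply/funext => x; rewrite addr0.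
Qed.

Lemma functionalD K u phi psi : smooth_functional K u ->
  smooth phi -> smooth psi ->
  u (fun x => phi x + psi x) = u phi + u psi.
Proof.
move=> [_ L _] h1 h2; rewrite (_ : (fun x => _) = (fun x => 1 * phi x + psi x)).
  by rewrite L // mul1r.
by apply/funext => x; rewrite mul1r.
Qed.

Lemma functionalB K u phi psi : smooth_functional K u ->
  smooth phi -> smooth psi ->
  u (fun x => phi x - psi x) = u phi - u psi.
Proof.
move=> [_ L _] h1 h2; rewrite (_ : (fun x => _) = (fun x => (-1) * psi x + phi x)).
  by rewrite L // mulN1r addrC.
by apply/funext => x; rewrite mulN1r addrC.
Qed.

Lemma functional_sum K u (I : Type) (r : seq I) (phi : I -> V -> R) :
  smooth_functional K u -> (forall i, smooth (phi i)) ->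
  u (fun x => \sum_(i <- r) phi i x) = \sum_(i <- r) u (phi i).
Proof.
move=> hu hphi; elim: r => [|i r IH].
  rewrite big_nil -[RHS](functional0 hu); congr u.
  by apply/funext => x; rewrite big_nil.
rewrite big_cons -IH -(functionalD hu) //; last exact: smooth_sum.
by congr u; apply/funext => x; rewrite big_cons.
Qed.

(** The kernel of u is closed for uniform convergence on K of finitely many derivatives; the
    limiting arguments below all pass through this form. *)
Lemma functional_approx K u phi : smooth_functional K u -> smooth phi ->
  (forall (S : seq (seq V)) e, 0 < e -> exists psi, [/\ smooth psi, u psi = 0 &
    forall s x, s \in S -> K x -> `|iterD s phi x - iterD s psi x| <= e]) ->
  u phi = 0.
Proof.
move=> hu hphi H; have [_ L [S [M [M0 HM]]]] := hu.
apply/eqP; rewrite -normr_le0; apply/ler_addgt0Pl => e e0; rewrite addr0.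
have e'0 : 0 < e / (M + 1) by rewrite divr_gt0 // ltr_wpDl.
have [psi [hpsi u0 Hpsi]] := H S _ e'0.
rewrite -[u phi]subr0 -u0 -(functionalB hu) //.
apply: le_trans (HM _ (e / (M + 1)) (smoothB hphi hpsi) (ltW e'0) _) _; last first.
  exact: mulr_div_succ_le.
move=> s x sS Kx; rewrite (_ : iterD s _ x = iterD s phi x - iterD s psi x) ?Hpsi //.
rewrite (_ : (fun x => _) = (fun x => (-1) * psi x + phi x)).
  by rewrite iterD_lincomb // mulN1r addrC.
by apply/funext => y; rewrite mulN1r addrC.
Qed.

(** On the neighbourhood O of K all derivatives of phi - psi vanish, so 0 approximates it
    exactly. *)
Lemma functional_germ K u (O : set V) phi psi : smooth_functional K u ->
  smooth phi -> smooth psi ->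
  open O -> K `<=` O -> (forall x, O x -> phi x = psi x) -> u phi = u psi.
Proof.
move=> hu h1 h2 oO KO E; apply/eqP; rewrite -subr_eq0 -(functionalB hu) //; apply/eqP.
apply: (functional_approx hu); first exact: smoothB.
move=> S e e0; exists (fun=> 0); split; [exact: smooth_cst|exact: functional0 hu|].
move=> s x _ Kx; rewrite (@iterD_eq_on _ _ O _ _ (fun=> 0) oO) ?subrr ?normr0 ?ltW//.
- by move=> y Oy; rewrite E // subrr.
- exact: KO.
Qed.

(* A sequence of averages concentrating at t0 behaves like evaluation at t0. *)
Lemma functional_concentrate {T : topologicalType} (C : set T) (t0 : T) K u
    (G : V -> T -> R) : smooth_functional K u -> psmooth G -> compact C ->
  (forall (U : set T) (eta : R), nbhs t0 U -> 0 < eta ->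
    exists Lam : (T -> R) -> R,
    [/\ forall (a : R) (g h : T -> R), continuous g -> continuous h ->
          Lam (fun t => a * g t + h t) = a * Lam g + Lam h,
        Lam (fun=> 1) = 1,
        forall g e B, continuous g -> 0 <= e -> 0 <= B ->
          (forall t, C t -> U t -> `|g t| <= e) -> (forall t, C t -> `|g t| <= B) ->
          `|Lam g| <= e + eta * B &
        u (fun x => Lam (G x)) = 0]) ->
  u (G^~ t0) = 0.
Proof.
move=> hu hG cC H; have [cK _ _] := hu.
apply: (functional_approx hu); first exact: psmooth_smooth.
move=> S e e0; pose d s (p : V * T) := iterD s (G^~ p.2) p.1 - iterD s (G^~ t0) p.1.
have cd s : continuous (d s).
  move=> p; apply: cvgB; first exact: (psmooth_continuous (psmooth_iterD s hG)).
  apply: (@continuous_comp _ _ _ fst (iterD s (G^~ t0))); first exact: continuous_fst.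
  exact/smooth_continuous/smooth_iterD/psmooth_smooth.
have e20 : 0 < e / 2 by rewrite divr_gt0.
have [B B0 HB] : exists2 B, 0 <= B & forall s x t, s \in S -> K x -> C t -> `|d s (x, t)| <= B.
  elim: S {H} => [|s S [B B0 HB]]; first by exists 0.
  have [B' B'0 HB'] := compact_le_bound (compact_setX cK cC) (cd s).
  exists (B + B'); first exact: addr_ge0.
  move=> s' x t; rewrite inE => /orP[/eqP ->|s'S] Kx Ct.
    by apply: le_trans (HB' (x, t) _) _ => //; rewrite lerDr.
  by apply: le_trans (HB _ _ _ s'S Kx Ct) _; rewrite lerDl.
have Unear : \forall t \near t0, forall s x, s \in S -> K x -> `|d s (x, t)| <= e / 2.
  elim: S {H HB} => [|s S IH]; first by near=> t.
  have cds : continuous (fun q : T * V => d s (q.2, q.1)).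
    move=> q; apply: (@continuous_comp _ _ _ (fun q : T * V => (q.2, q.1)) (d s)); last exact: cd.
    by apply: continuous_pair; [exact: continuous_snd|exact: continuous_fst].
  have := near_uniform t0 cK cds e20; apply: filterS2 IH => t IH Ht s' x.
  rewrite inE => /orP[/eqP -> Kx|]; last exact: IH.
  have := Ht x Kx; rewrite /= [d s (x, t0)]/d /= subrr subr0; exact: ltW.
(* With this bound on the mass away from t0, the far part contributes at most e / 2, like the near
   part. *)
have eta0 : 0 < (e / 2) / (B + 1) by rewrite divr_gt0 // ltr_wpDl.
have [Lam [L L1 HL u0]] := H _ _ Unear eta0.
have aL : average C Lam.
  split => //; exists (1 + e / 2 / (B + 1)) => [|g e' cg e'0 He'].
    by rewrite addr_ge0 // ltW.
  by rewrite mulrDl mul1r; apply: HL => // t Ct _; exact: He'.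
exists (fun x => Lam (G x)); split => //; first exact: average_smooth aL hG.
move=> s x sS Kx; rewrite (average_iterD s aL hG) distrC.
have cs : continuous (fun t => iterD s (G^~ t) x) by exact: (@psmooth_slice R V T (fun x t => iterD s (G^~ t) x) x (psmooth_iterD s hG)).
have cc : continuous (fun _ : T => iterD s (G^~ t0) x) by move=> ?; exact: cvg_cst.
have c1 : continuous (fun _ : T => (1 : R)) by move=> ?; exact: cvg_cst.
(* The value at t0 times Lam(1) = 1 is the average of a constant, so the difference is the average
   of a difference. *)
rewrite -[X in `|_ - X|]mulr1 -[X in `|_ - _ * X|]L1 -(averageZ _ aL) // -(averageB aL) //.
- have -> : e = e / 2 + e / 2 by rewrite -splitr.
  apply: le_trans (HL _ (e / 2) B _ (ltW e20) B0 _ _) _.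
  + by move=> t; apply: cvgB => //; [exact: cs|rewrite mulr1; exact: cc].
  + by move=> t _ Ut; rewrite mulr1; exact: Ut.
  + by move=> t Ct; rewrite mulr1; exact: (HB s x t).
  + by rewrite lerD2l mulrC mulr_div_succ_le.
- by move=> t; rewrite mulr1; exact: cc.
Unshelve. all: by end_near. Qed.

End Functionals.

(** * Multiplication by high powers of a function smaller than 1 *)

Section Neumann.
Context {R : realType} {V : normedModType R}.

Lemma bin_expr_le (q p : R) n j : 0 <= q -> 0 <= p -> (j <= n)%N ->
  'C(n, j)%:R * q ^+ (n - j) * p ^+ j <= (q + p) ^+ n.
Proof.
move=> q0 p0 jn; rewrite exprDn (bigD1 (inord j)) //= inordK ?ltnS //.
rewrite -mulrA mulr_natl lerDl; apply: sumr_ge0 => i _.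
by rewrite mulrn_wge0 // mulr_ge0 // exprn_ge0.
Qed.

(** Choose p > 0 with q + p < 1. One term of the binomial expansion bounds C(n, j) q^(n-j) p^j by (q
    + p)^n, which tends to 0, while j! / p^j stays fixed. *)
Lemma ffact_expr_small (q : R) (j : nat) (e : R) : 0 <= q < 1 -> 0 < e ->
  \forall n \near \oo, (n ^_ j)%:R * q ^+ (n - j) <= e.
Proof.
move=> /andP[q0 q1] e0; pose p := (1 - q) / 2.
have p0 : 0 < p by rewrite divr_gt0 // subr_gt0.
have r1 : `|q + p| < 1 by rewrite /p ger0_norm; lra.
have a0 : 0 < e * p ^+ j / j`!%:R by rewrite divr_gt0 ?mulr_gt0 ?exprn_gt0 // ltr0n fact_gt0.
have /cvgrPdist_le /(_ _ a0) := cvg_expr r1.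
move=> H; near=> n.
have jn : (j <= n)%N by near: n; exact: nbhs_infty_ge.
have : `|0 - (q + p) ^+ n| <= e * p ^+ j / j`!%:R by near: n.
rewrite sub0r normrN ger0_norm; last by rewrite exprn_ge0 // addr_ge0 // ltW.
move=> H2; have := le_trans (bin_expr_le q0 (ltW p0) jn) H2.
rewrite ler_pdivlMr; last by rewrite ltr0n fact_gt0.
rewrite -bin_ffact natrM => H3.
have pj : 0 < p ^+ j by rewrite exprn_gt0.
rewrite -(ler_pM2r pj); apply: le_trans H3.
by rewrite le_eqVlt; apply/orP; left; apply/eqP; ring.
Unshelve. all: by end_near. Qed.

Lemma ffactnSr_ring n j : (n ^_ j.+1)%:R = (n ^_ j)%:R * (n - j)%:R :> R.
Proof. by rewrite ffactnSr natrM. Qed.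

Lemma is_derive_exprn (h : V -> R) (x v : V) (dh : R) n : is_derive x v h dh ->
  is_derive x v (fun y => h y ^+ n) (n%:R * h x ^+ n.-1 * dh).
Proof.
move=> H; have := @is_derive_comp1 R V h x v dh (fun t => t ^+ n) (n%:R * h x ^+ n.-1) H.
apply; have := @is_deriveX _ _ id n (h x) 1 1 (is_derive_id _ _).
rewrite (_ : id ^+ n = (fun t : R => t ^+ n)).
  by move/is_derive_eq; apply; rewrite /GRing.scale /= mulr1 mulr_natl.
by apply/funext => t; elim: n => [|n IH] //; rewrite !exprS /= -IH.
Qed.

(* The falling factorials n ^_ j grow polynomially in n, so these derivatives
   tend to 0 uniformly where |h| <= q < 1. *)
Lemma iterD_mulX (s : seq V) (psi h : V -> R) : smooth psi -> smooth h ->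
  exists c : nat -> V -> R, [/\ forall j, smooth (c j),
    forall j, (size s < j)%N -> c j = fun=> 0 &
    forall n x, iterD s (fun y => psi y * h y ^+ n) x =
      \sum_(j < (size s).+1) (n ^_ j)%:R * h x ^+ (n - j) * c j x].
Proof.
move=> hpsi hh; elim: s => [|v s [c [hc c0 Hc]]].
  exists (fun j => if j is 0%N then psi else fun=> 0); split.
  - by case=> // _; exact: smooth_cst.
  - by case.
  - by move=> n x; rewrite big_ord1 /= subn0 mul1r mulrC.
(* Differentiating h^(n-j) produces a factor n - j, which turns [n ^_ j] into [n ^_ j.+1]; hence the
   term coming from index j - 1. Truncated subtraction is harmless because the falling factorial
   then vanishes. *)
exists (fun j x => 'D_v (c j) x + (if j is j'.+1 then c j' x * 'D_v h x else 0)); split.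
- have dc j : smooth ('D_v (c j)) by exact: smooth_derive.
    case=> [|j]; apply: smoothD; [exact: dc|exact: smooth_cst|exact: dc|].
    by apply: smoothM; [exact: hc|exact: smooth_derive].
  - move=> [//|j] /= sj; apply/funext => x; rewrite (c0 j) // (c0 j.+1) ?mul0r ?addr0.
    exact: derive_cst.
  exact: ltnW.
- move=> n x /=.
  rewrite (_ : iterD s _ = fun y => \sum_(j < (size s).+1) (n ^_ j)%:R * h y ^+ (n - j) * c j y); last first.
    by apply/funext => y; exact: Hc.
  have dh : is_derive x v h ('D_v h x) by apply/derivableP; exact: smooth_derivable.
  have D j : is_derive x v (fun y => (n ^_ j)%:R * h y ^+ (n - j) * c j y)
      ((n ^_ j)%:R * h x ^+ (n - j) * 'D_v (c j) x +
       (n ^_ j.+1)%:R * h x ^+ (n - j.+1) * (c j x * 'D_v h x)).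
    have dc : is_derive x v (c j) ('D_v (c j) x).
      by apply/derivableP; exact: smooth_derivable.
    have := is_deriveM (is_deriveM (is_derive_cst ((n ^_ j)%:R : R) x v)
       (is_derive_exprn (n - j) dh)) dc.
    move/is_derive_eq; apply; rewrite /GRing.scale /= subnS ffactnSr_ring.
    rewrite (_ : (cst _ * _) x = (n ^_ j)%:R * h x ^+ (n - j)) //; ring.
  rewrite (_ : (fun y => _) = \sum_(j < (size s).+1) (fun y => (n ^_ j)%:R * h y ^+ (n - j) * c j y)); last first.
    by apply/funext => y; rewrite fct_sumE.
  rewrite (@derive_val _ _ _ _ _ _ _ (is_derive_sum (fun j : 'I_(size s).+1 => D j))).
  rewrite big_split /=; under [RHS]eq_bigr do rewrite mulrDr; rewrite big_split /=; congr (_ + _).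
    rewrite [RHS]big_ord_recr /= (c0 (size s).+1) // (_ : 'D_v _ x = 0) ?mulr0 ?addr0 //.
    exact: derive_cst.
  by rewrite [RHS]big_ord_recl /= mulr0 add0r.
Qed.

(** By [iterD_mulX] and [ffact_expr_small], psi h^n tends to 0 on K with all its derivatives. Hence
    psi - psi h^n, which u annihilates, tends to psi. *)
Lemma functional_neumann (K : set V) u psi h (q : R) : smooth_functional K u ->
  smooth psi -> smooth h -> 0 <= q < 1 ->
  (forall x, K x -> `|h x| <= q) ->
  (forall n, u (fun x => psi x * h x ^+ n) = u psi) -> u psi = 0.
Proof.
move=> hu hpsi hh /andP[q0 q1] Hq Hn; have [cK _ _] := hu.
have hX n : smooth (fun x => psi x * h x ^+ n) by apply: smoothM => //; exact: smoothX.
apply: (functional_approx hu) => // S e e0.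
suff [n Hsmall] : exists n, forall s x, s \in S -> K x ->
    `|iterD s (fun x => psi x * h x ^+ n) x| <= e.
  exists (fun x => psi x - psi x * h x ^+ n); split.
  - exact: smoothB.
  - by rewrite (functionalB hu) // Hn subrr.
  - move=> s x sS Kx.
    rewrite (_ : (fun x => _) = (fun x => (-1) * (psi x * h x ^+ n) + psi x)).
      by rewrite iterD_lincomb // mulN1r opprD opprK addrCA subrr addr0 Hsmall.
    by apply/funext => y; rewrite mulN1r addrC.
suff : \forall n \near \oo, forall s x, s \in S -> K x ->
    `|iterD s (fun x => psi x * h x ^+ n) x| <= e.
  by move=> [N _ HN]; exists N; apply: HN => /=.
elim: S => [|s S IH]; first by near=> n.
have [c [hc _ Hc]] := iterD_mulX s hpsi hh.
suff : \forall n \near \oo, forall x, K x -> `|iterD s (fun x => psi x * h x ^+ n) x| <= e.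
  move: IH; apply: filterS2 => n IH1 IH2 s' x; rewrite inE => /orP[/eqP ->|]; first exact: IH2.
  exact: IH1.
have [B B0 HB] : exists2 B, 0 <= B & forall j x, (j < (size s).+1)%N -> K x -> `|c j x| <= B.
  elim: (size s).+1 => [|k [B B0 HB]]; first by exists 0.
  have [B' B'0 HB'] := compact_le_bound cK (smooth_continuous (hc k)).
  exists (B + B'); first exact: addr_ge0.
  move=> j x; rewrite ltnS leq_eqVlt => /orP[/eqP ->|jk] Kx.
    by apply: le_trans (HB' x Kx) _; rewrite lerDr.
  by apply: le_trans (HB _ _ jk Kx) _; rewrite lerDl.
(* The error e is shared among the (size s).+1 terms of the sum, each with a coefficient bounded by
   B. *)
have e'0 : 0 < e / (size s).+1%:R / (B + 1).
  by rewrite !divr_gt0 // ltr_wpDl.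
have : \forall n \near \oo, forall j, (j < (size s).+1)%N ->
    (n ^_ j)%:R * q ^+ (n - j) <= e / (size s).+1%:R / (B + 1).
  elim: (size s).+1 (e / _ / _) e'0 => [|k IH2] e' e'0; first by near=> n.
  have q01 : 0 <= q < 1 by rewrite q0.
  have := ffact_expr_small k q01 e'0; move: (IH2 _ e'0); apply: filterS2 => n I1 I2 j.
  by rewrite ltnS leq_eqVlt => /orP[/eqP ->//|]; exact: I1.
apply: filterS => n Hsm x Kx; rewrite Hc.
have -> : e = \sum_(j < (size s).+1) (e / (size s).+1%:R).
  by rewrite sumr_const card_ord -[RHS]mulr_natr divfK // pnatr_eq0.
apply: le_trans (ler_norm_sum _ _ _) _; apply: ler_sum => j _.
rewrite !normrM normr_nat normrX.
apply: le_trans (_ : (e / (size s).+1%:R / (B + 1)) * B <= _); last first.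
  rewrite mulrC; apply: mulr_div_succ_le => //; exact: divr_gt0.
apply: ler_pM => //; [ |exact: HB].
apply: le_trans (Hsm j (ltn_ord j)); apply: ler_wpM2l => //.
by apply: lerXn2r; rewrite ?nnegrE // Hq.
Unshelve. all: by end_near. Qed.

End Neumann.

(** * Bump functions *)

Section Smooth1Calculus.
Context {R : realType}.
Implicit Types f g : R -> R.

(** One-variable C^n functions are the parametric ones on [R^o] with a dummy parameter; sums,
    products and compositions are inherited through this and its converse. *)
Lemma diff1n_pdiffn n f : diff1n n f -> pdiffn n (fun (x : R^o) (_ : bool) => f x).
Proof.
move=> hf; apply: (@pdiffn_comp1 _ _ _ n f (fun (x : R^o) (_ : bool) => x)) => //.
by apply: (@pdiffn_linear _ _ _ n (@id R^o)) => // ?; exact: cvg_id.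
Qed.

Lemma pdiffn_diff1n n f : pdiffn n (fun (x : R^o) (_ : bool) => f x) -> diff1n n f.
Proof.
elim: n f => [|n IH] f hf.
  split => // x; have := pdiffn_continuous hf => C.
  apply: (@continuous_comp _ _ _ (fun y : R^o => (y, true)) (fun p : R^o * bool => f p.1)).
    by apply: continuous_pair; [exact: cvg_id|exact: cvg_cst].
  exact: C.
have [_ /(_ 1) [df Hdf]] := hf.
split; first by apply: derivable_continuous1 => x; exact: (df x true).
split => [x|]; first exact: (df x true).
apply: IH; rewrite (_ : (fun x _ => _) = (fun (x : R^o) (_ : bool) => 'D_1 f x)) //.
by apply/funext => x; apply/funext => _; rewrite derive1E.
Qed.

Lemma diff1nD n f g : diff1n n f -> diff1n n g -> diff1n n (fun x => f x + g x).
Proof.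
by move=> /diff1n_pdiffn hf /diff1n_pdiffn hg; apply: pdiffn_diff1n; exact: pdiffnD.
Qed.

Lemma diff1nM n f g : diff1n n f -> diff1n n g -> diff1n n (fun x => f x * g x).
Proof.
by move=> /diff1n_pdiffn hf /diff1n_pdiffn hg; apply: pdiffn_diff1n; exact: pdiffnM.
Qed.

Lemma diff1n_cst n (c : R) : diff1n n (fun=> c).
Proof.
by apply: pdiffn_diff1n; apply: (@pdiffn_param _ _ _ n (fun=> c)) => ?; exact: cvg_cst.
Qed.

Lemma diff1nZ n (a : R) f : diff1n n f -> diff1n n (fun x => a * f x).
Proof. by move=> hf; apply: diff1nM => //; exact: diff1n_cst. Qed.

Lemma diff1n_comp n f g : diff1n n f -> diff1n n g -> diff1n n (fun x => g (f x)).
Proof.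
by move=> /diff1n_pdiffn hf hg; apply: pdiffn_diff1n; exact: pdiffn_comp1.
Qed.

Lemma smooth1D f g : smooth1 f -> smooth1 g -> smooth1 (fun x => f x + g x).
Proof. by rewrite !smooth1E => hf hg n; exact: diff1nD. Qed.

Lemma smooth1M f g : smooth1 f -> smooth1 g -> smooth1 (fun x => f x * g x).
Proof. by rewrite !smooth1E => hf hg n; exact: diff1nM. Qed.

Lemma smooth1_cst (c : R) : smooth1 (fun=> c).
Proof. by rewrite smooth1E => n; exact: diff1n_cst. Qed.

Lemma smooth1_id : smooth1 (fun x : R => x).
Proof.
rewrite smooth1E => n; apply: pdiffn_diff1n.
by apply: (@pdiffn_linear _ _ _ n (@id R^o)) => // ?; exact: cvg_id.
Qed.

Lemma smooth1_aff (a b : R) : smooth1 (fun x => a * x + b).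
Proof.
by apply: smooth1D; [apply: smooth1M; [exact: smooth1_cst|exact: smooth1_id]|exact: smooth1_cst].
Qed.

Lemma smooth1X f n : smooth1 f -> smooth1 (fun x => f x ^+ n).
Proof.
move=> hf; elim: n => [|n IH].
  by rewrite (_ : (fun x => _) = (fun=> 1)); [exact: smooth1_cst|apply/funext => x; rewrite expr0].
rewrite (_ : (fun x => _) = (fun x => f x * f x ^+ n)); first exact: smooth1M.
by apply/funext => x; rewrite exprS.
Qed.

Lemma smooth1_comp f g : smooth1 f -> smooth1 g -> smooth1 (fun x => g (f x)).
Proof. by rewrite !smooth1E => hf hg n; exact: diff1n_comp. Qed.

Lemma is_derive_inv1 f (x df : R) : f x != 0 -> is_derive x 1 f df ->
  is_derive x 1 (fun y => (f y)^-1) (- df * ((f x)^-1 * (f x)^-1)).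
Proof.
move=> fx0 [dfx <-]; split; first exact: derivableV.
rewrite (@deriveV _ _ f x 1) // /GRing.scale /=.
by rewrite mulrC mulrN mulNr expr2 invfM.
Qed.

Lemma smooth1V f : (forall x, f x != 0) -> smooth1 f -> smooth1 (fun x => (f x)^-1).
Proof.
move=> f0 hf; rewrite smooth1E; elim=> [|n IH].
  split => // x; apply: cvgV => //; exact: smooth1_continuous.
apply: (@diff1nS _ n (fun x => (f x)^-1) (fun x => - f^`()%classic x * ((f x)^-1 * (f x)^-1))).
  by move=> x; apply: is_derive_inv1 => //; exact: smooth1_is_derive.
apply: diff1nM; last exact: diff1nM.
rewrite (_ : (fun x => _) = (fun x => (-1) * f^`()%classic x)).
  by apply: diff1nZ; move: (smooth1_derive hf); rewrite smooth1E.
by apply/funext => x; rewrite mulN1r.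
Qed.

(** This is the real power f^a. Its derivative is itself times a f' / f, which drives the
    induction. *)
Lemma smooth1_expR_ln f (a : R) : (forall x, 0 < f x) -> smooth1 f ->
  smooth1 (fun x => expR (a * ln (f x))).
Proof.
move=> f0 hf; rewrite smooth1E => n; elim: n => [|n IH].
  split => // x; apply: (@continuous_comp _ _ _ (fun x => a * ln (f x)) expR); last exact: continuous_expR.
  have C : {for x, continuous (@ln R \o f)}.
    apply: continuous_comp; first exact: (smooth1_continuous hf).
    exact: continuous_ln.
  by apply: cvgM; [exact: cvg_cst|exact: C].
apply: (@diff1nS _ n (fun x => expR (a * ln (f x))) (fun x => (a * (f^`()%classic x * (f x)^-1)) * expR (a * ln (f x)))).
  move=> x; have Hf := smooth1_is_derive x hf.
  have Hl := is_derive1_ln (f0 x).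
  have H1 := @is_derive_comp1 _ R^o f x 1 _ (@ln R) _ Hf Hl.
  have H2 := is_deriveZ a H1.
  have H3 := @is_derive_comp1 _ R^o (a *: fun y => ln (f y)) x 1 _ expR _ H2 (is_derive_expR _).
  apply: (is_derive_eq H3); rewrite /GRing.scale /=; ring.
apply: diff1nM => //; apply: diff1nZ; apply: diff1nM.
  by move: (smooth1_derive hf); rewrite smooth1E.
have f0' x : f x != 0 by rewrite gt_eqF.
by move: (smooth1V f0' hf); rewrite smooth1E.
Qed.

End Smooth1Calculus.

Section Flat.
Context {R : realType}.

(** The family t^(-k) exp(-1/t), extended by 0. Its linear span is stable under differentiation, so
    smoothness of all members follows by one induction; k = 0 is the classical flat function. *)
Definition flat (k : nat) (t : R) : R := if 0 < t then t^-1 ^+ k * expR (- t^-1) else 0.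

(** The exponential exp(1/t) exceeds its Taylor term of order k + 1. This bound yields the
    derivative 0 at the origin. *)
Lemma flat_le k (t : R) : 0 < t -> flat k t <= (k.+1)`!%:R * t.
Proof.
move=> t0; rewrite /flat t0 expRN.
have H : t^-1 ^+ k.+1 / k.+1`!%:R <= expR t^-1.
  have ti : 0 <= t^-1 by rewrite invr_ge0 ltW.
  by apply: le_trans (expR_ge1Dxn k ti); rewrite lerDr.
have F0 : 0 < k.+1`!%:R :> R by rewrite ltr0n fact_gt0.
rewrite ler_pdivrMr ?expR_gt0 //; move: H; rewrite ler_pdivrMr // exprS => H.
have := ler_wpM2l (ltW t0) H; rewrite mulrA divff ?gt_eqF // mul1r; lra.
Qed.

Lemma is_derive_flat k (t : R) : is_derive t 1 (flat k) (- k%:R * flat k.+1 t + flat k.+2 t).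
Proof.
have [t0|t0|t0] := ltgtP t 0.
- rewrite {2 3}/flat !(ltNge 0 t) (ltW t0) /= mulr0 addr0.
  apply: (near_eq_is_derive _ (is_derive_cst (0 : R) t 1)).
  have := lt_nbhsl t0; apply: filterS => y y0.
  by rewrite /flat ltNge (ltW y0).
- rewrite {2 3}/flat t0.
  have tn0 : id t != 0 by rewrite gt_eqF.
  have Hi := is_derive_inv1 tn0 (is_derive_id t 1).
  have Hx := @is_derive_exprn _ R^o (fun y => y^-1) t 1 _ k Hi.
  have He := @is_derive_comp1 _ R^o (- (fun y : R => y^-1)) t 1 _ expR _ (is_deriveN Hi) (is_derive_expR _).
  have Hf : {near t, (fun y => y^-1 ^+ k) * (fun y => expR (- y^-1)) =1 flat k}.
    by have := lt_nbhsr t0; apply: filterS => y y0; rewrite /flat y0.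
  apply: (is_derive_eq (near_eq_is_derive Hf (is_deriveM Hx He))).
  rewrite /GRing.scale /=; case: k {Hx Hf} => [|k]; rewrite ?expr0 ?exprS /=; ring.
- rewrite t0 {2 3}/flat ltxx mulr0 addr0.
  suff H : (fun h : R => h^-1 *: ((flat k \o shift 0) (h *: 1) - flat k 0)) @ 0^' --> (0 : R).
    by split; [apply/cvg_ex; eexists; exact: H|exact: cvg_lim H].
  have F0 : 0 < k.+2`!%:R :> R by rewrite ltr0n fact_gt0.
  apply/cvgrPdist_le => e e0; near=> h.
  have h0 : h != 0 by near: h; exact: nbhs_dnbhs_neq.
  rewrite /= addr0 [h *: 1]mulr1 {2}/flat ltxx subr0 sub0r normrN /GRing.scale /=.
  have [hp|hn] := ltP 0 h; last by rewrite /flat ltNge hn /= mulr0 normr0 ltW.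
  rewrite ger0_norm; last first.
    rewrite /flat hp !mulr_ge0 ?invr_ge0 ?exprn_ge0 ?invr_ge0 ?expR_ge0 // ltW //.
  (* The difference quotient at 0 is the next member of the family, hence bounded by a multiple of
     h. *)
  have -> : h^-1 * flat k h = flat k.+1 h by rewrite /flat hp exprS mulrA.
  apply: le_trans (flat_le _ hp) _.
  rewrite mulrC -ler_pdivlMr // -[h]ger0_norm ?ltW //.
  by near: h; exact: (dnbhs0_lt (divr_gt0 e0 F0)).
Unshelve. all: by end_near. Qed.

Lemma smooth1_flat k : smooth1 (flat k).
Proof.
rewrite smooth1E => n; elim: n k => [|n IH] k.
  split => //; apply: derivable_continuous1 => x.
  exact: (@ex_derive _ _ _ _ _ _ _ (is_derive_flat k x)).
apply: (@diff1nS _ _ _ (fun t => - k%:R * flat k.+1 t + flat k.+2 t)).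
  exact: is_derive_flat.
by apply: diff1nD => //; exact: diff1nZ.
Qed.

End Flat.

Section Bumps.
Context {R : realType}.

Definition bump (d t : R) : R := flat 0 (d ^+ 2 - t ^+ 2).

Lemma flat0_gt0 (t : R) : (0 < flat 0 t) = (0 < t).
Proof.
rewrite /flat; case: ifP => [_|]; last by rewrite ltxx.
by rewrite expr0 mul1r expR_gt0.
Qed.

Lemma flat0_ge0 (t : R) : 0 <= flat 0 t.
Proof. by rewrite /flat; case: ifP => // _; rewrite expr0 mul1r expR_ge0. Qed.

Lemma flat0_eq0 (t : R) : t <= 0 -> flat 0 t = 0.
Proof. by rewrite /flat ltNge => ->. Qed.

Lemma smooth1_bump d : smooth1 (bump d).
Proof.
apply: (@smooth1_comp _ (fun t => d ^+ 2 - t ^+ 2) (flat 0)); last exact: smooth1_flat.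
rewrite (_ : (fun t => _) = (fun t => (-1) * t ^+ 2 + d ^+ 2)).
  apply: smooth1D; last exact: smooth1_cst.
  by apply: smooth1M; [exact: smooth1_cst|apply: smooth1X; exact: smooth1_id].
by apply/funext => t; rewrite mulN1r addrC.
Qed.

Lemma bump_ge0 d t : 0 <= bump d t. Proof. exact: flat0_ge0. Qed.

Lemma bump_gt0 d t : `|t| < d -> 0 < bump d t.
Proof.
move=> td; have t0 := normr_ge0 t; rewrite /bump flat0_gt0 subr_gt0 -[t ^+ 2]real_normK ?num_real //.
by nra.
Qed.

Lemma bump_eq0 d t : 0 <= d -> d <= `|t| -> bump d t = 0.
Proof.
move=> d0 dt; apply: flat0_eq0; rewrite subr_le0 -[t ^+ 2]real_normK ?num_real //.
by rewrite lerXn2r // nnegrE.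
Qed.

Definition step (t : R) : R := flat 0 t / (flat 0 t + flat 0 (1 - t)).

Let step_den t : 0 < flat 0 t + flat 0 (1 - t) :> R.
Proof.
have [t0|t0] := ltP 0 t.
  by rewrite ltr_pwDl ?flat0_gt0 // flat0_ge0.
by rewrite ltr_wpDl ?flat0_ge0 // flat0_gt0; lra.
Qed.

Lemma smooth1_step : smooth1 step.
Proof.
apply: smooth1M; first exact: smooth1_flat.
apply: smooth1V; first by move=> t; rewrite gt_eqF.
apply: smooth1D; first exact: smooth1_flat.
apply: (@smooth1_comp _ (fun t => 1 - t) (flat 0)); last exact: smooth1_flat.
rewrite (_ : (fun t => _) = (fun t => (-1) * t + 1)); first exact: smooth1_aff.
by apply/funext => t; rewrite mulN1r addrC.
Qed.

Lemma step0 t : t <= 0 -> step t = 0.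
Proof. by move=> t0; rewrite /step flat0_eq0 // mul0r. Qed.

Lemma step1 t : 1 <= t -> step t = 1.
Proof.
move=> t1; rewrite /step (@flat0_eq0 (1 - t)) ?addr0; last lra.
by rewrite divff // gt_eqF // flat0_gt0; lra.
Qed.

Lemma step_ge0 t : 0 <= step t.
Proof. by rewrite divr_ge0 ?flat0_ge0 // ltW. Qed.

Lemma step_le1 t : step t <= 1.
Proof. by rewrite ler_pdivrMr // mul1r lerDl flat0_ge0. Qed.

(** The argument of [step] is 1 at |t| = M and 0 at |t| = 2 M; using t^2 instead of |t| keeps it
    smooth. *)
Definition cutoff (M t : R) : R := step ((4 * M ^+ 2 - t ^+ 2) / (3 * M ^+ 2)).

Lemma smooth1_cutoff M : smooth1 (cutoff M).
Proof.
apply: (@smooth1_comp _ (fun t => (4 * M ^+ 2 - t ^+ 2) / (3 * M ^+ 2)) step); last exact: smooth1_step.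
apply: smooth1M; last exact: smooth1_cst.
rewrite (_ : (fun t => _) = (fun t => (-1) * t ^+ 2 + 4 * M ^+ 2)).
  apply: smooth1D; last exact: smooth1_cst.
  by apply: smooth1M; [exact: smooth1_cst|apply: smooth1X; exact: smooth1_id].
by apply/funext => t; rewrite mulN1r addrC.
Qed.

Lemma cutoff1 M t : 0 < M -> `|t| <= M -> cutoff M t = 1.
Proof.
move=> M0 tM; apply: step1; have M20 : 0 < M ^+ 2 by rewrite exprn_gt0.
have t2 : t ^+ 2 <= M ^+ 2 by rewrite -[t ^+ 2]real_normK ?num_real // lerXn2r // nnegrE // ltW.
by rewrite ler_pdivlMr; lra.
Qed.

Lemma cutoff0 M t : 0 < M -> 2 * M <= `|t| -> cutoff M t = 0.
Proof.
move=> M0 tM; apply: step0; have M20 : 0 < M ^+ 2 by rewrite exprn_gt0.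
have t2 : (2 * M) ^+ 2 <= t ^+ 2 by rewrite -[t ^+ 2]real_normK ?num_real // lerXn2r // nnegrE // mulr_ge0 // ltW.
rewrite pmulr_lle0; last by rewrite invr_gt0 mulr_gt0.
by move: t2; rewrite exprMn -natrX /=; lra.
Qed.

(** A smooth positive substitute for t^(-1/2). Together with positivity, the relation mu^2 t = 1
    determines it from tau on and is the form in which it is used. *)
Lemma exists_inverse_sqrt (tau : R) : 0 < tau -> exists mu : R -> R,
  [/\ smooth1 mu, forall t, 0 < mu t & forall t, tau <= t -> mu t ^+ 2 * t = 1].
Proof.
(* Here s rises from 0 at tau / 2 to 1 at tau, so p passes from 1 to t without losing positivity; mu
   is p^(-1/2). *)
move=> tau0; pose s t := step ((2 * t - tau) / tau); pose p t := t * s t + (1 - s t).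
have s1 t : tau <= t -> s t = 1.
  by move=> ht; apply: step1; rewrite ler_pdivlMr //; lra.
have p0 t : 0 < p t.
  have := step_ge0 ((2 * t - tau) / tau); have := step_le1 ((2 * t - tau) / tau).
  rewrite -/(s t) => h1 h0; have [ht|ht] := leP (2 * t) tau.
    rewrite /p /s step0 ?mulr0 ?subr0 ?add0r // pmulr_lle0 ?invr_gt0 //; lra.
  rewrite /p; have t0 : 0 < t by lra.
  have [->|sn1] := eqVneq (s t) 1; first by rewrite subrr addr0 mulr1.
  by apply: ltr_wpDl; [apply: mulr_ge0 => //; exact: ltW|rewrite subr_gt0 lt_neqAle sn1].
have sp : smooth1 p.
  have ss : smooth1 s.
    apply: (@smooth1_comp _ (fun t => (2 * t - tau) / tau) step); last exact: smooth1_step.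
    by apply: smooth1M; [exact: smooth1_aff|exact: smooth1_cst].
  apply: smooth1D; first by apply: smooth1M; [exact: smooth1_id|].
  rewrite (_ : (fun t => _) = (fun t => 1 + (-1) * s t)).
    by apply: smooth1D; [exact: smooth1_cst|apply: smooth1M; [exact: smooth1_cst|]].
  by apply/funext => t; rewrite mulN1r.
exists (fun t => expR (- 2^-1 * ln (p t))); split.
- exact: smooth1_expR_ln.
- by move=> t; exact: expR_gt0.
- move=> t ht; rewrite -expRM_natr (_ : - 2^-1 * ln (p t) * 2 = - ln (p t)); last by field.
  have pt : p t = t by rewrite /p s1 // mulr1 subrr addr0.
  by rewrite expRN pt lnK ?posrE ?mulVf ?gt_eqF //; rewrite (lt_le_trans tau0).
Qed.

End Bumps.

(** * The integral over the sphere *)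

Section BoundedSupport.
Context {R : realType}.
Notation mu := (@lebesgue_measure R).
Implicit Types (F : R -> R) (M B : R).

Definition supported_in B F := forall x, B < `|x| -> F x = 0.

Lemma supported_restrict F B : supported_in B F -> F \_ `[- B, B] = F.
Proof.
move=> H; apply/funext => x; rewrite /patch mem_setE /= in_itv /= -ler_norml.
by case: leP => // /H.
Qed.

Let bounded_integrable F M B : measurable_fun setT F -> (forall x, `|F x| <= M) ->
  mu.-integrable `[- B, B] (EFin \o F).
Proof.
move=> mF FM; apply: measurable_bounded_integrable => //.
- by rewrite /= lebesgue_measure_itv /=; case: ifP => // _; rewrite -EFinD ltry.
- by apply: measurable_funS mF.
- by exists M; split; [exact: num_real|move=> N MN x _; exact: le_trans (FM x) (ltW MN)].
Qed.

Lemma supported_integrable F M B : measurable_fun setT F -> (forall x, `|F x| <= M) ->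
  supported_in B F -> mu.-integrable setT (EFin \o F).
Proof.
move=> mF FM sF; rewrite -(supported_restrict sF) -restrict_EFin.
apply: (integrable_mkcond _ _).1 => //; exact: (bounded_integrable B mF FM).
Qed.

Let Rintegral_supported F B : supported_in B F ->
  \int[mu]_x F x = \int[mu]_(x in `[- B, B]) F x.
Proof. by move=> sF; rewrite [RHS]Rintegral_mkcond (supported_restrict sF). Qed.

Lemma Rintegral_supported_le F M B : 0 <= B -> measurable_fun setT F ->
  (forall x, `|F x| <= M) -> supported_in B F -> `|\int[mu]_x F x| <= M * (2 * B).
Proof.
move=> B0 mF FM sF; rewrite (Rintegral_supported sF).
have iF := bounded_integrable B mF FM.
apply: le_trans (le_normr_Rintegral _ iF) _ => //.
have -> : M * (2 * B) = \int[mu]_(x in `[- B, B]) M.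
  rewrite Rintegral_cst //= lebesgue_measure_itv /= lte_fin.
  congr (_ * _); case: ifPn => [_|]; first by rewrite -EFinD /= opprK; ring.
  by rewrite -leNgt /=; lra.
apply: le_Rintegral => //.
- by have := integrable_norm iF.
- apply: (@bounded_integrable (fun=> M) `|M| B) => //.
Qed.

(** Dominated convergence with the constant M on [-B, B]. Measurability of the limit is part of the
    conclusion because the lemma is iterated over the coordinates. *)
Lemma Rintegral_supported_cvg (F_ : nat -> R -> R) F M B :
  (forall n, measurable_fun setT (F_ n)) -> (forall n x, `|F_ n x| <= M) ->
  (forall n, supported_in B (F_ n)) -> (forall x, F_ ^~ x @ \oo --> F x) ->
  measurable_fun setT F /\ \int[mu]_x F_ n x @[n --> \oo] --> \int[mu]_x F x.
Proof.
move=> mF FM sF F_F.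
have mFl : measurable_fun setT F.
  apply/measurable_EFinP; apply: (emeasurable_fun_cvg (fun n x => (F_ n x)%:E)).
    by move=> n; apply/measurable_EFinP.
  by move=> x _; apply: cvg_EFin; [near=> n|exact: F_F].
have sFl : supported_in B F.
  move=> x Bx; rewrite -(cvg_lim _ (F_F x)) //.
  by under eq_fun do rewrite (sF _ _ Bx); rewrite lim_cst.
split => //; rewrite (Rintegral_supported sFl).
under eq_fun do rewrite (Rintegral_supported (sF _)).
have FMl x : `|F x| <= M.
  rewrite -(cvg_lim _ (F_F x)) // -lim_norm; last by apply/cvg_ex; exists (F x).
  apply: limr_le; first by apply: is_cvg_norm; apply/cvg_ex; exists (F x).
  by near=> n.
apply: fine_cvg; rewrite fineK; last first.
  by apply: integrable_fin_num => //; exact: (bounded_integrable B mFl FMl).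
apply: (@dominated_cvg _ _ _ mu _ _ _ _ (cst M%:E)) => //.
- by move=> n; apply/measurable_EFinP; apply: measurable_funS (mF n).
- by move=> x _; apply: cvg_EFin; [near=> n|exact: F_F].
- by apply: (@bounded_integrable (fun=> M) `|M| B).
- by move=> n x _; rewrite /= lee_fin.
Unshelve. all: by end_near. Qed.

End BoundedSupport.

Section Matrices.
Context {R : realType}.

Lemma continuous_lincomb {T : topologicalType} (a : R) (f g : T -> R) :
  continuous f -> continuous g -> continuous (fun x => a * f x + g x).
Proof.
by move=> cf cg x; apply: cvgD; [apply: cvgM; [exact: cst_continuous|exact: cf]|exact: cg].
Qed.

Lemma continuous_mul {T : topologicalType} (f g : T -> R) :
  continuous f -> continuous g -> continuous (fun x => f x * g x).
Proof. by move=> cf cg x; apply: cvgM; [exact: cf|exact: cg]. Qed.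

Lemma continuous_add {T : topologicalType} (f g : T -> R) :
  continuous f -> continuous g -> continuous (fun x => f x + g x).
Proof. by move=> cf cg x; apply: cvgD; [exact: cf|exact: cg]. Qed.

Lemma continuous_compose {T U W : topologicalType} (f : T -> U) (g : U -> W) :
  continuous f -> continuous g -> continuous (fun x => g (f x)).
Proof. by move=> cf cg x; apply: continuous_comp; [exact: cf|exact: cg]. Qed.

Lemma continuous_mx {U : topologicalType} m n (f : U -> 'M[R]_(m, n)) (u : U) :
  (forall i j, {for u, continuous (fun x => f x i j)}) -> {for u, continuous f}.
Proof.
move=> H A [P HP PA].
have : \forall x \near u, forall i, forall j, P i j (f x i j).
  apply: filter_forall => i; apply: filter_forall => j; exact: (H i j _ (HP i j)).
by apply: filterS => x Hx; apply: PA.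
Qed.

Lemma coord_le_norm n (x : 'rV[R]_n) i : `|x 0 i| <= `|x|.
Proof.
rewrite [in leRHS]/Num.norm /= mx_normrE.
by apply: (le_bigmax_cond _ (fun ij : 'I_1 * 'I_n => `|x ij.1 ij.2|) (j := (0, i))).
Qed.

Lemma rV_norm_le n (x : 'rV[R]_n) (e : R) : 0 <= e -> (forall i, `|x 0 i| <= e) -> `|x| <= e.
Proof.
move=> e0 H; rewrite [in leLHS]/Num.norm /= mx_normrE.
by apply/bigmax_leP; split => // -[i j] _ /=; rewrite ord1.
Qed.

Lemma continuous_coord n (i : 'I_n) : continuous (fun x : 'rV[R]_n => x 0 i).
Proof. exact: coord_continuous. Qed.

Lemma continuous_row_mx n (p : R * 'rV[R]_n) :
  {for p, continuous (fun p : R * 'rV[R]_n => row_mx (p.1%:M : 'rV[R]_1) p.2)}.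
Proof.
apply: continuous_mx => i j; rewrite ord1 {i}.
case: (split_ordP j) => k ->.
  rewrite (_ : (fun p => _) = fst); first exact: continuous_fst.
  by apply/funext => q; rewrite row_mxEl ord1 mxE eqxx mulr1n.
rewrite (_ : (fun p => _) = (fun q : R * 'rV[R]_n => q.2 0 k)).
  apply: (@continuous_comp _ _ _ snd (fun x : 'rV[R]_n => x 0 k)); first exact: continuous_snd.
  exact: continuous_coord.
by apply/funext => q; rewrite row_mxEr.
Qed.

Lemma box_compact n (B : R) : compact [set x : 'rV[R]_n | forall i, `|x 0 i| <= B].
Proof.
rewrite (_ : [set x | _] = [set x : 'rV[R]_n | forall i, (`[- B, B]%classic : set R) (x ord0 i)]).
  by apply: (@rV_compact R n (fun=> `[- B, B]%classic)) => i; exact: segment_compact.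
by apply/seteqP; split => x /= H i; have := H i; rewrite in_itv /= ler_norml.
Qed.

End Matrices.

(** * Linearity, bounds and limits of the iterated Lebesgue integral *)

Section IteratedIntegral.
Context {R : realType}.
Notation mu := (@lebesgue_measure R).

Definition slice d (g : 'rV[R]_d.+1 -> R) (t : R) : 'rV[R]_d -> R :=
  fun y => g (row_mx (t%:M : 'rV[R]_1) y).

(** Integrability is imposed at each stage of the iteration and on every slice, so that linearity of
    the one-dimensional integral applies at each stage. *)
Fixpoint rVintegrable d : ('rV[R]_d -> R) -> Prop :=
  match d with
  | 0 => fun=> True
  | d'.+1 => fun g => (forall t, rVintegrable (slice g t)) /\
      mu.-integrable setT (EFin \o (fun t => rVintegral (slice g t)))
  end.

Lemma rVintegralS d (g : 'rV[R]_d.+1 -> R) :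
  rVintegral g = \int[mu]_t rVintegral (slice g t).
Proof. by []. Qed.

Lemma rVintegral_lin d (a : R) (g h : 'rV[R]_d -> R) : rVintegrable g -> rVintegrable h ->
  rVintegrable (fun x => a * g x + h x) /\
  rVintegral (fun x => a * g x + h x) = a * rVintegral g + rVintegral h.
Proof.
elim: d g h => [//|d IH] g h [g1 g2] [h1 h2].
have E t : rVintegral (slice (fun x => a * g x + h x) t) =
    a * rVintegral (slice g t) + rVintegral (slice h t).
  exact: (IH _ _ (g1 t) (h1 t)).2.
have iag : mu.-integrable setT (EFin \o (fun t => a * rVintegral (slice g t))).
  exact: integrableZl g2.
split; first split.
- by move=> t; exact: (IH _ _ (g1 t) (h1 t)).1.
- rewrite (_ : (fun t => _) = (fun t => a * rVintegral (slice g t) + rVintegral (slice h t))).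
    exact: integrableD iag h2.
  by apply/funext => t; exact: E.
- rewrite !rVintegralS -RintegralZl // -RintegralD //.
  by apply: eq_Rintegral => t _; exact: E.
Qed.

Lemma rVintegral_ge0 d (g : 'rV[R]_d -> R) : (forall x, 0 <= g x) -> 0 <= rVintegral g.
Proof.
elim: d g => [|d IH] g g0; first exact: g0.
rewrite rVintegralS; apply: Rintegral_ge0 => t _.
by apply: IH => y; exact: g0.
Qed.

Lemma rVintegral0 d : rVintegral (fun _ : 'rV[R]_d => 0) = 0.
Proof.
elim: d => [//|d IH]; rewrite rVintegralS.
have -> : (fun t => rVintegral (slice (fun _ : 'rV[R]_d.+1 => 0) t)) = fun=> 0.
  by apply/funext => t; exact: IH.
by rewrite Rintegral_cst // mul0r.
Qed.

Lemma rVintegral_le d (g h : 'rV[R]_d -> R) : rVintegrable g -> rVintegrable h ->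
  (forall x, g x <= h x) -> rVintegral g <= rVintegral h.
Proof.
move=> ig ih gh; have [_ E] := rVintegral_lin (-1) ig ih.
rewrite -subr_ge0; have -> : rVintegral h - rVintegral g = -1 * rVintegral g + rVintegral h by ring.
by rewrite -E; apply: rVintegral_ge0 => x; rewrite mulN1r addrC subr_ge0.
Qed.

Definition cont_supp d (M B : R) (g : 'rV[R]_d -> R) :=
  [/\ continuous g, forall x, `|g x| <= M & forall (x : 'rV[R]_d) i, B < `|x 0 i| -> g x = 0].

Lemma slice_cont_supp d M B (g : 'rV[R]_d.+1 -> R) t : cont_supp M B g ->
  cont_supp M B (slice g t).
Proof.
move=> [cg gM gB]; split => [y|y|y i yB].
- apply: (@continuous_comp _ _ _ (fun y => row_mx (t%:M : 'rV[R]_1) y) g); last exact: cg.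
  apply: (@continuous_comp _ _ _ (fun y => (t, y)) (fun p : R * 'rV[R]_d => row_mx (p.1%:M : 'rV[R]_1) p.2)).
    by apply: (@continuous_pair _ _ _ (fun=> t) id); [exact: cst_continuous|exact: cvg_id].
  exact: continuous_row_mx.
- exact: gM.
- apply: (gB _ (rshift 1 i : 'I_d.+1)).
  by rewrite [X in `|X|](row_mxEr (t%:M : 'rV[R]_1) y 0 i).
Qed.

Lemma slice_supp d M B (g : 'rV[R]_d.+1 -> R) t : cont_supp M B g -> B < `|t| ->
  slice g t = fun=> 0.
Proof.
move=> [_ _ gB] tB; apply/funext => y; apply: (gB (row_mx (t%:M : 'rV[R]_1) y) (lshift d (0 : 'I_1) : 'I_d.+1)).
by rewrite [X in `|X|](row_mxEl (t%:M : 'rV[R]_1) y 0 0) mxE eqxx mulr1n.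
Qed.

(** The induction is over all bounds M: applied to the difference of two slices, which is uniformly
    small, the estimate itself shows that the partial integral is continuous, hence measurable. *)
Lemma cont_supp_integral d M B (g : 'rV[R]_d -> R) : 0 <= B -> cont_supp M B g ->
  rVintegrable g /\ `|rVintegral g| <= M * (2 * B) ^+ d.
Proof.
move=> B0; elim: d M g => [|d IH] M g hg.
  by split => //; rewrite expr0 mulr1; case: hg => _ gM _; exact: gM.
have M0 : 0 <= M by case: hg => _ /(_ 0) H _; exact: le_trans H.
have BM t : `|rVintegral (slice g t)| <= M * (2 * B) ^+ d.
  exact: (IH _ _ (slice_cont_supp t hg)).2.
have sp : supported_in B (fun t => rVintegral (slice g t)).
  by move=> t tB; rewrite (slice_supp hg tB) rVintegral0.
have cI : continuous (fun t => rVintegral (slice g t)).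
  move=> s; apply/cvgrPdist_le => e e0.
  pose K := (2 * B) ^+ d; have K0 : 0 <= K by rewrite exprn_ge0 // mulr_ge0.
  have e'0 : 0 < e / (K + 1) by rewrite divr_gt0 // ltr_wpDl.
  have [cg gM gB] := hg.
  have cg2 : continuous (fun p : R * 'rV[R]_d => g (row_mx (p.1%:M : 'rV[R]_1) p.2)).
    move=> p; apply: (@continuous_comp _ _ _ (fun p : R * 'rV[R]_d => row_mx (p.1%:M : 'rV[R]_1) p.2) g).
      exact: continuous_row_mx.
    exact: cg.
  have := near_uniform s (@box_compact R d B) cg2 e'0; apply: filterS => t /= Ht.
  have [i1 i2] := ((IH _ _ (slice_cont_supp t hg)).1, (IH _ _ (slice_cont_supp s hg)).1).
  have [_ E] := rVintegral_lin (-1) i1 i2.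
  have -> : rVintegral (slice g s) - rVintegral (slice g t) =
    -1 * rVintegral (slice g t) + rVintegral (slice g s) by ring.
  rewrite -E; apply: le_trans (IH (e / (K + 1)) _ _).2 _; last first.
    by rewrite mulrC mulr_div_succ_le.
  have [c1 _ b1] := slice_cont_supp t hg; have [c2 _ b2] := slice_cont_supp s hg.
  split => [|y|y i yB].
  + exact: continuous_lincomb.
  + have -> : -1 * slice g t y + slice g s y = slice g s y - slice g t y by ring.
    have [yB|/existsNP[i /negP]] := pselect (forall i, `|y 0 i| <= B).
      by rewrite distrC; apply/ltW/Ht.
    by rewrite -ltNge => yB; rewrite (b1 y i) // (b2 y i) // subrr normr0 ltW.
  + by rewrite (b1 y i) // (b2 y i) // mulr0 addr0.
have mI := continuous_measurable_fun cI.
split; first split.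
- by move=> t; exact: (IH _ _ (slice_cont_supp t hg)).1.
- exact: supported_integrable mI BM sp.
- rewrite rVintegralS exprSr.
  by have := Rintegral_supported_le B0 mI BM sp; rewrite -mulrA.
Qed.

(* The integrands of sphere_integral are discontinuous (at 0 and on the unit
   sphere), but they belong to this class. *)
Definition bounded_limit d (g_ : nat -> 'rV[R]_d -> R) (g : 'rV[R]_d -> R) :=
  exists M B, [/\ 0 <= B, forall n, cont_supp M B (g_ n) & forall x, g_ ^~ x @ \oo --> g x].

(** Slicing preserves the class with the same M and B, so dominated convergence applies one
    coordinate at a time. *)
Lemma bounded_limit_integral d g_ (g : 'rV[R]_d -> R) : bounded_limit g_ g ->
  rVintegrable g /\ rVintegral (g_ n) @[n --> \oo] --> rVintegral g.
Proof.
elim: d g_ g => [|d IH] g_ g [M [B [B0 Hg gg]]]; first by split => //; exact: gg.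
have H t : bounded_limit (fun n => slice (g_ n) t) (slice g t).
  exists M, B; split => // [n|x]; first exact: slice_cont_supp.
  exact: gg.
have BM n t : `|rVintegral (slice (g_ n) t)| <= M * (2 * B) ^+ d.
  exact: (cont_supp_integral B0 (slice_cont_supp t (Hg n))).2.
have sp n : supported_in B (fun t => rVintegral (slice (g_ n) t)).
  by move=> t tB; rewrite (slice_supp (Hg n) tB) rVintegral0.
have mF n : measurable_fun setT (fun t => rVintegral (slice (g_ n) t)).
  have [[_ /integrableP[]]] := cont_supp_integral B0 (Hg n).
  by move/measurable_EFinP.
have cv t : rVintegral (slice (g_ n) t) @[n --> \oo] --> rVintegral (slice g t).
  exact: (IH _ _ (H t)).2.
have [m1 m2] := Rintegral_supported_cvg mF BM sp cv.
split => //; split => [t|]; first exact: (IH _ _ (H t)).1.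
apply: (@supported_integrable _ _ (M * (2 * B) ^+ d) B) => // t.
- rewrite -(cvg_lim _ (cv t)) // -lim_norm; last by apply/cvg_ex; eexists; exact: cv.
  apply: limr_le; first by apply: is_cvg_norm; apply/cvg_ex; eexists; exact: cv.
  by near=> n.
- move=> tB; rewrite -(cvg_lim _ (cv t)) //.
  by under eq_fun do rewrite (sp _ _ tB); rewrite lim_cst.
Unshelve. all: by end_near. Qed.

End IteratedIntegral.

Section ContinuityRules.
Context {R : realType} {T : topologicalType}.
Implicit Types f g : T -> R.

Lemma continuous_minf f g : continuous f -> continuous g ->
  continuous (fun x => Num.min (f x) (g x)).
Proof. by move=> cf cg x; have := continuous_min (cf x) (cg x); exact. Qed.

Lemma continuous_maxf f g : continuous f -> continuous g ->
  continuous (fun x => Num.max (f x) (g x)).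
Proof. by move=> cf cg x; have := continuous_max (cf x) (cg x); exact. Qed.

Lemma continuous_sub f g : continuous f -> continuous g ->
  continuous (fun x => f x - g x).
Proof. by move=> cf cg x; apply: cvgB; [exact: cf|exact: cg]. Qed.

Lemma continuous_scale {d} (f : T -> R) (h : T -> 'rV[R]_d) : continuous f -> continuous h ->
  continuous (fun x => f x *: h x).
Proof. by move=> cf ch x; apply: cvgZ; [exact: cf|exact: ch]. Qed.

Lemma continuous_inv f : (forall x, f x != 0) -> continuous f ->
  continuous (fun x => (f x)^-1).
Proof. by move=> f0 cf x; apply: cvgV; [exact: f0|exact: cf]. Qed.

End ContinuityRules.

Section Euclid.
Context {R : realType} {d : nat}.
Local Notation V := 'rV[R]_d.
Implicit Types x y z : V.

Lemma dotvC x y : dotv x y = dotv y x.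
Proof. by apply: eq_bigr => i _; rewrite mulrC. Qed.

Lemma dotvDl x y z : dotv (x + y) z = dotv x z + dotv y z.
Proof. by rewrite /dotv -big_split; apply: eq_bigr => i _; rewrite mxE mulrDl. Qed.

Lemma dotvZl (a : R) x y : dotv (a *: x) y = a * dotv x y.
Proof. by rewrite /dotv mulr_sumr; apply: eq_bigr => i _; rewrite mxE mulrA. Qed.

Lemma dotvDr x y z : dotv z (x + y) = dotv z x + dotv z y.
Proof. by rewrite dotvC dotvDl !(dotvC z). Qed.

Lemma dotvZr (a : R) x y : dotv y (a *: x) = a * dotv y x.
Proof. by rewrite dotvC dotvZl dotvC. Qed.

Lemma dotvNl x y : dotv (- x) y = - dotv x y.
Proof. by rewrite -scaleN1r dotvZl mulN1r. Qed.

Lemma dotvNr x y : dotv y (- x) = - dotv y x.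
Proof. by rewrite dotvC dotvNl dotvC. Qed.

(** The factor d appears because |x| is the sup norm. *)
Lemma dotv_norm_le x y : `|dotv x y| <= d%:R * `|x| * `|y|.
Proof.
apply: le_trans (ler_norm_sum _ _ _) _.
rewrite -mulrA mulr_natl (_ : _ *+ d = \sum_(i < d) `|x| * `|y|); last first.
  by rewrite sumr_const card_ord.
by apply: ler_sum => i _; rewrite normrM ler_pM // coord_le_norm.
Qed.

Lemma dotvv_ge0 x : 0 <= dotv x x.
Proof. by apply: sumr_ge0 => i _; rewrite -expr2 sqr_ge0. Qed.

Lemma sqr_enorm x : enorm x ^+ 2 = dotv x x.
Proof. by rewrite /enorm sqr_sqrtr // dotvv_ge0. Qed.

Lemma enorm_ge0 x : 0 <= enorm x. Proof. exact: sqrtr_ge0. Qed.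

Lemma coord_le_enorm x i : `|x 0 i| <= enorm x.
Proof.
rewrite -sqrtr_sqr /enorm ler_wsqrtr // /dotv (bigD1 i) //= -expr2 lerDl.
by apply: sumr_ge0 => j _; rewrite -expr2 sqr_ge0.
Qed.

Lemma norm_le_enorm x : `|x| <= enorm x.
Proof. by apply: rV_norm_le; [exact: enorm_ge0|exact: coord_le_enorm]. Qed.

Lemma enormZ (a : R) x : enorm (a *: x) = `|a| * enorm x.
Proof. by rewrite /enorm dotvZl dotvZr mulrA -expr2 sqrtrM ?sqr_ge0 // sqrtr_sqr. Qed.

Lemma continuous_dotv {U : topologicalType} (f g : U -> V) :
  continuous f -> continuous g -> continuous (fun t : U => dotv (f t) (g t)).
Proof.
move=> cf cg; rewrite /dotv; elim: (index_enum _) => [|i r IH].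
  have -> : (fun t : U => \sum_(i <- [::]) f t 0 i * g t 0 i) = fun=> 0.
    by apply/funext => t; rewrite big_nil.
  exact: cst_continuous.
have -> : (fun t : U => \sum_(i <- i :: r) f t 0 i * g t 0 i) =
    (fun t => f t 0 i * g t 0 i + \sum_(i <- r) f t 0 i * g t 0 i).
  by apply/funext => t; rewrite big_cons.
apply: continuous_add IH; apply: continuous_mul.
  exact: (continuous_compose cf (@continuous_coord R d i)).
exact: (continuous_compose cg (@continuous_coord R d i)).
Qed.

Let cid : continuous (fun x : V => x). Proof. by move=> x; exact: cvg_id. Qed.

Lemma continuous_enorm : continuous (fun x : V => enorm x).
Proof.
apply: (@continuous_compose V R R (fun x => dotv x x) Num.sqrt).
  exact: continuous_dotv.
exact: sqrt_continuous.
Qed.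

Lemma linear_dotv y : linear (fun x => dotv x y).
Proof. by move=> a x z; rewrite dotvDl dotvZl. Qed.

Lemma continuous_dotvl y : continuous (fun x => dotv x y).
Proof. by apply: continuous_dotv => //; exact: cst_continuous. Qed.

End Euclid.

Section SphereIntegral.
Context {R : realType} {d : nat}.
Local Notation V := 'rV[R]_d.

Definition sphere : set V := [set x | enorm x = 1].

Lemma compact_sphere : compact sphere.
Proof.
apply: bounded_closed_compact.
  exists 1; split; [exact: num_real|move=> M M1 x /= x1].
  by apply: le_trans (norm_le_enorm x) _; rewrite x1 ltW.
rewrite (_ : sphere = (fun x : V => enorm x) @^-1` [set 1]) //.
apply: (@closed_comp _ _ (fun x : V => enorm x)) => [x _|]; first exact: continuous_enorm.
exact: closed_eq.
Qed.

Definition radial_ext (g : V -> R) (x : V) : R :=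
  if 0 < enorm x <= 1 then g ((enorm x)^-1 *: x) else 0.

Lemma sphere_integralE (g : V -> R) : sphere_integral g = d%:R * rVintegral (radial_ext g).
Proof. by []. Qed.

(** Tends to the indicator function of 0 < r <= 1: the first factor rises from 0 to 1 on
    [0, 1/(n+1)], the second falls back to 0 on [1, 1 + 1/(n+1)]. *)
Let rho (n : nat) (r : R) : R :=
  Num.min 1 (n.+1%:R * r) * Num.max 0 (1 - n.+1%:R * Num.max 0 (r - 1)).

(** The maximum in the denominator removes the discontinuity of x / |x| at 0. *)
Let approx (g : V -> R) n (x : V) : R :=
  rho n (enorm x) * g ((Num.max (enorm x) n.+1%:R^-1)^-1 *: x).

Let rho_continuous n : continuous (rho n).
Proof.
have cid : continuous (fun x : R => x) by move=> x; exact: cvg_id.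
have ccst (c : R) : continuous (fun _ : R => c) by exact: cst_continuous.
apply: continuous_mul.
  by apply: continuous_minf; [exact: ccst|exact: continuous_mul].
apply: continuous_maxf; first exact: ccst.
apply: continuous_sub; first exact: ccst.
apply: continuous_mul; first exact: ccst.
apply: continuous_maxf; first exact: ccst.
by apply: continuous_sub.
Qed.

Let rho_norm_le1 n r : 0 <= r -> `|rho n r| <= 1.
Proof.
move=> r0; have n0 : 0 <= n.+1%:R * r by rewrite mulr_ge0.
rewrite /rho normrM !ger0_norm ?le_max ?lexx ?le_min ?ler01 ?n0 //.
apply: mulr_ile1; rewrite ?le_max ?lexx ?le_min ?ler01 ?n0 //.
  by rewrite ge_min lexx.
by rewrite ge_max ler01 lerBlDr lerDl mulr_ge0 // le_max lexx.
Qed.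

Let rho_eq0 n r : 2 <= r -> rho n r = 0.
Proof.
move=> r2; rewrite /rho; have -> : Num.max 0 (r - 1) = r - 1 by apply/max_idPr; lra.
suff -> : Num.max 0 (1 - n.+1%:R * (r - 1)) = 0 by rewrite mulr0.
apply/max_idPl; rewrite subr_le0.
have : 1 <= n.+1%:R :> R by rewrite ler1n.
nra.
Qed.

(** At each point the approximants are eventually constant. The bound M is taken over the unit cube,
    which contains all the rescaled points. *)
Lemma radial_ext_limit (g : V -> R) : continuous g ->
  bounded_limit (approx g) (radial_ext g).
Proof.
move=> cg; have [M M0 HM] := compact_le_bound (@box_compact R d 1) cg.
exists M, 2; split => // [n|x].
- have n0 : 0 < n.+1%:R^-1 :> R by rewrite invr_gt0.
  have m0 (x : V) : 0 < Num.max (enorm x) n.+1%:R^-1 by rewrite lt_max n0 orbT.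
  split => [|x|x i x2].
  + apply: (@continuous_mul _ _ (fun x : V => rho n (enorm x))
      (fun x => g ((Num.max (enorm x) n.+1%:R^-1)^-1 *: x))).
      apply: (@continuous_compose _ _ _ (fun x : V => enorm x) (rho n)) => //.
      exact: continuous_enorm.
    apply: continuous_compose cg; apply: continuous_scale; last by move=> x; exact: cvg_id.
    apply: continuous_inv => [x|]; first by rewrite gt_eqF.
    by apply: continuous_maxf; [exact: continuous_enorm|exact: cst_continuous].
  + rewrite normrM -[M]mul1r ler_pM // ?rho_norm_le1 ?enorm_ge0 //.
    apply: HM => i /=; rewrite mxE normrM gtr0_norm ?invr_gt0 // mulrC ler_pdivrMr // mul1r.
    by rewrite le_max coord_le_enorm.
  + rewrite /approx rho_eq0 ?mul0r //; apply: ltW; apply: lt_le_trans x2 _.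
    exact: coord_le_enorm.
- rewrite /radial_ext /approx; case: ifPn => [/andP[r0 r1]|].
    apply: cvg_near_cst; near=> n.
    have nr : (enorm x)^-1 <= n.+1%:R.
      by apply: le_trans (_ : n%:R <= _); [near: n; exact: nbhs_infty_ger|rewrite ler_nat].
    have -> : Num.max (enorm x) n.+1%:R^-1 = enorm x.
      by apply/max_idPl; rewrite invf_ple ?posrE.
    have -> : rho n (enorm x) = 1; last by rewrite mul1r.
    rewrite /rho; have -> : Num.max 0 (enorm x - 1) = 0 by apply/max_idPl; lra.
    rewrite mulr0 subr0 (max_idPr _) // mulr1; apply/min_idPl.
    by rewrite -ler_pdivrMr // div1r.
  rewrite negb_and -leNgt -ltNge => /orP[r0|r1].
    have -> : enorm x = 0 by apply/eqP; rewrite eq_le r0 enorm_ge0.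
    by apply: cvg_near_cst; near=> n; rewrite /rho mulr0 (min_idPr _) // !mul0r.
  apply: cvg_near_cst; near=> n.
  have nr : (enorm x - 1)^-1 <= n.+1%:R.
    by apply: le_trans (_ : n%:R <= _); [near: n; exact: nbhs_infty_ger|rewrite ler_nat].
  rewrite /rho; have -> : Num.max 0 (enorm x - 1) = enorm x - 1 by apply/max_idPr; lra.
  rewrite [Num.max _ _](max_idPl _) ?mulr0 ?mul0r // subr_le0.
  by rewrite -ler_pdivrMr ?div1r // subr_gt0.
Unshelve. all: by end_near. Qed.

Lemma radial_ext_integrable g : continuous g -> rVintegrable (radial_ext g).
Proof. by move=> /radial_ext_limit /bounded_limit_integral []. Qed.

Lemma sphere_integral_lin (a : R) (g h : V -> R) : continuous g -> continuous h ->
  sphere_integral (fun x => a * g x + h x) = a * sphere_integral g + sphere_integral h.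
Proof.
move=> cg ch; rewrite !sphere_integralE.
have [_ E] := rVintegral_lin a (radial_ext_integrable cg) (radial_ext_integrable ch).
rewrite mulrCA -mulrDr -E; congr (_ * rVintegral _); apply/funext => x.
by rewrite /radial_ext; case: ifP => // _; rewrite mulr0 addr0.
Qed.

Lemma sphere_integral_le (g h : V -> R) : continuous g -> continuous h ->
  (forall x, sphere x -> g x <= h x) -> sphere_integral g <= sphere_integral h.
Proof.
move=> cg ch gh; rewrite !sphere_integralE; apply: ler_wpM2l => //.
apply: rVintegral_le; [exact: radial_ext_integrable|exact: radial_ext_integrable|].
move=> x; rewrite /radial_ext; case: ifP => // /andP[x0 _]; apply: gh.
by rewrite /sphere /= enormZ gtr0_norm ?invr_gt0 // mulVf // gt_eqF.
Qed.

End SphereIntegral.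

Lemma rVintegral_box_ge {R : realType} d (g : 'rV[R]_d -> R) (c : 'rV[R]_d) (r m : R) :
  0 <= r -> 0 <= m -> rVintegrable g -> (forall x, 0 <= g x) ->
  (forall x : 'rV[R]_d, (forall i, `|x 0 i - c 0 i| <= r) -> m <= g x) ->
  m * (2 * r) ^+ d <= rVintegral g.
Proof.
move=> r0 m0; elim: d g c => [|d IH] g c ig g0 H.
  by rewrite expr0 mulr1; apply: H => -[].
have [ig1 ig2] := ig; rewrite rVintegralS.
pose K := m * (2 * r) ^+ d; pose D : set R := `[c 0 0 - r, c 0 0 + r]%classic.
have K0 : 0 <= K by rewrite mulr_ge0 // exprn_ge0 // mulr_ge0.
have mD : measurable D by exact: measurable_itv.
have -> : m * (2 * r) ^+ d.+1 = \int[lebesgue_measure]_(x in D) K.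
  rewrite Rintegral_cst //= /D lebesgue_measure_itv /= lte_fin exprSr mulrA; congr (_ * _).
  by case: ifPn => [_|]; [rewrite -EFinD /=; ring|rewrite -leNgt /=; lra].
rewrite Rintegral_mkcond; apply: le_Rintegral => //.
  rewrite -restrict_EFin; apply: (integrable_mkcond _ _).1 => //.
  apply: measurable_bounded_integrable => //.
  - by rewrite /D /= lebesgue_measure_itv /=; case: ifP => // _; rewrite -EFinD ltry.
  - by exists K; split; [exact: num_real|move=> N KN x _; rewrite /= ger0_norm // ltW].
move=> t _; rewrite /patch; case: ifPn => [|_]; last by apply: rVintegral_ge0 => y; exact: g0.
rewrite mem_setE /= in_itv /= => tD; pose c' : 'rV[R]_d := \row_i c 0 (rshift 1 i : 'I_d.+1).
apply: (IH (slice g t) c' (ig1 t)) => [y|y Hy]; first exact: g0.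
apply: H => i; case: (split_ordP (i : 'I_(1 + d))) => j ->.
  rewrite [X in `|X - _|](row_mxEl (t%:M : 'rV[R]_1) y 0 j) ord1 mxE eqxx mulr1n.
  have -> : lshift d (0 : 'I_1) = 0 :> 'I_d.+1 by apply/val_inj.
  by rewrite ler_norml; lra.
by rewrite [X in `|X - _|](row_mxEr (t%:M : 'rV[R]_1) y 0 j); have := Hy j; rewrite mxE.
Qed.

Section SpherePositive.
Context {R : realType} {d : nat}.
Local Notation V := 'rV[R]_d.

(** The point theta / 2 is interior to the punctured ball, and near it the radial extension stays
    above b(theta) / 2; a small cube there carries positive mass. *)
Lemma sphere_integral_gt0 (b : V -> R) (theta : V) : continuous b ->
  (forall x, 0 <= b x) -> sphere theta -> 0 < b theta -> 0 < sphere_integral b.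
Proof.
move=> cb b0 th1 bth.
have d0 : (0 < d)%N.
  rewrite lt0n; apply/eqP => d0; move: th1; rewrite /sphere /= /enorm /dotv.
  by move: theta {bth}; rewrite d0 => theta; rewrite big_ord0 sqrtr0 => /esym/eqP; rewrite oner_eq0.
(* Continuous everywhere, and equal to the radial extension of b where 1/4 <= |v| <= 1. *)
pose h (v : V) := b ((Num.max (enorm v) (1 / 4))^-1 *: v).
have ch : continuous h.
  apply: continuous_compose cb; apply: continuous_scale; last by move=> x; exact: cvg_id.
  apply: continuous_inv => [x|]; first by rewrite gt_eqF // lt_max divr_gt0 ?orbT.
  by apply: continuous_maxf; [exact: continuous_enorm|exact: cst_continuous].
pose v0 := (1 / 2) *: theta.
have e0 : enorm v0 = 1 / 2 by rewrite enormZ th1 mulr1 ger0_norm.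
have hv0 : h v0 = b theta.
  rewrite /h e0 (max_idPl _); last by lra.
  by rewrite scalerA mulVf ?scale1r // mul1r invr_eq0.
have m0 : 0 < b theta / 2 by rewrite divr_gt0.
have : \forall v \near v0, b theta / 2 <= radial_ext b v.
  have H1 : \forall v \near v0, b theta / 2 <= h v.
    have := ch v0 => /cvgrPdist_le /(_ _ m0); apply: filterS => v /=.
    by rewrite hv0 ler_norml; lra.
  have q0 : 0 < 1 / 4 :> R by rewrite divr_gt0.
  have H2 : \forall v \near v0, `|enorm v0 - enorm v| <= 1 / 4.
    by have := @continuous_enorm R d v0 => /cvgrPdist_le /(_ _ q0).
  apply: filterS2 H1 H2 => v; rewrite e0 ler_norml /h => H /andP[v1 v2].
  rewrite /radial_ext ifT; last by apply/andP; split; lra.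
  by move: H; rewrite (max_idPl _) //; lra.
move=> /nbhs_ballP[r /= r0 Hr].
rewrite sphere_integralE; apply: mulr_gt0; first by rewrite ltr0n.
have r20 : 0 < r / 2 by rewrite divr_gt0.
apply: lt_le_trans (rVintegral_box_ge (ltW r20) (ltW m0) (radial_ext_integrable cb) _ (c := v0) _).
- by rewrite mulr_gt0 // exprn_gt0 // mulr_gt0.
- by move=> x; rewrite /radial_ext; case: ifP.
- move=> x Hx; apply: Hr; rewrite -ball_normE /= distrC.
  apply: le_lt_trans (_ : r / 2 < r); last by rewrite ltr_pdivrMr // ltr_pMr // ltr1n.
  by apply: rV_norm_le => [|i]; [exact: ltW|have := Hx i; rewrite !mxE].
Qed.

Lemma sphere_integralZ (k : R) (g : V -> R) : continuous g ->
  sphere_integral (fun x => k * g x) = k * sphere_integral g.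
Proof.
move=> cg; have := sphere_integral_lin k cg (@cst_continuous V R 0).
have -> : sphere_integral (fun _ : V => (0 : R)) = 0.
  rewrite sphere_integralE (_ : radial_ext _ = fun=> 0) ?rVintegral0 ?mulr0 //.
  by apply/funext => x; rewrite /radial_ext; case: ifP.
rewrite addr0 => E; rewrite -[RHS]E; congr sphere_integral.
by apply/funext => x; rewrite addr0.
Qed.

End SpherePositive.

(** * Functions constant along a line of V *)

Section Tube.
Context {R : realType} {d : nat}.
Local Notation V := 'rV[R]_d.

(** Real form of the hypothesis on Xf, tested on eta smooth on all of V * V; such eta are in
    particular smooth within the manifold of lines. *)
Definition Xvanish (W : set V) (u : (V -> R) -> R) : Prop :=
  forall eta : V * V -> R, smooth eta ->
    compact (closure [set p | oriented_lines p /\ eta p != 0]) ->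
    closure [set p | oriented_lines p /\ eta p != 0] `<=` lines_meeting W ->
    u (fun x => sphere_integral (fun theta => eta (line_through x theta))) = 0.

Lemma psmooth_dotv : psmooth (fun x theta : V => dotv x theta).
Proof.
apply: psmooth_sum => i _; apply: psmoothM.
  apply: psmooth_linear; last exact: continuous_coord.
  by move=> a x y; rewrite !mxE.
by apply: psmooth_param; exact: continuous_coord.
Qed.

(** A product of ridge functions. It is constant along theta when every [m k] is orthogonal to
    theta, which is the shape taken by tube functions. *)
Definition ridges N (chi : 'I_N -> R -> R) (m : 'I_N -> V) (c : 'I_N -> R) (x : V) : R :=
  \prod_k chi k (dotv x (m k) + c k).

Section Ridges.
Variables (N : nat) (chi : 'I_N -> R -> R) (m : 'I_N -> V) (c : 'I_N -> R).
Local Notation a := (ridges chi m c).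

Lemma psmooth_ridges_line : (forall k, smooth1 (chi k)) ->
  psmooth (fun x theta : V => a (line_through x theta).1).
Proof.
move=> hchi; apply: psmooth_prod => k _; apply: psmooth_comp1 => //.
rewrite (_ : (fun x theta => _) =
    (fun x theta => dotv x (m k) + (-1) * (dotv x theta * dotv theta (m k)) + c k)).
  apply: psmoothD; last exact: psmooth_cst.
  apply: psmoothD.
    by apply: psmooth_linear; [exact: linear_dotv|exact: continuous_dotvl].
  apply: psmoothZ; apply: psmoothM; first exact: psmooth_dotv.
  by apply: psmooth_param; exact: continuous_dotvl.
apply/funext => x; apply/funext => theta; congr (_ + _).
by rewrite /line_through /= dotvDl dotvNl dotvZl mulN1r.
Qed.

Lemma smooth_ridges_fst (theta0 : V) (g : R -> R) : (forall k, smooth1 (chi k)) ->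
  smooth1 g -> smooth (fun p : V * V => a p.1 * g (dotv p.2 theta0)).
Proof.
move=> hchi hg; apply: smoothM.
  apply: smooth_prod => k _; apply: smooth_comp1 => //.
  apply: smoothD; last exact: smooth_cst.
  apply: (@smooth_of_psmooth _ _ (fun (p : V * V) _ => dotv p.1 (m k))); apply: psmooth_linear.
    by move=> e p q; rewrite dotvDl dotvZl.
  apply: (@continuous_compose _ _ _ fst (fun x => dotv x (m k))); last exact: continuous_dotvl.
  exact: continuous_fst.
apply: smooth_comp1 => //.
apply: (@smooth_of_psmooth _ _ (fun (p : V * V) _ => dotv p.2 theta0)); apply: psmooth_linear.
  by move=> e p q; rewrite dotvDl dotvZl.
apply: (@continuous_compose _ _ _ snd (fun x => dotv x theta0)); last exact: continuous_dotvl.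
exact: continuous_snd.
Qed.

(** Between unit vectors the squared Euclidean distance is 2 - 2 (theta . theta0), and it dominates
    the sup norm. *)
Lemma sphere_dist (theta theta0 : V) r : sphere theta -> sphere theta0 ->
  dotv theta theta0 >= 1 - r -> `|theta - theta0| ^+ 2 <= 2 * r.
Proof.
move=> t1 t0 H; apply: le_trans (_ : enorm (theta - theta0) ^+ 2 <= _).
  by rewrite lerXn2r ?nnegrE ?enorm_ge0 // norm_le_enorm.
rewrite sqr_enorm !(dotvDl, dotvDr, dotvNl, dotvNr) -!sqr_enorm t1 t0 (dotvC theta0).
by lra.
Qed.

(* Lines (z, theta) through the tube with axis x0 + R theta0, whose direction
   is close to theta0, form a compact set and meet a neighbourhood of x0. *)
Lemma tube_lines (x0 theta0 : V) (eps : R) (W : set V) : 0 < eps -> sphere theta0 ->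
  (forall x, `|x - x0| < 2 * eps -> W x) ->
  exists2 rho, 0 < rho & forall r, 0 <= r <= rho ->
    let C := [set p : V * V | [/\ oriented_lines p, dotv p.2 theta0 >= 1 - r &
      `|p.1 - x0 - dotv (p.1 - x0) theta0 *: theta0| <= eps]] in
    compact C /\ C `<=` lines_meeting W.
Proof.
move=> eps0 t0 HW; pose D : R := d%:R; pose N0 := `|x0|.
have D0 : 0 <= D by rewrite ler0n.
have N00 : 0 <= N0 by exact: normr_ge0.
(* Since z is orthogonal to theta, |z . theta0| = |z . (theta - theta0)| is at most |z| / 2 for
   theta close to theta0. Absorbing this half into |z| <= eps + N0 + |(z - x0) . theta0| gives |z|
   <= Z, and then S bounds |(z - x0) . theta0|. *)
pose Z := 2 * (eps + N0 + D * N0); pose S := Z / 2 + D * N0.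
have DN0 : 0 <= D * N0 by exact: mulr_ge0.
have S0 : 0 <= S by rewrite /S /Z; lra.
(* The first bound gives the factor 1/2 above; the second makes the line pass within eps + S sg < 2
   eps of x0. The radius sg^2 / 2 given below for r yields |theta - theta0| <= sg by
   [sphere_dist]. *)
pose sg := Num.min (1 / (2 * (D + 1))) (eps / (2 * (S + 1))).
have sg0 : 0 < sg by rewrite lt_min !divr_gt0 // mulr_gt0 //; lra.
have Dsg : D * sg <= 1 / 2.
  have : sg <= 1 / (2 * (D + 1)) by rewrite ge_min lexx.
  rewrite ler_pdivlMr; last by lra.
  nra.
have Ssg : S * sg < eps.
  have : sg <= eps / (2 * (S + 1)) by rewrite ge_min lexx orbT.
  rewrite ler_pdivlMr; last by lra.
  nra.
have nt0 : `|theta0| <= 1 by rewrite -t0 norm_le_enorm.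
exists (sg ^+ 2 / 2) => [|r /andP[r0 rsg] C]; first by rewrite divr_gt0 // exprn_gt0.
have key p : C p -> [/\ `|p.1| <= Z, `|dotv (p.1 - x0) theta0| <= S & `|p.2 - theta0| <= sg].
  move=> [[p1 p2] pr pe].
  have dist : `|p.2 - theta0| <= sg.
    rewrite -(ler_pXn2r (n := 2)) ?nnegrE // ?(ltW sg0) //.
    by apply: le_trans (sphere_dist p1 t0 pr) _; lra.
  have zt : `|dotv p.1 theta0| <= `|p.1| / 2.
    have -> : dotv p.1 theta0 = - dotv p.1 (p.2 - theta0).
      by rewrite dotvDr dotvNr p2; ring.
    rewrite normrN; apply: le_trans (dotv_norm_le _ _) _; rewrite -/D.
    have : D * `|p.1| * `|p.2 - theta0| <= D * `|p.1| * sg.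
      by apply: ler_wpM2l => //; exact: mulr_ge0.
    have := normr_ge0 p.1; nra.
  have xt : `|dotv x0 theta0| <= D * N0.
    apply: le_trans (dotv_norm_le _ _) _; rewrite -/D -/N0.
    by rewrite -[leRHS]mulr1; apply: ler_wpM2l.
  have sE : dotv (p.1 - x0) theta0 = dotv p.1 theta0 - dotv x0 theta0.
    by rewrite dotvDl dotvNl.
  have sb : `|dotv (p.1 - x0) theta0| <= `|p.1| / 2 + D * N0.
    by rewrite sE; apply: le_trans (ler_normB _ _) _; exact: lerD.
  have zb : `|p.1| <= eps + N0 + `|dotv (p.1 - x0) theta0|.
    have E : p.1 = (p.1 - x0 - dotv (p.1 - x0) theta0 *: theta0) + x0 + dotv (p.1 - x0) theta0 *: theta0.
      by rewrite addrAC subrK subrK.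
    rewrite [X in `|X| <= _]E.
    apply: le_trans (ler_normD _ _) _; apply: lerD.
      by apply: le_trans (ler_normD _ _) _; rewrite lerD2r.
    by rewrite normrZ -[leRHS]mulr1; apply: ler_pM.
  have pZ : `|p.1| <= Z by rewrite /Z; lra.
  by split => //; rewrite /S; lra.
split; last first.
  move=> p Cp; have [pZ pS psg] := key p Cp; have [pO _ pe] := Cp; split => //.
  exists (- dotv (p.1 - x0) theta0); apply: HW.
  set s := dotv _ _ in pS pe *.
  have -> : p.1 + - s *: p.2 - x0 = (p.1 - x0 - s *: theta0) - s *: (p.2 - theta0).
    rewrite scalerBr scaleNr; apply/matrixP => i j; rewrite !mxE; ring.
  apply: le_lt_trans (ler_normB _ _) _; rewrite normrZ.
  have : `|s| * `|p.2 - theta0| <= S * sg by apply: ler_pM.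
  lra.
have cf1 : continuous (fun p : V * V => p.1) by move=> p; exact: continuous_fst.
have cf2 : continuous (fun p : V * V => p.2) by move=> p; exact: continuous_snd.
have ct : continuous (fun _ : V * V => theta0) by exact: cst_continuous.
have cl (f : V * V -> R) (A : set R) : continuous f -> closed A -> closed [set p | A (f p)].
  by move=> cf cA; apply: (@closed_comp _ _ f) => // p _; exact: cf.
apply: (subclosed_compact _ (compact_setX (@box_compact R d Z) (@compact_sphere R d))); last first.
  move=> p Cp; have [pZ _ _] := key p Cp; have [[p1 _] _ _] := Cp; split => //= i.
  exact: le_trans (coord_le_norm _ _) pZ.
have cz : continuous (fun p : V * V => p.1 - x0).
  by move=> p; apply: cvgB; [exact: cf1|exact: cst_continuous].
have -> : C = [set p | [set 1] (enorm p.2)] `&` [set p | [set 0] (dotv p.1 p.2)] `&`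
   [set p | [set t | 1 - r <= t] (dotv p.2 theta0)] `&`
   [set p | [set t | t <= eps] `|p.1 - x0 - dotv (p.1 - x0) theta0 *: theta0|].
  by apply/seteqP; split => [p [[]]|p [[[]]]].
apply: closedI; [apply: closedI; [apply: closedI|]|].
- apply: cl; last exact: closed_eq.
  exact: (continuous_compose cf2 (@continuous_enorm R d)).
- by apply: (cl (fun p => dotv p.1 p.2) [set 0]); [exact: continuous_dotv|exact: closed_eq].
- by apply: (cl (fun p => dotv p.2 theta0)); [exact: continuous_dotv|exact: closed_ge].
- apply: (cl (fun p => `|p.1 - x0 - dotv (p.1 - x0) theta0 *: theta0|)); last exact: closed_le.
  have cs : continuous (fun p : V * V => dotv (p.1 - x0) theta0 *: theta0).
    by apply: continuous_scale => //; exact: continuous_dotv.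
  by move=> p; apply: cvg_norm; apply: cvgB; [exact: cz|exact: cs].
Qed.

Lemma tube_vanish K u (W : set V) (x0 theta0 : V) (eps : R) :
  smooth_functional K u -> Xvanish W u -> 0 < eps -> sphere theta0 ->
  (forall x, `|x - x0| < 2 * eps -> W x) ->
  (forall k, smooth1 (chi k)) -> (forall k, dotv theta0 (m k) = 0) ->
  (forall x, a x != 0 -> `|x - x0 - dotv (x - x0) theta0 *: theta0| <= eps) ->
  u a = 0.
Proof.
move=> hu hX eps0 t0 HW hchi hm ha.
have [rho rho0 Hrho] := tube_lines eps0 t0 HW.
(* G evaluates a at the foot of the line through x. At theta0 the foot differs from x by a multiple
   of theta0, along which a is constant. *)
pose G (x theta : V) := a (line_through x theta).1.
have G0 : G^~ theta0 = a.
  apply/funext => x; apply: eq_bigr => k _; congr (chi k (_ + _)).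
  by rewrite /line_through /= dotvDl dotvNl dotvZl hm mulr0 subr0.
rewrite -G0; apply: (functional_concentrate hu (psmooth_ridges_line hchi) compact_sphere).
move=> U e /nbhs_ballP[s /= s0 HU] e0.
(* The bound rho keeps the test lines compact and meeting W; s^2 / 3 puts the support of beta into
   the s-ball around theta0, since 2 r < s^2. *)
pose r := Num.min rho (s ^+ 2 / 3).
have r0 : 0 < r by rewrite lt_min rho0 divr_gt0 // exprn_gt0.
pose beta (theta : V) := bump r (dotv theta theta0 - 1).
have cdot : continuous (fun theta : V => dotv theta theta0 - 1).
  by apply: continuous_sub; [exact: continuous_dotvl|exact: cst_continuous].
have cbeta : continuous beta.
  by apply: (continuous_compose cdot); apply: smooth1_continuous; exact: smooth1_bump.
have Sbeta : 0 < sphere_integral beta.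
  apply: (sphere_integral_gt0 cbeta _ t0 _) => [x|]; first exact: bump_ge0.
  by rewrite /beta -sqr_enorm t0 expr1n subrr; apply: bump_gt0; rewrite normr0.
pose S := (sphere_integral beta)^-1.
have S0 : 0 < S by rewrite invr_gt0.
have cSb : continuous (fun theta => S * beta theta).
  by apply: continuous_mul cbeta; exact: cst_continuous.
have S1 : sphere_integral (fun theta => S * beta theta) = 1.
  by rewrite sphere_integralZ // mulVf // gt_eqF.
have beta_far theta : sphere theta -> ~ U theta -> beta theta = 0.
  move=> t1 Ut; apply: bump_eq0; first exact: ltW.
  rewrite leNgt; apply/negP; rewrite ltr_norml => /andP[H _]; apply: Ut; apply: HU.
  rewrite -ball_normE /= distrC.
  have H2 : `|theta - theta0| ^+ 2 <= 2 * r by apply: sphere_dist => //; lra.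
  have r3 : r <= s ^+ 2 / 3 by rewrite ge_min lexx orbT.
  rewrite -(ltr_pXn2r (n := 2)) ?nnegrE // ?ltW //.
  have := exprn_gt0 2 s0; lra.
pose eta (p : V * V) := a p.1 * (S * bump r (dotv p.2 theta0 - 1)).
have rr : 0 <= r <= rho by rewrite ltW //= ge_min lexx.
have [cC sC] := Hrho r rr.
have sub : closure [set p | oriented_lines p /\ eta p != 0] `<=`
    [set p : V * V | [/\ oriented_lines p, dotv p.2 theta0 >= 1 - r &
      `|p.1 - x0 - dotv (p.1 - x0) theta0 *: theta0| <= eps]].
  rewrite [X in _ `<=` X](closure_id _).1; last by apply: compact_closed cC; exact: norm_hausdorff.
  apply: closure_subset => p [pO]; rewrite /eta mulf_eq0 negb_or => /andP[/ha ap].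
  rewrite mulf_eq0 negb_or => /andP[_ bp]; split => //.
  rewrite leNgt; apply: contra bp => H; rewrite bump_eq0 ?ltW //.
  by rewrite ler0_norm; lra.
exists (fun g => sphere_integral (fun theta => S * beta theta * g theta)); split.
- move=> k g h cg ch; rewrite -sphere_integral_lin; [|exact: continuous_mul..].
  by congr sphere_integral; apply/funext => x; ring.
- by rewrite -[RHS]S1; congr sphere_integral; apply/funext => x; rewrite mulr1.
- move=> g e' B cg e'0 B0 Hg _; apply: le_trans (_ : e' <= _); last by rewrite lerDl mulr_ge0 // ltW.
  have E k : sphere_integral (fun theta => k * (S * beta theta)) = k.
    by rewrite sphere_integralZ // S1 mulr1.
  have cg' : continuous (fun theta => S * beta theta * g theta) by exact: continuous_mul.
  have ck k : continuous (fun theta => k * (S * beta theta)).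
    by apply: continuous_mul cSb; exact: cst_continuous.
  have bnd theta : sphere theta -> `|S * beta theta * g theta| <= e' * (S * beta theta).
    move=> t1; have [Ut|Ut] := pselect (U theta); last by rewrite beta_far // mulr0 mul0r normr0 mulr0.
    have Sb0 : 0 <= S * beta theta by apply: mulr_ge0; [exact: ltW|exact: bump_ge0].
    by rewrite normrM (ger0_norm Sb0) mulrC; apply: ler_wpM2r => //; exact: Hg.
  rewrite ler_norml; apply/andP; split.
    rewrite -[X in X <= _]E; apply: sphere_integral_le => // theta /bnd.
    by rewrite ler_norml mulNr => /andP[].
  rewrite -[X in _ <= X]E; apply: sphere_integral_le => // theta /bnd.
  by rewrite ler_norml => /andP[].
(* The average of G with weight S beta is the sphere integral of eta along the lines through x,
   where [Xvanish] applies. *)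
- have := hX eta; rewrite (_ : (fun x => sphere_integral _) =
    (fun x => sphere_integral (fun theta => S * beta theta * G x theta))); last first.
    by apply/funext => x; congr sphere_integral; apply/funext => theta; rewrite mulrC.
  apply.
  + apply: (@smooth_ridges_fst theta0 (fun t => S * bump r (t - 1))) => //.
    apply: smooth1M; first exact: smooth1_cst.
    apply: (@smooth1_comp _ (fun t => t - 1) (bump r)); last exact: smooth1_bump.
    by apply: smooth1D; [exact: smooth1_id|exact: smooth1_cst].
  + exact: subclosed_compact (@closed_closure _ _) cC sub.
  + exact: subset_trans sub sC.
Qed.

End Ridges.
End Tube.

(** * Superpositions and density of polynomials *)

Section IntervalIntegral.
Context {R : realType}.
Notation mu := (@lebesgue_measure R).
Implicit Types (a b : R) (g h P : R -> R).

Definition itg a b g : R := \int[mu]_(t in `[a, b]) g t.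

Let itg_integrable a b g : continuous g -> mu.-integrable `[a, b] (EFin \o g).
Proof.
move=> cg; apply: continuous_compact_integrable; first exact: segment_compact.
exact: continuous_subspaceT.
Qed.

Lemma itg_lin a b (k : R) g h : continuous g -> continuous h ->
  itg a b (fun t => k * g t + h t) = k * itg a b g + itg a b h.
Proof.
move=> cg ch; have [ig ih] := (itg_integrable a b cg, itg_integrable a b ch).
rewrite /itg -RintegralZl // -RintegralD //.
by apply: (@itg_integrable a b (fun t => k * g t)); apply: continuous_mul => //; exact: cst_continuous.
Qed.

Lemma itg_cst a b k : a <= b -> itg a b (fun=> k) = k * (b - a).
Proof.
move=> ab; rewrite /itg Rintegral_cst //= lebesgue_measure_itv /= lte_fin; congr (_ * _).
by case: ifPn => //; rewrite -leNgt /=; lra.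
Qed.

Lemma itg_bound a b g e : a <= b -> continuous g ->
  (forall t, a <= t <= b -> `|g t| <= e) -> `|itg a b g| <= e * (b - a).
Proof.
move=> ab cg ge; rewrite /itg; apply: le_trans (le_normr_Rintegral _ (itg_integrable a b cg)) _ => //.
rewrite -itg_cst //; apply: le_Rintegral => //.
- exact: (integrable_norm (itg_integrable a b cg)).
- exact: (@itg_integrable a b (fun=> e) (@cst_continuous R R e)).
Qed.

Lemma itg_le a b g h : a <= b -> continuous g -> continuous h ->
  (forall t, a <= t <= b -> g t <= h t) -> itg a b g <= itg a b h.
Proof.
move=> ab cg ch gh; have [ig ih] := (itg_integrable a b cg, itg_integrable a b ch).
by apply: le_Rintegral => // t; rewrite /= in_itv /=; exact: gh.
Qed.

Lemma is_derive1_continuous P g (x : R) : is_derive x 1 P (g x) -> {for x, continuous P}.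
Proof. by move=> [dP _]; apply/differentiable_continuous/derivable1_diffP. Qed.

Lemma itg_ftc a b g P : a <= b -> continuous g ->
  (forall x : R, a <= x <= b -> is_derive x 1 P (g x)) -> itg a b g = P b - P a.
Proof.
rewrite le_eqVlt => /predU1P[<- _ _|ab cg dP].
  by rewrite subrr /itg set_itv1 Rintegral_set1.
rewrite /itg /Rintegral (continuous_FTC2 ab (F := P)) //.
- exact: continuous_subspaceT.
- have cP x : a <= x <= b -> {for x, continuous P} by move=> /dP; exact: is_derive1_continuous.
  split.
  + move=> x; rewrite in_itv /= => /andP[ax xb].
    by have [] := dP x; rewrite ?(ltW ax) ?(ltW xb).
  + by apply: cvg_at_right_filter; apply: cP; rewrite lexx ltW.
  + by apply: cvg_at_left_filter; apply: cP; rewrite lexx ltW.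
- move=> x; rewrite in_itv /= => /andP[ax xb]; rewrite derive1E.
  by have [] := dP x; rewrite ?(ltW ax) ?(ltW xb).
Qed.

(** Additivity and the changes of variables below are read off from primitives by differentiation,
    on an interval large enough for all the endpoints. *)
Lemma primitive_exists (N : R) g : continuous g ->
  exists P, forall x : R, - N < x < N -> is_derive x 1 P (g x).
Proof.
move=> cg; exists (fun x => itg (- N) x g) => x /andP[Nx xN].
have [dF Fx] := continuous_FTC1_closed xN (itg_integrable (- N) N cg) Nx (cg x).
by apply: (DeriveDef dF); rewrite -derive1E; exact: Fx.
Qed.

Lemma itg_cat a b c g : a <= b -> b <= c -> continuous g ->
  itg a c g = itg a b g + itg b c g.
Proof.
move=> ab bc cg; have [P dP] := primitive_exists (`|a| + `|c| + 1) cg.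
have in_N x : a <= x <= c -> - (`|a| + `|c| + 1) < x < `|a| + `|c| + 1.
  have := ler_norm c; have := ler_norm (- a); rewrite normrN.
  by have := normr_ge0 a; have := normr_ge0 c; lra.
have E p q : a <= p -> p <= q -> q <= c -> itg p q g = P q - P p.
  by move=> ap pq qc; apply: itg_ftc => // x xb; apply: dP; apply: in_N; lra.
rewrite !E //; first ring.
exact: le_trans bc.
Qed.

Lemma average_itg a b (w : R -> R) : a <= b -> continuous w ->
  average `[a, b]%classic (fun g => itg a b (fun t => w t * g t)).
Proof.
move=> ab cw; split; first exact: segment_compact.
- move=> k g h cg ch; rewrite -itg_lin; [|exact: continuous_mul..].
  by congr itg; apply/funext => t; ring.
- have [M M0 HM] := compact_le_bound (@segment_compact R a b) cw.
  exists (M * (b - a)) => [|g e cg e0 He]; first by rewrite mulr_ge0 // subr_ge0.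
  rewrite mulrAC; apply: itg_bound => //; first exact: continuous_mul.
  move=> t tab; rewrite normrM ler_pM //; [apply: HM|apply: He]; by rewrite /= in_itv.
Qed.

End IntervalIntegral.

Section FunctionalIntegral.
Context {R : realType} {V : normedModType R}.
Implicit Types (u : (V -> R) -> R) (K : set V) (G : V -> R -> R).

Lemma average_itg1 (a b : R) : a <= b -> average `[a, b]%classic (itg a b).
Proof.
move=> ab; have := average_itg ab (@cst_continuous R R 1).
by rewrite (_ : (fun g => itg a b (fun t => 1 * g t)) = itg a b) //;
  apply/funext => g; congr itg; apply/funext => t; rewrite mul1r.
Qed.

Lemma psmooth_itg (a b : R) G : a <= b -> psmooth G -> smooth (fun x => itg a b (G x)).
Proof. by move=> ab hG; exact: average_smooth (average_itg1 ab) hG. Qed.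

(** On each cell of length eta the integrand stays within e of its value at the left end; the cells
    add up. *)
Lemma riemann_sum_le (g : R -> R) (a eta e : R) k : continuous g -> 0 <= eta ->
  (forall t h, a <= t <= a + k%:R * eta -> 0 <= h <= eta -> `|g (t + h) - g t| <= e) ->
  `|itg a (a + k%:R * eta) g - \sum_(i < k) eta * g (a + i%:R * eta)| <= k%:R * (e * eta).
Proof.
move=> cg eta0; elim: k => [|k IH] H.
  by rewrite big_ord0 !mul0r addr0 subr0 /itg set_itv1 Rintegral_set1 normr0.
have k0 : 0 <= k%:R * eta by rewrite mulr_ge0.
have E : a + k.+1%:R * eta = a + k%:R * eta + eta by rewrite -[in LHS]natr1; ring.
rewrite big_ord_recr /= E (@itg_cat _ a (a + k%:R * eta)) //; [|by lra..].
have -> : itg a (a + k%:R * eta) g + itg (a + k%:R * eta) (a + k%:R * eta + eta) g -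
   (\sum_(i < k) eta * g (a + i%:R * eta) + eta * g (a + k%:R * eta)) =
   (itg a (a + k%:R * eta) g - \sum_(i < k) eta * g (a + i%:R * eta)) +
   (itg (a + k%:R * eta) (a + k%:R * eta + eta) g - eta * g (a + k%:R * eta)) by ring.
rewrite -natr1 mulrDl mul1r; apply: le_trans (ler_normD _ _) _; apply: lerD.
  by apply: IH => t h th; apply: H; rewrite E; lra.
set b := a + k%:R * eta in E *.
have -> : itg b (b + eta) g - eta * g b = itg b (b + eta) (fun t => (-1) * g b + g t).
  have cc := @cst_continuous R R (g b).
  by rewrite (@itg_lin _ _ _ (-1) (fun=> g b)) // itg_cst ?lerDl //; ring.
have eE : e * eta = e * (b + eta - b) by ring.
rewrite eE; apply: itg_bound; first by rewrite lerDl.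
  apply: continuous_lincomb => //; exact: cst_continuous.
move=> t tb; have bt : b + (t - b) = t by ring.
rewrite mulN1r addrC -{1}bt; apply: H; rewrite ?E; last lra.
by apply/andP; split; rewrite ?lerDl.
Qed.

Lemma iterD_sum s k (phi : 'I_k -> V -> R) x : (forall i, smooth (phi i)) ->
  iterD s (fun x => \sum_i phi i x) x = \sum_i iterD s (phi i) x.
Proof.
elim: k phi => [|k IH] phi hphi.
  rewrite big_ord0 (_ : (fun x => _) = (fun=> 0)); last by apply/funext => y; rewrite big_ord0.
  elim: s x => [//|v s IHs] x /=; rewrite (_ : iterD s _ = cst 0) ?derive_cst //.
  by apply/funext => y; exact: IHs.
rewrite big_ord_recl -(IH (fun i => phi (lift ord0 i))) //.
rewrite (_ : (fun x => _) = (fun x => 1 * phi ord0 x + \sum_i phi (lift ord0 i) x)); last first.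
  by apply/funext => y; rewrite big_ord_recl mul1r.
by rewrite iterD_lincomb ?mul1r //; exact: smooth_sum.
Qed.

Lemma iterDZ s (k : R) (phi : V -> R) x : smooth phi ->
  iterD s (fun x => k * phi x) x = k * iterD s phi x.
Proof.
move=> hphi; have := iterD_lincomb s (k - 1) x hphi hphi.
rewrite (_ : (fun x => _) = (fun x => k * phi x)); last by apply/funext => y; ring.
by move=> ->; ring.
Qed.

(** The integral is the limit, with the derivatives in S uniformly on K, of left Riemann sums, which
    u annihilates term by term. *)
Lemma functional_itg K u G (a b : R) : smooth_functional K u -> psmooth G -> a <= b ->
  (forall t, a <= t <= b -> u (G^~ t) = 0) -> u (fun x => itg a b (G x)) = 0.
Proof.
move=> hu hG ab uG; have [cK _ _] := hu; have sm := psmooth_itg ab hG.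
apply: (functional_approx hu sm) => S e e0.
have e'0 : 0 < e / (b - a + 1) by rewrite divr_gt0 // ltr_wpDl // subr_ge0.
have : \forall h \near (0 : R), forall s, s \in S -> forall x t, K x -> a <= t <= b ->
    `|iterD s (G^~ (t + h)) x - iterD s (G^~ t) x| <= e / (b - a + 1).
  elim: S => [|s S IH]; first by near=> h.
  pose D (p : R * (V * R)) := iterD s (G^~ (p.2.2 + p.1)) p.2.1.
  have cD : continuous D.
    apply: (@continuous_compose _ _ _ (fun p : R * (V * R) => (p.2.1, p.2.2 + p.1))
      (fun p : V * R => iterD s (G^~ p.2) p.1)); last exact: psmooth_continuous (psmooth_iterD s hG).
    have c1 : continuous (fun p : R * (V * R) => p.1) by move=> p; exact: continuous_fst.
    have c2 : continuous (fun p : R * (V * R) => p.2) by move=> p; exact: continuous_snd.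
    have c21 : continuous (fun p : R * (V * R) => p.2.1).
      by apply: (@continuous_compose _ _ _ snd fst) => // p; exact: continuous_fst.
    have c22 : continuous (fun p : R * (V * R) => p.2.2).
      by apply: (@continuous_compose _ _ _ snd snd) => // p; exact: continuous_snd.
    move=> p; apply: (@continuous_pair _ _ _ (fun p : R * (V * R) => p.2.1) (fun p => p.2.2 + p.1)).
      exact: c21.
    exact: (continuous_add c22 c1).
  have := near_uniform (0 : R) (compact_setX cK (@segment_compact R a b)) cD e'0.
  move: IH; apply: filterS2 => h IH Hh s'; rewrite inE => /orP[/eqP -> x t Kx tab|]; last exact: IH.
  have := Hh (x, t); rewrite /D /= addr0 => H; apply/ltW/H; by split.
move=> /nbhs_ballP[r /= r0 Hr].
pose n := (Num.truncn ((b - a) / r)).+1; pose eta := (b - a) / n%:R.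
have n0 : 0 < n%:R :> R by rewrite ltr0n.
have eta0 : 0 <= eta by rewrite divr_ge0 // subr_ge0.
have etar : eta < r by rewrite ltr_pdivrMr // mulrC -ltr_pdivrMr // truncnS_gt.
have bE : b = a + n%:R * eta by rewrite mulrC divfK ?gt_eqF //; ring.
have tab (i : 'I_n) : a <= a + i%:R * eta <= b.
  rewrite lerDl mulr_ge0 //= [leRHS]bE lerD2l ler_wpM2r // ler_nat; exact: ltnW.
have sG (i : 'I_n) : smooth (fun x => eta * G x (a + i%:R * eta)).
  by apply: smoothM (smooth_cst _) _; exact: psmooth_smooth.
exists (fun x => \sum_(i < n) eta * G x (a + i%:R * eta)); split.
- by apply: smooth_sum => i _; exact: sG.
- rewrite (functional_sum _ hu sG).
  by apply: big1 => i _; rewrite (functionalZ _ hu) ?uG ?mulr0 //; exact: psmooth_smooth.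
- move=> s x sS Kx; rewrite (average_iterD s (average_itg1 ab) hG).
  rewrite (iterD_sum s _ sG).
  have EZ (i : 'I_n) : iterD s (fun x => eta * G x (a + i%:R * eta)) x =
      eta * iterD s (G^~ (a + i%:R * eta)) x.
    by rewrite iterDZ //; exact: psmooth_smooth.
  under eq_bigr do rewrite EZ.
  rewrite [X in itg a X]bE.
  have cs : continuous (fun t => iterD s (G^~ t) x).
    exact: (@psmooth_slice _ _ _ (fun x t => iterD s (G^~ t) x) x (psmooth_iterD s hG)).
  apply: le_trans (riemann_sum_le (e := e / (b - a + 1)) cs eta0 _) _.
    move=> t h; rewrite -bE => th /andP[h0 heta]; apply: Hr => //.
    by rewrite /ball /= sub0r normrN ger0_norm // (le_lt_trans heta).
  have nE : n%:R * eta = b - a by rewrite mulrC divfK // gt_eqF.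
  have -> : n%:R * (e / (b - a + 1) * eta) = (n%:R * eta) * (e / (b - a + 1)) by ring.
  by rewrite nE; apply: mulr_div_succ_le => //; rewrite subr_ge0.
Unshelve. all: by end_near. Qed.

(** By the fundamental theorem of calculus, the difference quotients of G are averages of H over
    [t0, t0 + h]; these concentrate at t0. *)
Lemma functional_deriv K u G (H : V -> R -> R) (t0 e : R) : smooth_functional K u ->
  psmooth H -> 0 < e -> (forall t, smooth (G^~ t)) ->
  (forall x (t : R), is_derive t 1 (G x) (H x t)) ->
  (forall t, `|t - t0| <= e -> u (G^~ t) = 0) -> u (H^~ t0) = 0.
Proof.
move=> hu hH e0 sG dG uG.
apply: (functional_concentrate hu hH (@segment_compact R (t0 - e) (t0 + e))).
move=> U eta /nbhs_ballP[r /= r0 HU] eta0.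
pose h := Num.min e (r / 2).
have h0 : 0 < h by rewrite lt_min e0 divr_gt0.
have he : h <= e by rewrite ge_min lexx.
have hr : h < r by rewrite gt_min; apply/orP; right; lra.
have th : t0 <= t0 + h by rewrite lerDl ltW.
exists (fun g => h^-1 * itg t0 (t0 + h) g); split.
- by move=> k g g' cg cg'; rewrite itg_lin //; ring.
- by rewrite itg_cst // mul1r addrAC subrr add0r mulVf // gt_eqF.
- move=> g e' B cg e'0 B0 Hg _; apply: le_trans (_ : e' <= _); last by rewrite lerDl mulr_ge0 // ltW.
  rewrite normrM ger0_norm ?invr_ge0 ?(ltW h0) // mulrC ler_pdivrMr //.
  have -> : e' * h = e' * (t0 + h - t0) by ring.
  apply: itg_bound => // t tb; apply: Hg; first by rewrite /= in_itv /=; lra.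
  by apply: HU; rewrite /ball /= ltr_norml; lra.
- rewrite (_ : (fun x => _) = (fun x => h^-1 * (G x (t0 + h) - G x t0))).
    rewrite (functionalZ _ hu); last exact: smoothB.
    rewrite (functionalB hu) // !uG ?subrr ?mulr0 ?normr0 ?(ltW e0) //.
    by rewrite addrAC subrr add0r ger0_norm // ltW.
  apply/funext => x; rewrite (@itg_ftc _ _ _ _ (G x)) //.
  exact: psmooth_slice.
Qed.

End FunctionalIntegral.

(** * Landau kernels *)

Section LandauKernel.
Context {R : realType}.

Definition landau (S : R) (n : nat) (t : R) : R := (1 - t ^+ 2 / S ^+ 2) ^+ n.

Lemma continuous_landau S n : continuous (landau S n).
Proof.
have cid : continuous (fun x : R => x) by move=> x; exact: cvg_id.
have cc (c : R) := @cst_continuous R R c.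
have c1 : continuous (fun t : R => 1 - t ^+ 2 / S ^+ 2).
  apply: continuous_sub => //; apply: continuous_mul => //.
  exact: (continuous_mul cid cid).
rewrite /landau; elim: n => [|n IH].
  by rewrite (_ : (fun t => _) = (fun=> 1)) //; apply/funext => t; rewrite expr0.
rewrite (_ : (fun t => _) = (fun t => (1 - t ^+ 2 / S ^+ 2) * (1 - t ^+ 2 / S ^+ 2) ^+ n)).
  exact: continuous_mul.
by apply/funext => t; rewrite exprS.
Qed.

(** The kernel is at most q1^n for |t| >= r and at least q2^n for |t| <= r / 2, with q1 < q2. The
    total mass is thus at least q2^n r, while the far mass is at most q1^n 2 S. *)
Lemma landau_concentrates (S r eta : R) : 0 < S -> 0 < r -> 0 < eta ->
  exists n : nat, let Z := itg (- S) S (landau S n) in 0 < Z /\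
    forall g e B, continuous g -> 0 <= e -> 0 <= B ->
      (forall t, - S <= t <= S -> `|t| < r -> `|g t| <= e) ->
      (forall t, - S <= t <= S -> `|g t| <= B) ->
      `|itg (- S) S (fun t => landau S n t * g t)| <= Z * (e + eta * B).
Proof.
move=> S0; wlog rS : r / r <= S.
  move=> H r0 eta0; have [/H|/ltW Sr] := leP r S; first exact.
  have [n [Z0 Hn]] := H S (lexx S) S0 eta0; exists n; split => // g e B cg e0 B0 H1 H2.
  by apply: Hn => // t tS tr; apply: H1 => //; exact: lt_le_trans Sr.
move=> r0 eta0; have SS : - S <= S by lra.
pose q1 := 1 - r ^+ 2 / S ^+ 2; pose q2 := 1 - (r / 2) ^+ 2 / S ^+ 2.
have S20 : 0 < S ^+ 2 by exact: exprn_gt0.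
have sq t : `|t| <= S -> 0 <= t ^+ 2 / S ^+ 2 <= 1.
  move=> tS; rewrite divr_ge0 ?sqr_ge0 ?(ltW S20) //= ler_pdivrMr // mul1r -[t ^+ 2]real_normK ?num_real //.
  by rewrite lerXn2r ?nnegrE ?(ltW S0).
have q10 : 0 <= q1 by have := sq r; rewrite (ger0_norm (ltW r0)) => /(_ rS); rewrite /q1; lra.
have q12 : q1 < q2.
  by rewrite /q1 /q2 ltrD2l ltrN2 ltr_pM2r ?invr_gt0 //; nra.
have q20 : 0 < q2 by exact: le_lt_trans q12.
have ratio1 : `|q1 / q2| < 1 by rewrite ger0_norm ?divr_ge0 ?(ltW q20) // ltr_pdivrMr // mul1r.
(* With (q1 / q2)^n below this constant, the far mass is at most eta q2^n r, hence at most eta Z. *)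
have e0 : 0 < eta * r / (2 * S) by rewrite divr_gt0 ?mulr_gt0.
have /cvgrPdist_le /(_ _ e0) [n _ /(_ n (leqnn n))] := cvg_expr ratio1.
rewrite /= sub0r normrN normrX ger0_norm ?divr_ge0 ?(ltW q20) // => Hn.
exists n => /=; set Z := itg (- S) S (landau S n); have cL : continuous (landau S n) by exact: continuous_landau.
have L0 t : - S <= t <= S -> 0 <= landau S n t.
  by move=> tS; apply: exprn_ge0; have := sq t; rewrite ler_norml => /(_ tS); lra.
have Zge : q2 ^+ n * r <= Z.
  rewrite /Z (@itg_cat _ _ (- (r / 2))) //; [|lra..]; rewrite (@itg_cat _ (- (r / 2)) (r / 2)) //; [|lra..].
  have pos a b : - S <= a -> a <= b -> b <= S -> 0 <= itg a b (landau S n).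
    move=> Sa ab bS; rewrite -[leLHS](mul0r (b - a)) -itg_cst //; apply: itg_le => //.
      exact: cst_continuous.
    by move=> t tab; apply: L0; lra.
  have := pos (- S) (- (r / 2)); have := pos (r / 2) S.
  suff : q2 ^+ n * r <= itg (- (r / 2)) (r / 2) (landau S n) by lra.
  have -> : q2 ^+ n * r = itg (- (r / 2)) (r / 2) (fun=> q2 ^+ n).
    by rewrite itg_cst; [congr (_ * _); field|lra].
  apply: itg_le => //; [lra|exact: cst_continuous|move=> t tr].
  rewrite /landau lerXn2r ?nnegrE ?(ltW q20) //.
    have tS : - S <= t <= S by lra.
    by have := sq t; rewrite ler_norml => /(_ tS); lra.
  rewrite /q2 lerD2l lerN2 ler_pM2r ?invr_gt0 // -[t ^+ 2]real_normK ?num_real //.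
  by rewrite lerXn2r ?nnegrE ?divr_ge0 ?(ltW r0) // ler_norml.
have Z0 : 0 < Z by apply: lt_le_trans Zge; rewrite mulr_gt0 // exprn_gt0.
split => // g e B cg ee0 B0 H1 H2.
pose b t := e * landau S n t + (fun=> q1 ^+ n * B) t.
have cb : continuous b by apply: continuous_lincomb => //; exact: cst_continuous.
have Hb t : - S <= t <= S -> `|landau S n t * g t| <= b t.
  move=> tS; rewrite normrM (ger0_norm (L0 t tS)) /b; have [tr|tr] := ltP `|t| r.
    rewrite mulrC -[leLHS]addr0 lerD ?ler_wpM2r ?L0 ?H1 //.
    by rewrite mulr_ge0 // exprn_ge0.
  rewrite -[leLHS]add0r lerD ?mulr_ge0 ?L0 //; apply: ler_pM; rewrite ?L0 ?H2 //.
  rewrite /landau lerXn2r ?nnegrE //.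
    by have := sq t; rewrite ler_norml => /(_ tS); lra.
  rewrite /q1 lerD2l lerN2 ler_pM2r ?invr_gt0 // -[t ^+ 2]real_normK ?num_real //.
  by rewrite lerXn2r ?nnegrE ?(ltW r0).
have cLg : continuous (fun t => landau S n t * g t) by exact: continuous_mul.
have : `|itg (- S) S (fun t => landau S n t * g t)| <= itg (- S) S b.
  rewrite ler_norml; apply/andP; split; last first.
    by apply: itg_le => // t /Hb; rewrite ler_norml => /andP[].
  have -> : - itg (- S) S b = itg (- S) S (fun t => (-1) * b t + (fun=> 0) t).
    rewrite [RHS](itg_lin _ _ _ cb (@cst_continuous R R 0)).
    by rewrite (itg_cst 0 SS) mul0r addr0 mulN1r.
  apply: itg_le => //; first by apply: continuous_lincomb => //; exact: cst_continuous.
  by move=> t /Hb; rewrite addr0 mulN1r ler_norml => /andP[].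
move=> /le_trans; apply; rewrite itg_lin //; last exact: cst_continuous.
rewrite -/Z itg_cst //.
have H : q1 ^+ n * (2 * S) <= Z * eta.
  apply: le_trans (_ : q2 ^+ n * r * eta <= _); last by rewrite ler_wpM2r // ltW.
  have -> : q1 ^+ n = (q1 / q2) ^+ n * q2 ^+ n by rewrite -exprMn divfK // gt_eqF.
  have -> : q2 ^+ n * r * eta = (eta * r / (2 * S)) * (q2 ^+ n * (2 * S)).
    by field; rewrite gt_eqF.
  rewrite -mulrA ler_wpM2r // mulr_ge0 // ?exprn_ge0 ?(ltW q20) //.
  by rewrite mulr_ge0 // ltW.
have := ler_wpM2r B0 H; lra.
Qed.

Lemma itg_zero_continuous (a b : R) (g : R -> R) : a <= b -> continuous g ->
  (forall t, a <= t <= b -> g t = 0) -> itg a b g = 0.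
Proof.
move=> ab cg g0; apply/eqP; rewrite -normr_le0 -[leRHS](mul0r (b - a)).
by apply: itg_bound => // t /g0 ->; rewrite normr0.
Qed.

(** The substitution s = y - t maps [-4B, 4B] onto [y - 4B, y + 4B], which contains [-2B, 2B]
    because |y| <= B; outside the latter h vanishes. All endpoints stay within 5B, so a primitive on
    (-6B, 6B) serves. *)
Lemma itg_reflect (h L : R -> R) (y B : R) : 0 < B -> `|y| <= B ->
  continuous h -> continuous L -> (forall s, 2 * B <= `|s| -> h s = 0) ->
  itg (- (4 * B)) (4 * B) (fun t => L t * h (y - t)) =
  itg (- (2 * B)) (2 * B) (fun s => L (y - s) * h s).
Proof.
rewrite ler_norml => B0 yB ch cL h0.
have cid : continuous (fun x : R => x) by move=> x; exact: cvg_id.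
have cyt : continuous (fun t : R => y - t) by apply: continuous_sub => //; exact: cst_continuous.
have c1 : continuous (fun s => L (y - s) * h s) by apply: continuous_mul => //; exact: continuous_compose cL.
have c2 : continuous (fun t => L t * h (y - t)) by apply: continuous_mul => //; exact: continuous_compose ch.
have [P dP] := primitive_exists (6 * B) c1.
have E1 a b : - (6 * B) < a -> a <= b -> b < 6 * B ->
    itg a b (fun s => L (y - s) * h s) = P b - P a.
  by move=> Ha ab Hb; apply: itg_ftc => // x xab; apply: dP; lra.
have -> : itg (- (4 * B)) (4 * B) (fun t => L t * h (y - t)) =
    (- P (y - 4 * B)) - (- P (y - - (4 * B))).
  apply: (@itg_ftc _ _ _ _ (fun t => - P (y - t))) => // [|t tB]; first lra.
  have d1 : is_derive t 1 (fun t : R => y - t) (- 1).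
    by have := is_deriveB (is_derive_cst y t 1) (is_derive_id t 1); rewrite sub0r.
  have d2 : is_derive (y - t) 1 P (L t * h (y - t)).
    by have := dP (y - t); rewrite (_ : y - (y - t) = t); [apply; lra|ring].
  have := is_deriveN (@is_derive_comp1 _ R^o _ t 1 _ P _ d1 d2).
  by move/is_derive_eq; apply; ring.
rewrite opprK addrC.
have Z a b : - (6 * B) < a -> a <= b -> b < 6 * B -> (2 * B <= a \/ b <= - (2 * B)) -> P b = P a.
  move=> Ha ab Hb H; apply/eqP; rewrite -subr_eq0 -E1 //; apply/eqP.
  apply: itg_zero_continuous => // t tab; rewrite h0 ?mulr0 // lter_normr.
  by apply/orP; case: H => H; [left|right]; lra.
rewrite E1 ?(Z (2 * B) (y - - (4 * B))) ?(Z (y - 4 * B) (- (2 * B))) //; try lra.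
all: by [left; lra|right; lra].
Qed.

End LandauKernel.

Section Density.
Context {R : realType} {V : normedModType R}.
Implicit Types (u : (V -> R) -> R) (K : set V).

Lemma smooth_affine_form (lin : V -> R) (c : R) : linear lin -> continuous lin ->
  smooth (fun x => lin x + c).
Proof.
move=> ll cl; apply: (@smooth_of_psmooth _ _ (fun x _ => lin x + c)).
by apply: psmoothD; [exact: psmooth_linear|exact: psmooth_cst].
Qed.

(* Near K, psi(x) is the limit of the averages of psi(x - t w) against Landau's
   kernel in t; substituting s = l(x) - t turns each of them into a polynomial in
   l(x) with coefficients that are constant along w. *)
Lemma landau_step K u (M psi lin : V -> R) (c : R) (w : V) :
  smooth_functional K u -> smooth M -> smooth psi ->
  linear lin -> continuous lin -> lin w = 1 ->
  (forall k psi', smooth psi' -> (forall x t, psi' (x + t *: w) = psi' x) ->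
    (forall v, lin v = 0 -> (forall x t, psi (x + t *: v) = psi x) ->
      forall x t, psi' (x + t *: v) = psi' x) ->
    u (fun x => M x * (lin x + c) ^+ k * psi' x) = 0) ->
  u (fun x => M x * psi x) = 0.
Proof.
move=> hu hM hpsi ll cl lw H; have [cK _ _] := hu.
pose l x := lin x + c.
have sl : smooth l by exact: smooth_affine_form.
have lD x (t : R) v : l (x + t *: v) = l x + t * lin v.
  by rewrite /l addrC -/(lin _) [x + _]addrC ll; rewrite /GRing.scale /=; ring.
have [B0 _ HB0] := compact_le_bound cK (smooth_continuous sl).
pose B := `|B0| + 1; have B_gt0 : 0 < B by rewrite ltr_wpDl.
have HB x : K x -> `|l x| < B.
  by move=> /HB0 lx; rewrite /B; apply: le_lt_trans lx _; have := ler_norm B0; lra.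
pose O := [set x | `|l x| < B].
have oO : open O.
  rewrite (_ : O = (fun x => `|l x|) @^-1` [set t | t < B]) //.
  apply: open_comp; last exact: open_lt.
  by move=> x _; apply: cvg_norm; exact: smooth_continuous.
(* The point x + (s - l x) w is where the line x + R w meets the level l = s; for fixed s, h is
   therefore constant in x along w. *)
pose h (x : V) (s : R) := cutoff B s * psi (x + (s - l x) *: w).
pose P x := x - lin x *: w.
have hpsm : psmooth h.
  apply: psmoothM; first by apply: psmooth_param; apply: smooth1_continuous; exact: smooth1_cutoff.
  rewrite (_ : (fun x t => _) = (fun (x : V) (t : R) => psi (P x + (t - c) *: w))).
    apply: psmooth_affine => //.
    - by move=> a x y; rewrite /P ll scalerBr scalerDl opprD addrACA scalerA.
    - by move=> x; apply: cvgB; [exact: cvg_id|apply: cvgZr_tmp; exact: cl].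
    - by move=> t; apply: cvgZr_tmp; apply: cvgB; [exact: cvg_id|exact: cst_continuous].
  apply/funext => x; apply/funext => t; congr psi.
  by rewrite /P /l -addrA -scaleNr -scalerDl; congr (_ + _ *: _); ring.
have B2 : - (2 * B) <= 2 * B by lra.
have cid : continuous (fun t : R => t) by move=> t; exact: cvg_id.
have ccst (k : R) : continuous (fun _ : R => k) by exact: cst_continuous.
pose ker n x s := (1 - (l x - s) ^+ 2 / (4 * B) ^+ 2) ^+ n.
have kpsm n (q : R -> R) : continuous q -> psmooth (fun x s => q s * ker n x s * h x s).
  move=> cq; apply: psmoothM => //; apply: psmoothM; first exact: psmooth_param.
  apply: psmoothX; apply: psmoothB; first exact: psmooth_cst.
  apply: psmoothM; last exact: psmooth_cst.
  apply: psmoothX; apply: psmoothB; first exact: psmooth_const.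
  exact: psmooth_param.
(* One kernel factor is expanded at a time as a quadratic polynomial in l x: the powers of l go into
   k, the coefficients, functions of s, into q. At n = 0 the integral is constant along w and H
   applies. *)
have kill n : forall k (q : R -> R), continuous q ->
    u (fun x => M x * l x ^+ k * itg (- (2 * B)) (2 * B) (fun s => q s * ker n x s * h x s)) = 0.
  elim: n => [|n IH] k q cq.
    apply: H.
    - exact: psmooth_itg (kpsm 0 q cq).
    - move=> x t; congr itg; apply/funext => s; rewrite /ker !expr0; congr (_ * (_ * psi _)).
      by rewrite lD lw mulr1 -addrA -scalerDl; congr (_ + _ *: _); ring.
    - move=> v lv Hv x t; congr itg; apply/funext => s; rewrite /ker !expr0; congr (_ * (_ * _)).
      by rewrite lD lv mulr0 addr0 addrAC Hv.
  pose I (q : R -> R) x := itg (- (2 * B)) (2 * B) (fun s => q s * ker n x s * h x s).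
  have sI (q' : R -> R) j : continuous q' -> smooth (fun x => M x * l x ^+ j * I q' x).
    by move=> cq'; apply: smoothM; [apply: smoothM => //; exact: smoothX|exact: psmooth_itg (kpsm n q' cq')].
  pose q0 s := q s * (1 - s ^+ 2 / (4 * B) ^+ 2).
  pose q1 s := q s * (2 * s / (4 * B) ^+ 2).
  pose q2 s := q s * - ((4 * B) ^+ 2)^-1.
  have c0 : continuous q0.
    apply: continuous_mul => //; apply: continuous_sub => //; apply: continuous_mul => //.
    exact: (continuous_mul cid cid).
  have c1 : continuous q1.
    by apply: continuous_mul => //; apply: continuous_mul => //; exact: continuous_mul.
  have c2 : continuous q2 by apply: continuous_mul => //.
  rewrite (_ : (fun x => _) = (fun x => M x * l x ^+ k * I q0 x +
      (M x * l x ^+ k.+1 * I q1 x + M x * l x ^+ k.+2 * I q2 x))).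
    have [s0 s1 s2] := And3 (sI q0 k c0) (sI q1 k.+1 c1) (sI q2 k.+2 c2).
    by rewrite (functionalD hu s0 (smoothD s1 s2)) (functionalD hu s1 s2) !IH ?addr0.
  apply/funext => x; rewrite (_ : itg _ _ _ = 1 * I q0 x + (l x * I q1 x + l x ^+ 2 * I q2 x)).
    by rewrite !exprS expr0; ring.
  have sq (q' : R -> R) : continuous q' -> continuous (fun s => q' s * ker n x s * h x s).
    by move=> cq'; exact: (@psmooth_slice _ _ _ _ x (kpsm n q' cq')).
  have s2 : continuous (fun s => (l x ^+ 2) * (q2 s * ker n x s * h x s)).
    by apply: continuous_mul => //; exact: sq.
  have -> : l x ^+ 2 * I q2 x = itg (- (2 * B)) (2 * B) (fun s => (l x ^+ 2) * (q2 s * ker n x s * h x s)).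
    have := itg_lin (- (2 * B)) (2 * B) (l x ^+ 2) (sq _ c2) (ccst 0).
    rewrite itg_cst // mul0r addr0 => <-; congr itg; apply/funext => s; exact: addr0.
  rewrite -itg_lin //; last exact: sq.
  rewrite -itg_lin //; [|exact: sq|by apply: continuous_lincomb => //; exact: sq].
  by congr itg; apply/funext => s; rewrite /ker exprS /q0 /q1 /q2; ring.
have spsit : smooth (fun x => cutoff B (l x) * psi x).
  by apply: smoothM => //; apply: smooth_comp1 => //; exact: smooth1_cutoff.
have -> : u (fun x => M x * psi x) = u (fun x => M x * (cutoff B (l x) * psi x)).
  apply: (functional_germ hu (O := O)) => //; [exact: smoothM|exact: smoothM|].
  by move=> x Ox; rewrite cutoff1 ?mul1r //; exact: ltW.
pose G (x : V) (t : R) := M x * (cutoff B (l (x - t *: w)) * psi (x - t *: w)).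
have hG : psmooth G.
  apply: psmoothM; first exact: psmooth_const.
  apply: (@psmooth_affine _ _ _ (fun y => cutoff B (l y) * psi y) id (fun t : R => - (t *: w))) => //.
    by move=> x; exact: cvg_id.
  by move=> t; apply: cvgN; apply: cvgZr_tmp; exact: cvg_id.
have -> : (fun x => M x * (cutoff B (l x) * psi x)) = G^~ 0.
  by apply/funext => x; rewrite /G scale0r subr0.
have S0 : 0 < 4 * B by lra.
apply: (functional_concentrate hu hG (@segment_compact R (- (4 * B)) (4 * B))).
move=> U eta /nbhs_ballP[r /= r0 HU] eta0.
have [n /= [Z0 Hn]] := landau_concentrates S0 r0 eta0.
set Z := itg _ _ _ in Z0 Hn; have cL : continuous (landau (4 * B) n) by exact: continuous_landau.
exists (fun g => Z^-1 * itg (- (4 * B)) (4 * B) (fun t => landau (4 * B) n t * g t)); split.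
- move=> a g g' cg cg'; rewrite mulrCA -mulrDr; congr (_ * _).
  rewrite -itg_lin; [|exact: continuous_mul..].
  by congr itg; apply/funext => t; ring.
- rewrite (_ : (fun t => _) = landau (4 * B) n) ?mulVf ?gt_eqF //.
  by apply/funext => t; rewrite mulr1.
- move=> g e b cg e0 b0 H1 H2; rewrite normrM ger0_norm ?invr_ge0 ?(ltW Z0) //.
  rewrite mulrC ler_pdivrMr // [leRHS]mulrC; apply: Hn => // t tS tr.
  by apply: H1 => //; apply: HU; rewrite /ball /= sub0r normrN.
- pose I x := itg (- (2 * B)) (2 * B) (fun s => 1 * ker n x s * h x s).
  have sI : smooth I by apply: psmooth_itg => //; exact: kpsm.
  have E x : O x -> itg (- (4 * B)) (4 * B) (fun t => landau (4 * B) n t * G x t) = M x * I x.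
    move=> /ltW Ox.
    have ch : continuous (h x) by exact: psmooth_slice.
    have h0 s : 2 * B <= `|s| -> h x s = 0 by move=> Hs; rewrite /h cutoff0 // mul0r.
    have := itg_reflect B_gt0 Ox ch cL h0.
    have -> : (fun t => landau (4 * B) n t * h x (l x - t)) =
       (fun t => landau (4 * B) n t * (cutoff B (l (x - t *: w)) * psi (x - t *: w))).
      apply/funext => t; rewrite /h -scaleNr lD lw mulr1; congr (_ * (_ * psi (_ + _ *: _))); ring.
    have -> : (fun s => landau (4 * B) n (l x - s) * h x s) = (fun s => 1 * ker n x s * h x s).
      by apply/funext => s; rewrite mul1r.
    rewrite -/(I x) => <-.
    have cc : continuous (fun t => landau (4 * B) n t * (cutoff B (l (x - t *: w)) * psi (x - t *: w))).
      apply: continuous_mul => //; have := @psmooth_slice _ _ _ _ x (@psmooth_affine _ _ _ _ id (fun t : R => - (t *: w)) spsit _ _ _).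
      apply => //; first by move=> y; exact: cvg_id.
      by move=> t; apply: cvgN; apply: cvgZr_tmp; exact: cvg_id.
    have := itg_lin (- (4 * B)) (4 * B) (M x) cc (ccst 0).
    rewrite itg_cst; last by lra.
    rewrite mul0r addr0 => <-; congr itg; apply/funext => t; rewrite /G; ring.
  have S4 : - (4 * B) <= 4 * B by lra.
  rewrite (functional_germ hu _ _ oO (psi := fun x => Z^-1 * (M x * l x ^+ 0 * I x))); first last.
  + by move=> x Ox; rewrite E // expr0 mulr1.
  + exact: HB.
  + apply: smoothM; first exact: smooth_cst.
    apply: smoothM => //; apply: smoothM => //; exact: smoothX.
  + apply: smoothM; first exact: smooth_cst.
    exact: (average_smooth (average_itg S4 cL) hG).
  rewrite (functionalZ _ hu) ?kill ?mulr0 //.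
  by apply: smoothM => //; apply: smoothM => //; exact: smoothX.
Qed.

End Density.

Section Positive.
Context {R : realType} {V : normedModType R}.

(* Expand psi (1 - g sigma)^n for a small constant g. *)
Lemma functional_positive (K : set V) u psi sigma : smooth_functional K u ->
  smooth psi -> smooth sigma -> (forall x, K x -> 0 < sigma x) ->
  (forall j, u (fun x => psi x * sigma x ^+ j.+1) = 0) -> u psi = 0.
Proof.
move=> hu hpsi hs s0 Hj; have [cK _ _] := hu.
have cs := smooth_continuous hs.
have [B B0 HB] := compact_le_bound cK cs.
have [m m0 Hm] : exists2 m, 0 < m & forall x, K x -> m <= sigma x.
  have [[x Kx]|K0] := pselect (K !=set0); last by exists 1 => // x Kx; case: K0; exists x.
  have [y] := compact_EVT_min (ex_intro _ x Kx) cK (continuous_subspaceT cs).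
  rewrite inE => Ky Hy; exists (sigma y); first exact: s0.
  by move=> z Kz; apply: Hy; rewrite inE.
(* This g gives 0 < g m <= g sigma <= 1 on K, so 1 - g sigma lies between 0 and 1 - g m < 1. *)
pose g := (B + 1 + m)^-1; have g0 : 0 < g by rewrite invr_gt0; lra.
pose h x := 1 - g * sigma x.
have hh : smooth h by apply: smoothB; [exact: smooth_cst|apply: smoothM => //; exact: smooth_cst].
have gm : 0 < g * m by exact: mulr_gt0.
have gm1 : g * m <= 1 by rewrite /g mulrC ler_pdivrMr ?mul1r; lra.
apply: (functional_neumann (h := h) (q := 1 - g * m) hu hpsi hh).
- by apply/andP; split; lra.
- move=> x Kx; have sB : sigma x <= B by apply: le_trans (ler_norm _) (HB x Kx).
  have H1 : g * m <= g * sigma x by rewrite ler_pM2l // Hm.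
  have H2 : g * sigma x <= 1 by rewrite /g mulrC ler_pdivrMr ?mul1r; lra.
  by rewrite /h ger0_norm; lra.
have sX n j : smooth (fun x => psi x * sigma x ^+ j * h x ^+ n).
  by apply: smoothM; [apply: smoothM => //|]; exact: smoothX.
have Q n : forall j, u (fun x => psi x * sigma x ^+ j.+1 * h x ^+ n) = 0.
  elim: n => [|n IH] j.
    by rewrite -(Hj j); congr u; apply/funext => x; rewrite mulr1.
  rewrite (_ : (fun x => _) = (fun x => (- g) * (psi x * sigma x ^+ j.+2 * h x ^+ n) +
      psi x * sigma x ^+ j.+1 * h x ^+ n)).
    have [_ L _] := hu; rewrite L; [|exact: sX..].
    by rewrite !IH mulr0 addr0.
  by apply/funext => x; rewrite /h !exprS; ring.
elim=> [|n IH]; first by congr u; apply/funext => x; rewrite mulr1.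
rewrite -IH (_ : (fun x => psi x * h x ^+ n.+1) =
    (fun x => (- g) * (psi x * sigma x ^+ 1 * h x ^+ n) + psi x * sigma x ^+ 0 * h x ^+ n)).
  have [_ L _] := hu; rewrite L; [|exact: sX..].
  by rewrite Q mulr0 add0r; congr u; apply/funext => x; rewrite mulr1.
by apply/funext => x; rewrite /h !exprS expr0; ring.
Qed.

End Positive.

Section CoordinateDensity.
Context {R : realType} {V : normedModType R} {d : nat}.
Variables (lin : 'I_d -> V -> R) (c : 'I_d -> R) (w : 'I_d -> V).
Hypothesis lin_linear : forall i, linear (lin i).
Hypothesis lin_continuous : forall i, continuous (lin i).
Hypothesis lin_dual : forall i j, lin i (w j) = (i == j)%:R.
Hypothesis lin_span : forall x, x = \sum_i lin i x *: w i.

Let L i x := lin i x + c i.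

Let smooth_L i : smooth (L i).
Proof. exact: smooth_affine_form. Qed.

(** One coordinate is treated at a time: [landau_step] trades a general dependence on the j-th
    coordinate for powers of it and preserves invariance along the earlier basis vectors. After d
    steps the remaining factor is constant. *)
Lemma functional_density K u (rho : V -> R) : smooth_functional K u -> smooth rho ->
  (forall e : 'I_d -> nat, u (fun x => rho x * \prod_i (lin i x + c i) ^+ e i) = 0) ->
  forall phi, smooth phi -> u (fun x => rho x * phi x) = 0.
Proof.
move=> hu hrho H0.
pose mon j (e : 'I_d -> nat) x := \prod_(i < d | (i < j)%N) L i x ^+ e i.
have smon j e : smooth (mon j e) by apply: smooth_prod => i _; exact: smoothX.
(* Here j coordinates are already polynomial and k are left. *)
have claim k j : (j + k = d)%N -> forall e psi, smooth psi ->
    (forall i : 'I_d, (i < j)%N -> forall x t, psi (x + t *: w i) = psi x) ->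
    u (fun x => rho x * mon j e x * psi x) = 0.
  elim: k j => [|k IH] j jk e psi hpsi Hinv.
    have jd : j = d by rewrite -jk addn0.
    have psi0 x : psi x = psi 0.
      rewrite [x in LHS]lin_span; elim: (index_enum _) => [|i r IHr]; first by rewrite big_nil.
      by rewrite big_cons addrC Hinv // jd.
    have hE : smooth (fun x => rho x * \prod_i (lin i x + c i) ^+ e i).
      by apply: smoothM => //; apply: smooth_prod => i _; apply: smoothX; exact: smooth_L.
    rewrite (_ : (fun x => _) = (fun x => psi 0 * (rho x * \prod_i (lin i x + c i) ^+ e i))).
      by rewrite (functionalZ _ hu) // H0 mulr0.
    apply/funext => x; rewrite psi0 mulrC; congr (_ * (_ * _)).
    by apply: eq_bigl => i; rewrite jd ltn_ord.
  have jd : (j < d)%N by rewrite -jk addnS ltnS leq_addr.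
  pose i0 := Ordinal jd.
  apply: (landau_step (lin := lin i0) (c := c i0) (w := w i0) hu) => //.
  - exact: smoothM.
  - by rewrite lin_dual eqxx.
  - move=> a psi' hpsi' Hw Hv.
    pose e' i := if i == i0 then a else e i.
    rewrite -(IH j.+1 _ e' psi') //.
    + congr u; apply/funext => x; congr (_ * _); rewrite -mulrA; congr (_ * _).
      rewrite /mon [RHS](bigD1 i0) ?leqnn //= /e' eqxx mulrC; congr (_ * _).
      apply: eq_big => [i|i]; last by move=> ij; case: eqP => // ii; rewrite ii ltnn in ij.
      by rewrite ltnS [in RHS]leq_eqVlt -val_eqE /=; case: eqP => [->|] //=; rewrite ?ltnn ?andbT.
    + by rewrite addSnnS.
    + move=> i; rewrite ltnS leq_eqVlt => /orP[/eqP ij|ij].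
        have -> : i = i0 by apply/val_inj.
        exact: Hw.
      apply: Hv; last exact: Hinv.
      by rewrite lin_dual -val_eqE /= gtn_eqF.
move=> phi hphi; rewrite -(claim d 0%N _ (fun=> 0%N) phi) //.
by congr u; apply/funext => x; rewrite /mon big_pred0 // mulr1.
Qed.

End CoordinateDensity.

Lemma continuous_norm_sub {R : realType} {V : normedModType R} (a : V) :
  continuous (fun x : V => `|x - a|).
Proof. by move=> x; apply: cvg_norm; apply: cvgB; [exact: cvg_id|exact: cst_continuous]. Qed.

(** * The weights of a plane through a point of V *)

Section SlabCoordinates.
Context {R : realType} {n : nat}.
Local Notation V := 'rV[R]_n.+2.
Variables (x0 kap : V).
Hypothesis kap0 : kap 0 0 = 0.
Local Notation i0 := (0 : 'I_n.+2).
Local Notation i1 := (1 : 'I_n.+2).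

(* The first two coordinates parametrize the plane through x0 spanned by
   e_0 + kap and e_1, on which the remaining coordinates vanish. *)
Definition slab_form (k : 'I_n.+2) : V := delta_mx 0 k - kap 0 k *: delta_mx 0 i0.
Definition slab_coord (k : 'I_n.+2) (x : V) : R :=
  dotv x (slab_form k) + - dotv x0 (slab_form k).
Definition slab_basis (k : 'I_n.+2) : V := delta_mx 0 k + (k == i0)%:R *: kap.
Local Notation L := slab_coord.

Lemma dotv_delta (x : V) k : dotv x (delta_mx 0 k) = x 0 k.
Proof.
rewrite /dotv (bigD1 k) //= mxE !eqxx mulr1 big1 ?addr0 // => i ik.
by rewrite mxE (negbTE ik) andbF mulr0.
Qed.

Lemma dotv_slab_form x k : dotv x (slab_form k) = x 0 k - kap 0 k * x 0 0.
Proof. by rewrite /slab_form dotvDr dotvNr dotvZr !dotv_delta. Qed.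

Lemma slab_coordE k x : L k x = (x - x0) 0 k - kap 0 k * (x - x0) 0 0.
Proof. by rewrite /L -dotvNl -dotvDl dotv_slab_form. Qed.

Lemma slab_dual i j : dotv (slab_basis j) (slab_form i) = (i == j)%:R.
Proof.
rewrite dotv_slab_form /slab_basis !mxE !eqxx /= kap0 mulr0 addr0.
rewrite (eq_sym j i0).
ring.
Qed.

Lemma slab_span x : x = \sum_i dotv x (slab_form i) *: slab_basis i.
Proof.
apply/rowP => j; rewrite summxE.
under eq_bigr do rewrite dotv_slab_form !mxE eqxx /= mulrDr.
rewrite big_split /= (bigD1 j) //= eqxx mulr1 [X in _ + X + _]big1 ?addr0; last first.
  by move=> i ij; rewrite eq_sym (negbTE ij) mulr0.
rewrite (bigD1 i0) //= ?eqxx mul1r kap0 mul0r subr0 big1 ?addr0.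
  by ring.
by move=> i ii0; rewrite (negbTE ii0) mul0r mulr0.
Qed.

(** The entry v_k is its slanted coordinate plus kap_k v_0, and v_0 is itself a slanted coordinate;
    hence the factor 1 + |kap|. *)
Lemma slab_norm_le (v : V) (e : R) : 0 <= e ->
  (forall k, `|dotv v (slab_form k)| <= e) -> `|v| <= e * (1 + `|kap|).
Proof.
move=> e0 H; apply: rV_norm_le => [|k]; first by rewrite mulr_ge0 // addr_ge0.
have v0 : `|v 0 i0| <= e.
  by have := H i0; rewrite dotv_slab_form kap0 mul0r subr0.
have -> : v 0 k = dotv v (slab_form k) + kap 0 k * v 0 i0 by rewrite dotv_slab_form; ring.
apply: le_trans (ler_normD _ _) _; rewrite mulrDr mulr1 lerD // normrM mulrC ler_pM //.
exact: coord_le_norm.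
Qed.

Lemma smooth_slab_coord k : smooth (L k).
Proof.
by apply: smooth_affine_form; [exact: linear_dotv|exact: continuous_dotvl].
Qed.

Section Local.
Variables (u : (V -> R) -> R) (K W : set V) (eps : R).
Hypothesis hu : smooth_functional K u.
Hypothesis hX : Xvanish W u.
Hypothesis hW : forall phi, smooth phi -> compact (closure [set x | phi x != 0]) ->
  closure [set x | phi x != 0] `<=` W -> u phi = 0.
Hypothesis eps0 : 0 < eps.
Hypothesis ballW : forall x, `|x - x0| < 2 * eps -> W x.

(** The factor 1 + |kap| converts slanted coordinates into the norm; 1 + n.+2 pays for projecting
    off a unit vector theta, where |v . theta| <= n.+2 |v|. *)
Let dl : R := eps / ((1 + n.+2%:R) * (1 + `|kap|)).

Let dl0 : 0 < dl.
Proof. by rewrite divr_gt0 // mulr_gt0 // ltr_pwDl. Qed.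

Let dlE : dl * (1 + `|kap|) * (1 + n.+2%:R) = eps.
Proof.
have k0 : 0 < 1 + `|kap| by rewrite ltr_pwDl.
have n0 : 0 < 1 + n.+2%:R :> R by rewrite ltr_pwDl.
by rewrite /dl; field; rewrite !gt_eqF.
Qed.

Let dl_le : dl * (1 + `|kap|) <= eps.
Proof.
rewrite -[leRHS]dlE ler_peMr ?lerDl // mulr_ge0 ?(ltW dl0) // addr_ge0 //.
Qed.

(* Functions supported where all the coordinates are small are supported in W. *)
Lemma slab_hole phi : smooth phi -> (forall x, phi x != 0 -> forall k, `|L k x| <= dl) ->
  u phi = 0.
Proof.
move=> hphi Hphi.
pose C : set V := [set x | `|x - x0| <= eps].
have sC : [set x | phi x != 0] `<=` C.
  move=> x /= /Hphi Hx; apply: le_trans dl_le; apply: slab_norm_le (ltW dl0) _ => k.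
  by have := Hx k; rewrite slab_coordE dotv_slab_form.
have clC : closed C.
  rewrite (_ : C = (fun x => `|x - x0|) @^-1` [set t | t <= eps]) //.
  apply: (@closed_comp _ _ (fun x : V => `|x - x0|)); last exact: closed_le.
  by move=> x _; exact: continuous_norm_sub.
have cC : compact C.
  apply: bounded_closed_compact => //; exists (`|x0| + eps); split; first exact: num_real.
  move=> M HM x /= xC; rewrite -(subrK x0 x); apply: le_trans (ler_normD _ _) _.
  by apply: le_trans (ltW HM); rewrite addrC lerD2l.
have scC : closure [set x | phi x != 0] `<=` C.
  by rewrite [X in _ `<=` X](closure_id _).1 //; exact: closure_subset.
apply: hW => //; first exact: subclosed_compact (@closed_closure _ _) cC scC.
by move=> x /scC xC; apply: ballW; apply: le_lt_trans xC _; have := eps0; lra.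
Qed.

(** Constant along the first two basis vectors, so multiplying a tube of the plane by it keeps the
    invariance along the axis. *)
Definition slab_cut (chi : 'I_n.+2 -> R -> R) (x : V) : R :=
  \prod_(k < n.+2 | (1 < k)%N) chi k (L k x).

Lemma smooth_slab_cut chi : (forall k, smooth1 (chi k)) -> smooth (slab_cut chi).
Proof.
by move=> hchi; apply: smooth_prod => k _; apply: smooth_comp1 => //; exact: smooth_slab_coord.
Qed.

Lemma slab_tube (c s : R) (a : R -> R) (chi : 'I_n.+2 -> R -> R) : c ^+ 2 + s ^+ 2 = 1 ->
  smooth1 a -> (forall k, smooth1 (chi k)) ->
  (forall t, dl < `|t| -> a t = 0) -> (forall k t, dl < `|t| -> chi k t = 0) ->
  u (fun x => a (c * L i0 x + s * L i1 x) * slab_cut chi x) = 0.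
Proof.
move=> cs1 ha hchi a0 chi0.
(* The direction in the plane on which c X + s Y vanishes; the other coordinate forms vanish on it
   by duality. *)
pose tau : V := (- s) *: slab_basis i0 + c *: slab_basis i1.
have ltau k : dotv tau (slab_form k) = - s * (k == i0)%:R + c * (k == i1)%:R.
  by rewrite dotvDl !dotvZl !slab_dual.
have tau0 : 0 < enorm tau.
  rewrite lt_neqAle enorm_ge0 andbT eq_sym; apply/eqP => t0.
  have tz : tau = 0.
    by apply/rowP => j; rewrite [RHS]mxE; apply/eqP; rewrite -normr_le0 -t0 coord_le_enorm.
  have z0 := ltau i0; have z1 := ltau i1; move: z0 z1; rewrite tz !eqxx /=.
  have dz k : dotv (0 : V) (slab_form k) = 0 by rewrite -(scale0r 0) dotvZl mul0r.
  rewrite !dz /= => z0 z1; move: cs1; have -> : s = 0 by lra.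
  have -> : c = 0 by lra.
  by rewrite expr0n /= addr0 => /esym/eqP; rewrite oner_eq0.
have [theta thE th1] : exists2 theta, theta = (enorm tau)^-1 *: tau & sphere theta.
  exists ((enorm tau)^-1 *: tau) => //.
  by rewrite /sphere /= enormZ gtr0_norm ?invr_gt0 // mulVf // gt_eqF.
(* The two plane coordinates share one ridge: slot 0 carries a with the form c X + s Y, slot 1 is
   the constant 1. *)
pose chi' (k : 'I_n.+2) := if k == i0 then a else if k == i1 then (fun=> 1) else chi k.
pose m' (k : 'I_n.+2) := if k == i0 then c *: slab_form i0 + s *: slab_form i1
  else if k == i1 then 0 else slab_form k.
pose c' (k : 'I_n.+2) := - dotv x0 (m' k).
have E : ridges chi' m' c' = (fun x => a (c * L i0 x + s * L i1 x) * slab_cut chi x).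
  apply/funext => x; rewrite /ridges (bigD1 i0) //= (bigD1 i1) //=.
  rewrite {1}/chi' eqxx {1}/chi' /= mul1r; congr (_ * _).
    congr a; rewrite /c' /m' eqxx !dotvDr !dotvZr /L; ring.
  rewrite /slab_cut; apply: eq_big => k.
    by case: k => -[|[|k]] //= ?; rewrite -?val_eqE.
  move=> /andP[k0 k1]; rewrite /chi' /c' /m' (negbTE k0) (negbTE k1) //.
rewrite -E; apply: (tube_vanish (x0 := x0) (theta0 := theta) (eps := eps) hu hX) => //.
- by move=> k; rewrite /chi'; case: ifP => // _; case: ifP => // _; exact: smooth1_cst.
- move=> k; rewrite /m'; case: ifP => k0; last first.
    rewrite thE dotvZl; case: ifP => k1; first by rewrite -(scale0r 0) dotvZr mul0r mulr0.
    by rewrite ltau k0 k1 !mulr0 addr0 mulr0.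
  by rewrite dotvDr !dotvZr thE !dotvZl !ltau !eqxx /=; ring.
- move=> x; rewrite E mulf_eq0 negb_or => /andP[ax Wx].
  (* Rotated plane coordinates: r runs along the tube and q across it. Removing r tau leaves a
     vector with coordinates c q, s q and the L_k, all at most dl; this does not change the part
     orthogonal to theta. *)
  pose q := c * L i0 x + s * L i1 x; pose r := - s * L i0 x + c * L i1 x.
  pose v := x - x0 - r *: tau.
  have xE k : dotv (x - x0) (slab_form k) = L k x by rewrite dotvDl dotvNl.
  have qd : `|q| <= dl by rewrite leNgt; apply: contra ax => H; rewrite a0.
  have c1 : `|c| <= 1 by rewrite -(ler_pXn2r (n := 2)) ?nnegrE // real_normK ?num_real // expr1n -cs1 lerDl sqr_ge0.
  have s1 : `|s| <= 1 by rewrite -(ler_pXn2r (n := 2)) ?nnegrE // real_normK ?num_real // expr1n -cs1 lerDr sqr_ge0.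
  have vn : `|v| <= dl * (1 + `|kap|).
    apply: slab_norm_le (ltW dl0) _ => k; rewrite /v dotvDl dotvNl dotvZl ltau xE.
    have [->|k0] := eqVneq k i0.
      rewrite (_ : L i0 x - _ = c * q); last first.
        by rewrite /q /r mulr1 mulr0 -[X in X - _]mul1r -cs1; ring.
      by rewrite normrM -[leRHS]mul1r ler_pM.
    have [->|k1] := eqVneq k i1.
      rewrite (_ : L i1 x - _ = s * q); last first.
        by rewrite /q /r mulr1 mulr0 -[X in X - _]mul1r -cs1; ring.
      by rewrite normrM -[leRHS]mul1r ler_pM.
    rewrite !mulr0 addr0 mulr0 subr0 leNgt; apply: contra Wx => H.
    rewrite /slab_cut (bigD1 k) /= ?chi0 ?mul0r //.
    by case: k k0 k1 {H} => -[|[|k]].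
  have tt : dotv theta theta = 1 by rewrite -sqr_enorm th1 expr1n.
  have tE : tau = enorm tau *: theta by rewrite thE scalerA mulfV ?scale1r // gt_eqF.
  have -> : x - x0 - dotv (x - x0) theta *: theta = v - dotv v theta *: theta.
    rewrite /v tE !(dotvDl, dotvNl, dotvZl) tt.
    apply/rowP => j; rewrite !mxE; ring.
  apply: le_trans (ler_normB _ _) _; rewrite normrZ.
  have tn : `|theta| <= 1 by rewrite -th1 norm_le_enorm.
  have dv : `|dotv v theta| <= n.+2%:R * `|v|.
    by apply: le_trans (dotv_norm_le _ _) _; rewrite ler_piMr // mulr_ge0.
  have : `|dotv v theta| * `|theta| <= n.+2%:R * `|v| by rewrite -[leRHS]mulr1 ler_pM.
  have := dlE; have := ler_wpM2r (_ : 0 <= 1 + n.+2%:R :> R) vn.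
  have N0 : 0 <= 1 + n.+2%:R :> R by rewrite addr_ge0.
  move=> /(_ N0); lra.
Qed.

End Local.

Lemma slab_local u (K W : set V) (eps : R) : smooth_functional K u -> Xvanish W u ->
  (forall phi, smooth phi -> compact (closure [set x | phi x != 0]) ->
    closure [set x | phi x != 0] `<=` W -> u phi = 0) ->
  0 < eps -> (forall x, `|x - x0| < 2 * eps -> W x) ->
  exists2 dl, 0 < dl &
    (forall phi, smooth phi -> (forall x, phi x != 0 -> forall k, `|L k x| <= dl) -> u phi = 0) /\
    (forall (c s : R) (a : R -> R) (chi : 'I_n.+2 -> R -> R), c ^+ 2 + s ^+ 2 = 1 ->
      smooth1 a -> (forall k, smooth1 (chi k)) ->
      (forall t, dl < `|t| -> a t = 0) -> (forall k t, dl < `|t| -> chi k t = 0) ->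
      u (fun x => a (c * L i0 x + s * L i1 x) * slab_cut chi x) = 0).
Proof.
move=> hu hX hW eps0 ballW.
exists (eps / ((1 + n.+2%:R) * (1 + `|kap|))).
  by rewrite divr_gt0 // mulr_gt0 // ltr_pwDl.
split; first exact: (slab_hole hW eps0 ballW).
exact: (slab_tube hu hX eps0 ballW).
Qed.
End SlabCoordinates.

(** * Superposition of strips along the tangent lines of a circle *)

Section Circle.
Context {R : realType}.

Lemma polar_angle (y1 y2 r : R) : 0 < r -> y1 ^+ 2 + y2 ^+ 2 = r ^+ 2 ->
  exists phi : R, [/\ `|phi| <= pi, y1 = r * cos phi & y2 = r * sin phi].
Proof.
move=> r0 yr; have r20 : 0 < r ^+ 2 by exact: exprn_gt0.
have x1 : -1 <= y1 / r <= 1.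
  have : (y1 / r) ^+ 2 <= 1.
    by rewrite expr_div_n ler_pdivrMr // mul1r -yr lerDl sqr_ge0.
  by move=> H; rewrite -ler_norml -(ler_pXn2r (n := 2)) ?nnegrE // real_normK ?num_real // expr1n.
have cE : cos (acos (y1 / r)) = y1 / r by apply: acosK; rewrite in_itv.
have sE : sin (acos (y1 / r)) = `|y2| / r.
  rewrite sin_acos // expr_div_n.
  have -> : 1 - y1 ^+ 2 / r ^+ 2 = (`|y2| / r) ^+ 2.
    rewrite expr_div_n real_normK ?num_real // -[y2 ^+ 2](addKr (y1 ^+ 2)) yr; field.
    by rewrite gt_eqF.
  by rewrite sqrtr_sqr ger0_norm // divr_ge0 // ltW.
have a0 := acos_ge0 x1; have api := acos_lepi x1.
have [y20|y20] := leP 0 y2.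
  exists (acos (y1 / r)); rewrite cE sE !(ger0_norm a0) (ger0_norm y20); split => //.
    by rewrite mulrC divfK // gt_eqF.
  by rewrite mulrC divfK // gt_eqF.
exists (- acos (y1 / r)); rewrite cosN sinN cE sE normrN (ger0_norm a0) (ltr0_norm y20); split => //.
  by rewrite mulrC divfK // gt_eqF.
by rewrite mulNr opprK mulrC divfK // gt_eqF.
Qed.

(* Substitute v = r cos(psi - phi) - p, with (y1, y2) = r (cos phi, sin phi), on
   each half of the circle. *)
Lemma circle_integral (a mu : R -> R) (y1 y2 p eta tau : R) :
  continuous a -> continuous mu -> 0 < eta -> 0 < tau ->
  (forall t, 0 < mu t) -> (forall t, tau <= t -> mu t ^+ 2 * t = 1) ->
  (forall t, eta <= `|t| -> a t = 0) -> 0 <= p ->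
  (eta + p) ^+ 2 + tau <= y1 ^+ 2 + y2 ^+ 2 ->
  itg 0 (2 * pi) (fun psi => a (y1 * cos psi + y2 * sin psi - p)) =
  2 * itg (- eta) eta (fun v => a v * mu (y1 ^+ 2 + y2 ^+ 2 - (v + p) ^+ 2)).
Proof.
move=> ca cmu eta0 tau0 mu0 muE a0 p0 yp.
pose r := Num.sqrt (y1 ^+ 2 + y2 ^+ 2).
have r2 : r ^+ 2 = y1 ^+ 2 + y2 ^+ 2 by rewrite sqr_sqrtr // addr_ge0 ?sqr_ge0.
have r0 : 0 < r.
  by rewrite sqrtr_gt0; apply: lt_le_trans yp; rewrite ltr_wpDl // sqr_ge0.
have rp : eta + p < r.
  have H : (eta + p) ^+ 2 < r ^+ 2 by rewrite r2; apply: lt_le_trans yp; rewrite ltrDl.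
  have ep0 : 0 <= eta + p by lra.
  by move: H; rewrite ltr_pXn2r // nnegrE // ltW.
have [phi [phipi -> ->]] := polar_angle r0 (esym r2).
have -> : (fun psi => a (r * cos phi * cos psi + r * sin phi * sin psi - p)) =
    (fun psi => a (r * cos (psi - phi) - p)).
  by apply/funext => psi; congr a; rewrite cosB; ring.
have -> : (r * cos phi) ^+ 2 + (r * sin phi) ^+ 2 = r ^+ 2.
  by rewrite !exprMn -mulrDr cos2Dsin2 mulr1.
have pi0 : 0 < pi :> R by exact: pi_gt0.
have cid : continuous (fun t : R => t) by move=> t; exact: cvg_id.
have ccst (k : R) : continuous (fun _ : R => k) by exact: cst_continuous.
pose g psi := a (r * cos psi - p).
have cg : continuous g.
  apply: continuous_compose ca; apply: continuous_sub => //; apply: continuous_mul => //.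
  exact: continuous_cos.
pose E v := a v * mu (r ^+ 2 - (v + p) ^+ 2).
have cE : continuous E.
  apply: continuous_mul => //; apply: continuous_compose cmu; apply: continuous_sub => //.
  by apply: continuous_mul; apply: continuous_add.
(* The arguments psi - phi stay in [-pi, 3 pi], and r cos psi - p stays within r + p of 0; both
   primitives are taken with room to spare. *)
have [P dP] := primitive_exists (4 * pi) cg.
have [Q dQ] := primitive_exists (2 * r + 2 * p + 1) cE.
rewrite ler_norml in phipi.
have const (D : R -> R) s t : s <= t -> (forall x : R, s <= x <= t -> is_derive x 1 D 0) -> D t = D s.
  move=> st dD; apply/eqP; rewrite -subr_eq0; apply/eqP.
  by rewrite -(@itg_ftc _ s t (fun=> 0) D st (ccst 0) dD) itg_cst // mul0r.
(* By periodicity of g, P(2 pi + s) - P(s) is constant in s, which moves the period back to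
   [-pi, pi]. *)
have per : itg 0 (2 * pi) (fun psi => g (psi - phi)) = itg (- pi) pi g.
  have -> : itg 0 (2 * pi) (fun psi => g (psi - phi)) = P (2 * pi - phi) - P (0 - phi).
    apply: (@itg_ftc _ _ _ _ (fun psi => P (psi - phi))); first lra.
      by apply: continuous_compose cg; apply: continuous_sub.
    move=> x xb; have d1 : is_derive x 1 (fun t : R => t - phi) 1.
      by have := is_deriveB (is_derive_id x 1) (is_derive_cst phi x 1); rewrite subr0.
    have d2 : is_derive (x - phi) 1 P (g (x - phi)) by apply: dP; lra.
    have := @is_derive_comp1 _ R^o _ x 1 _ P _ d1 d2.
    by rewrite mulr1.
  have -> : itg (- pi) pi g = P pi - P (- pi).
    by apply: itg_ftc => //; [lra|move=> x xb; apply: dP; lra].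
  have := const (fun s => P (2 * pi + s) - P s) (- pi) (- phi); rewrite sub0r.
  rewrite (_ : 2 * pi + - pi = pi); last by ring.
  apply; first lra.
  move=> x xb; have d1 : is_derive x 1 (fun t : R => 2 * pi + t) 1.
    by have := is_deriveD (is_derive_cst (2 * pi : R) x 1) (is_derive_id x 1); rewrite add0r.
  have d2 : is_derive (2 * pi + x) 1 P (g (2 * pi + x)) by apply: dP; lra.
  have d3 := @is_derive_comp1 _ R^o _ x 1 _ P _ d1 d2.
  have d4 : is_derive x 1 P (g x) by apply: dP; lra.
  have := is_deriveB d3 d4; move/is_derive_eq; apply.
  by rewrite mulr1 /g [2 * pi + x]addrC mulr_natl cosD2pi subrr.
have dcos (x : R) : is_derive x 1 (fun t : R => r * cos t - p) (- (r * sin x)).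
  have := is_deriveB (is_deriveZ r (is_derive_cos x)) (is_derive_cst p x 1).
  by move/is_derive_eq; apply; rewrite /GRing.scale /= subr0 mulrN.
have dQc (x : R) : is_derive x 1 (fun t : R => Q (r * cos t - p)) (E (r * cos x - p) * - (r * sin x)).
  apply: (@is_derive_comp1 _ R^o _ x 1 _ Q _ (dcos x)); apply: dQ.
  have := cos_le1 x; have := cos_geN1 x; nra.
(* The Jacobian identity: with v = r cos x - p, r^2 - (v + p)^2 = (r sin x)^2. Where a(v) is nonzero
   this is at least tau, so mu of it is 1 / (r |sin x|). *)
have Eg x : E (r * cos x - p) * (r * `|sin x|) = g x.
  rewrite /E /g; set v := r * cos x - p; have [v1|v1] := leP eta `|v|; first by rewrite a0 // !mul0r.
  have vp : r ^+ 2 - (v + p) ^+ 2 = (r * sin x) ^+ 2.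
    have -> : (r * sin x) ^+ 2 = r ^+ 2 * (1 - cos x ^+ 2).
      by rewrite exprMn -(cos2Dsin2 x) [X in _ = _ * X]addrAC subrr add0r.
    by rewrite /v subrK; ring.
  have vt : tau <= (r * sin x) ^+ 2.
    rewrite -vp r2; move: v1; rewrite ltr_norml => v1; nra.
  rewrite vp -mulrA; set m := mu _.
  suff -> : m * (r * `|sin x|) = 1 by rewrite mulr1.
  have m0 : 0 < m by exact: mu0.
  have H1 : 0 <= m * (r * `|sin x|) by rewrite !mulr_ge0 ?(ltW r0) ?(ltW m0).
  apply/eqP; rewrite -(eqrXn2 (n := 2)) // expr1n !exprMn real_normK ?num_real // -exprMn muE //.
have half1 : itg 0 pi g = Q (r - p) - Q (- r - p).
  have -> : itg 0 pi g = - Q (r * cos pi - p) - - Q (r * cos 0 - p).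
    apply: (@itg_ftc _ _ _ _ (fun t => - Q (r * cos t - p))) => //; first exact: ltW.
    move=> x xb; have := is_deriveN (dQc x); move/is_derive_eq; apply.
    by rewrite -Eg ger0_norm; [ring|apply: sin_ge0_pi].
  by rewrite cos0 cospi mulr1 mulrN1; ring.
have half2 : itg (- pi) 0 g = Q (r - p) - Q (- r - p).
  have -> : itg (- pi) 0 g = Q (r * cos 0 - p) - Q (r * cos (- pi) - p).
    apply: (@itg_ftc _ _ _ _ (fun t => Q (r * cos t - p))) => //; first lra.
    move=> x xb; have := dQc x; move/is_derive_eq; apply.
    have sx : sin x <= 0.
      rewrite -[x]opprK sinN oppr_le0; apply: sin_ge0_pi; lra.
    by rewrite -Eg (ler0_norm sx); ring.
  by rewrite cosN cos0 cospi mulr1 mulrN1; ring.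
rewrite -[LHS]/(itg 0 (2 * pi) (fun psi => g (psi - phi))) per (@itg_cat _ _ 0) //; [|lra..].
rewrite half1 half2.
have EQ : itg (- eta) eta E = Q eta - Q (- eta).
  by apply: itg_ftc => //; [lra|move=> x xb; apply: dQ; lra].
have E0 v : eta <= `|v| -> E v = 0 by move=> hv; rewrite /E a0 // mul0r.
(* E vanishes outside (-eta, eta), so Q is constant from eta to r - p, and likewise on the negative
   side. *)
have -> : Q (r - p) = Q eta.
  apply: const; first lra.
  move=> x xb; rewrite -(E0 x); last by rewrite ger0_norm; lra.
  by apply: dQ; lra.
have -> : Q (- r - p) = Q (- eta).
  symmetry; apply: const; first lra.
  move=> x xb; rewrite -(E0 x); last by rewrite ler0_norm; lra.
  by apply: dQ; lra.
rewrite -[X in _ = 2 * X]/(itg (- eta) eta E) EQ; ring.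
Qed.

End Circle.

Lemma itgZ {R : realType} (a b k : R) (g : R -> R) : a <= b -> continuous g ->
  itg a b (fun t => k * g t) = k * itg a b g.
Proof.
move=> ab cg; have := itg_lin a b k cg (@cst_continuous R R 0).
rewrite itg_cst // mul0r addr0 => <-; congr itg; apply/funext => t; by rewrite addr0.
Qed.

(** Differentiating mu^2 t = 1 gives mu' = - mu^3 / 2, so each derivative raises the exponent by 2
    and multiplies the constant by a nonzero factor. Strictness of tau < t makes the relation hold
    in a neighbourhood. *)
Lemma derive1n_inverse_sqrt {R : realType} (mu : R -> R) (tau : R) : 0 < tau -> smooth1 mu ->
  (forall t, 0 < mu t) -> (forall t, tau <= t -> mu t ^+ 2 * t = 1) ->
  forall k, exists2 C : R, C != 0 &
    forall t, tau < t -> (mu^`(k))%classic t = C * mu t ^+ (2 * k).+1.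
Proof.
move=> tau0 smu mu0 muE; elim=> [|k [C C0 IH]].
  by exists 1 => [|t _]; [rewrite oner_eq0|rewrite mul1r muln0 expr1].
exists (C * (2 * k).+1%:R * - 2^-1) => [|t tt].
  by rewrite !mulf_neq0 // ?pnatr_eq0 // oppr_eq0 invr_eq0.
have dmu : is_derive t 1 mu (mu^`()%classic t) by exact: smooth1_is_derive.
have t0 : 0 < t by exact: lt_trans tt.
have near_t : \forall y \near t, tau < y by exact: lt_nbhsr.
have dE : mu^`()%classic t = - 2^-1 * mu t ^+ 3.
  have D1 : is_derive t 1 (fun y => mu y ^+ 2 * y) (mu t ^+ 2 + t * (2%:R * mu t ^+ 1 * mu^`()%classic t)).
    have := is_deriveM (@is_derive_exprn _ R^o mu t 1 _ 2 dmu) (is_derive_id t 1).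
    by move/is_derive_eq; apply; rewrite /GRing.scale /= mulr1.
  have D2 : is_derive t 1 (fun y => mu y ^+ 2 * y) 0.
    apply: (near_eq_is_derive _ (is_derive_cst (1 : R) t 1)).
    by apply: filterS near_t => y ty; rewrite muE // ltW.
  have E : mu t ^+ 2 + t * (2%:R * mu t ^+ 1 * mu^`()%classic t) = 0.
    by rewrite -(@derive_val _ _ _ _ _ _ _ D1) (@derive_val _ _ _ _ _ _ _ D2).
  have M := muE t (ltW tt); have m0 := mu0 t.
  have tm0 : t * mu t != 0 by rewrite mulf_neq0 // gt_eqF.
  apply: (mulfI tm0); move: E; rewrite expr1 => E.
  have -> : t * mu t * (- 2^-1 * mu t ^+ 3) = - 2^-1 * mu t ^+ 2 * (mu t ^+ 2 * t) by ring.
  by rewrite M mulr1; lra.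
rewrite derive1nS derive1E.
have -> : 'D_1 (mu^`(k))%classic t = 'D_1 (fun y => C * mu y ^+ (2 * k).+1) t.
  by apply: near_eq_derive; apply: filterS near_t => y; exact: IH.
have D := is_deriveZ C (@is_derive_exprn _ R^o mu t 1 _ (2 * k).+1 dmu).
rewrite (@derive_val _ _ _ _ _ _ _ D) /GRing.scale /= dE.
have -> : (2 * k.+1).+1 = (2 * k + 3)%N by rewrite mulnS addnC -addnS.
by rewrite exprD; ring.
Qed.

Lemma flat0_nondecreasing {R : realType} (s t : R) : s <= t -> flat 0 s <= flat 0 t.
Proof.
move=> st; have [s0|s0] := ltP 0 s; last by rewrite flat0_eq0 // flat0_ge0.
have t0 : 0 < t by exact: lt_le_trans st.
by rewrite /flat s0 t0 !expr0 !mul1r ler_expR lerN2 lef_pV2.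
Qed.

Lemma bump_decreasing {R : realType} (d s t : R) : `|s| <= `|t| -> bump d t <= bump d s.
Proof.
move=> st; apply: flat0_nondecreasing; rewrite lerD2l lerN2.
by rewrite -[s ^+ 2]real_normK ?num_real // -[t ^+ 2]real_normK ?num_real // ler_pXn2r.
Qed.

Lemma itg_bump_gt0 {R : realType} (eta : R) : 0 < eta -> 0 < itg (- eta) eta (bump eta).
Proof.
move=> eta0; pose m := bump eta (eta / 2).
have ca : continuous (bump eta) by apply: smooth1_continuous; exact: smooth1_bump.
have ccst (k : R) : continuous (fun _ : R => k) by exact: cst_continuous.
have m0 : 0 < m by apply: bump_gt0; rewrite ger0_norm; lra.
have mono t : - (eta / 2) <= t <= eta / 2 -> m <= bump eta t.
  by move=> tE; apply: bump_decreasing; rewrite ler_norml ger0_norm; lra.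
rewrite (@itg_cat _ _ (- (eta / 2))) //; [|lra..].
rewrite (@itg_cat _ (- (eta / 2)) (eta / 2)) //; [|lra..].
have pos s t : s <= t -> 0 <= itg s t (bump eta).
  move=> st; rewrite -[leLHS](mul0r (t - s)) -itg_cst //; apply: itg_le => // y _; exact: bump_ge0.
have := pos (- eta) (- (eta / 2)); have := pos (eta / 2) eta.
suff : m * eta <= itg (- (eta / 2)) (eta / 2) (bump eta) by have := mulr_gt0 m0 eta0; lra.
have -> : m * eta = itg (- (eta / 2)) (eta / 2) (fun=> m) by rewrite itg_cst; [congr (_ * _); field|lra].
by apply: itg_le => //; lra.
Qed.

Section Kernel.
Context {R : realType} {n : nat}.
Local Notation V := 'rV[R]_n.+2.
Variables (x0 kap : V) (u : (V -> R) -> R) (K : set V) (dl : R).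
Hypothesis hu : smooth_functional K u.
Hypothesis dl0 : 0 < dl.
Local Notation L := (slab_coord x0 kap).
Local Notation cut := (slab_cut x0 kap).
Local Notation X := (slab_coord x0 kap 0).
Local Notation Y := (slab_coord x0 kap 1).
Hypothesis hole : forall phi, smooth phi ->
  (forall x, phi x != 0 -> forall k, `|L k x| <= dl) -> u phi = 0.
Hypothesis tube : forall (c s : R) (a : R -> R) (chi : 'I_n.+2 -> R -> R),
  c ^+ 2 + s ^+ 2 = 1 -> smooth1 a -> (forall k, smooth1 (chi k)) ->
  (forall t, dl < `|t| -> a t = 0) -> (forall k t, dl < `|t| -> chi k t = 0) ->
  u (fun x => a (c * X x + s * Y x) * cut chi x) = 0.

Let sX : smooth X. Proof. exact: smooth_slab_coord. Qed.
Let sY : smooth Y. Proof. exact: smooth_slab_coord. Qed.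

Definition cut_family (chi : 'I_n.+2 -> R -> R) :=
  (forall k, smooth1 (chi k)) /\ (forall k t, dl < `|t| -> chi k t = 0).

Let scut chi : cut_family chi -> smooth (cut chi).
Proof. by move=> [? _]; exact: smooth_slab_cut. Qed.

(** The difference lives where X^2 + Y^2 < dl^2 and the cut is nonzero, hence where every coordinate
    is at most dl. This is what allows a smooth mu in place of the singular power. *)
Lemma hole_eq phi1 phi2 chi : smooth phi1 -> smooth phi2 -> cut_family chi ->
  (forall x, dl ^+ 2 <= X x ^+ 2 + Y x ^+ 2 -> phi1 x = phi2 x) ->
  u (fun x => phi1 x * cut chi x) = u (fun x => phi2 x * cut chi x).
Proof.
move=> s1 s2 hchi E; have sc := scut hchi; apply/eqP; rewrite -subr_eq0 -(functionalB hu); [|exact: smoothM..].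
apply/eqP; apply: hole; first by apply: smoothB; exact: smoothM.
move=> x; rewrite -mulrBl mulf_eq0 negb_or => /andP[d12 cx] k.
have XY : X x ^+ 2 + Y x ^+ 2 < dl ^+ 2.
  by rewrite ltNge; apply: contra d12 => /E ->; rewrite subrr.
have sqle (t : R) : t ^+ 2 <= dl ^+ 2 -> `|t| <= dl.
  by move=> tt; rewrite -(ler_pXn2r (n := 2)) ?nnegrE ?(ltW dl0) // real_normK ?num_real.
have [->|k0] := eqVneq k 0; first by apply: sqle; have := sqr_ge0 (Y x); lra.
have [->|k1] := eqVneq k 1; first by apply: sqle; have := sqr_ge0 (X x); lra.
rewrite leNgt; apply: contra cx => H; case: hchi => _ chi0.
rewrite /slab_cut (bigD1 k) /= ?chi0 ?mul0r //.
by case: k k0 k1 {H} => -[|[|k]].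
Qed.

Variable mu : R -> R.
Hypothesis smu : smooth1 mu.
Hypothesis mu0 : forall t, 0 < mu t.
Hypothesis muE : forall t, dl ^+ 2 / 2 <= t -> mu t ^+ 2 * t = 1.

Let cid : continuous (fun t : R => t). Proof. by move=> t; exact: cvg_id. Qed.
Let ccst (k : R) : continuous (fun _ : R => k). Proof. exact: cst_continuous. Qed.

(** Off the hole, the strips a(arg) along the tangent lines superpose to twice the integral of a(v)
    H(x, v), by [circle_integral]. Normalised by the mass of a, this concentrates at v = 0, and H at
    v = 0 is the required kernel. *)
Lemma kernel_shift (c1 c2 : R) chi : cut_family chi -> `|c1| < dl / 16 -> `|c2| < dl / 16 ->
  u (fun x => mu (X x ^+ 2 + Y x ^+ 2 - 2 * (c1 * X x + c2 * Y x)) * cut chi x) = 0.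
Proof.
move=> hchi hc1 hc2; have sc := scut hchi.
(* With the radius equal to |c|, the term p^2 cancels c1^2 + c2^2 and the argument of mu becomes
   affine in (c1, c2). *)
pose p := Num.sqrt (c1 ^+ 2 + c2 ^+ 2).
have p0 : 0 <= p by exact: sqrtr_ge0.
have p2 : p ^+ 2 = c1 ^+ 2 + c2 ^+ 2 by rewrite sqr_sqrtr // addr_ge0 ?sqr_ge0.
rewrite !ltr_norml in hc1 hc2.
have d20 : 0 < dl ^+ 2 by exact: exprn_gt0.
have c1s : c1 ^+ 2 <= (dl / 16) ^+ 2 by nra.
have c2s : c2 ^+ 2 <= (dl / 16) ^+ 2 by nra.
have p8 : p <= dl / 8.
  by rewrite -(ler_pXn2r (n := 2)) ?nnegrE //; [rewrite p2; nra|lra].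
have p28 : p ^+ 2 <= (dl / 8) ^+ 2 by nra.
pose H (x : V) (v : R) := mu ((X x - c1) ^+ 2 + (Y x - c2) ^+ 2 - (v + p) ^+ 2) * cut chi x.
have pX : psmooth (fun (x : V) (_ : R) => X x) by exact: psmooth_const.
have pY : psmooth (fun (x : V) (_ : R) => Y x) by exact: psmooth_const.
have pX1 : psmooth (fun (x : V) (_ : R) => X x - c1) by apply: psmoothB => //; exact: psmooth_cst.
have pY1 : psmooth (fun (x : V) (_ : R) => Y x - c2) by apply: psmoothB => //; exact: psmooth_cst.
have hmu : psmooth (fun (x : V) (v : R) => mu ((X x - c1) ^+ 2 + (Y x - c2) ^+ 2 - (v + p) ^+ 2)).
  apply: psmooth_comp1 => //; apply: psmoothB; first by apply: psmoothD; exact: psmoothX.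
  by apply: psmooth_param; apply: continuous_mul; apply: continuous_add.
have hH : psmooth H by apply: psmoothM => //; exact: psmooth_const.
rewrite (_ : (fun x => _) = H^~ 0); last first.
  apply/funext => x; rewrite /H add0r p2; congr (mu _ * _); ring.
apply: (functional_concentrate hu hH (@segment_compact R (- dl) dl)) => U e /nbhs_ballP[r /= r0 HU] e0.
pose eta := Num.min (r / 2) (dl / 8).
have eta0 : 0 < eta by rewrite lt_min !divr_gt0.
have etad : eta <= dl / 8 by rewrite ge_min lexx orbT.
have etar : eta < r by rewrite gt_min; apply/orP; left; lra.
pose a := bump eta.
have sa : smooth1 a by exact: smooth1_bump.
have ca : continuous a by exact: smooth1_continuous.
have a0 t : eta <= `|t| -> a t = 0 by apply: bump_eq0; exact: ltW.
have ee : - eta <= eta by lra.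
pose Z := itg (- eta) eta a.
have Z0 : 0 < Z by exact: itg_bump_gt0.
exists (fun g => Z^-1 * itg (- eta) eta (fun v => a v * g v)); split.
- move=> k g g' cg cg'; rewrite mulrCA -mulrDr; congr (_ * _).
  rewrite -itg_lin; [|exact: continuous_mul..].
  by congr itg; apply/funext => t; ring.
- rewrite (_ : (fun t => _) = a) ?mulVf ?gt_eqF //.
  by apply/funext => t; rewrite mulr1.
- move=> g e' B cg e'0 B0 Hg _; apply: le_trans (_ : e' <= _); last by rewrite lerDl mulr_ge0 // ltW.
  rewrite normrM ger0_norm ?invr_ge0 ?(ltW Z0) // mulrC ler_pdivrMr //.
  have bnd t : - eta <= t <= eta -> `|a t * g t| <= e' * a t.
    move=> tE; rewrite normrM mulrC (ger0_norm (bump_ge0 _ _)) ler_wpM2r ?bump_ge0 //.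
    apply: Hg; first by rewrite /= in_itv /=; lra.
    by apply: HU; rewrite /ball /= sub0r normrN ltr_norml; lra.
  have cag : continuous (fun t => a t * g t) by exact: continuous_mul.
  rewrite ler_norml; apply/andP; split.
    rewrite -mulNr -itgZ //; apply: itg_le => //; first exact: continuous_mul.
    by move=> t /bnd; rewrite ler_norml mulNr => /andP[].
  rewrite -itgZ //; apply: itg_le => //; first exact: continuous_mul.
  by move=> t /bnd; rewrite ler_norml => /andP[].
- pose arg (x : V) (psi : R) := (X x - c1) * cos psi + (Y x - c2) * sin psi - p.
  have hG : psmooth (fun x psi => a (arg x psi) * cut chi x).
    apply: psmoothM; last exact: psmooth_const.
    apply: psmooth_comp1 => //; apply: psmoothB; last exact: psmooth_cst.
    apply: psmoothD; apply: psmoothM => //; apply: psmooth_param.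
      exact: continuous_cos.
    exact: continuous_sin.
  have pi2 : 0 <= 2 * pi :> R by rewrite mulr_ge0 // pi_ge0.
  have S1 : u (fun x => itg 0 (2 * pi) (fun psi => a (arg x psi) * cut chi x)) = 0.
    apply: (functional_itg hu hG pi2) => psi _.
    (* Relative to x0 the strip is shifted by q, with |q| <= 2 dl / 16 + dl / 8. As its half-width
       eta is at most dl / 8, it stays within the width dl allowed by [tube]. *)
    pose q := c1 * cos psi + c2 * sin psi + p.
    have qs : `|q| <= dl / 4.
      rewrite ler_norml; have := cos_le1 psi; have := cos_geN1 psi.
      have := sin_le1 psi; have := sin_geN1 psi; rewrite /q; nra.
    case: (hchi) => hchi1 hchi2.
    rewrite -[RHS](tube (c := cos psi) (s := sin psi) (a := fun t => a (t - q)) (cos2Dsin2 psi) _ hchi1 _ hchi2).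
    + congr u; apply/funext => x; congr (a _ * _); rewrite /arg /q; ring.
    + apply: (@smooth1_comp _ (fun t => t - q) a) => //.
      by apply: smooth1D; [exact: smooth1_id|exact: smooth1_cst].
    + move=> t td; apply: a0; have := lerB_dist t q; lra.
  have cut_out x : itg 0 (2 * pi) (fun psi => a (arg x psi) * cut chi x) =
      itg 0 (2 * pi) (fun psi => a (arg x psi)) * cut chi x.
    rewrite [RHS]mulrC -itgZ //; first by congr itg; apply/funext => psi; rewrite mulrC.
    apply: continuous_compose ca; apply: continuous_sub => //; apply: continuous_add; apply: continuous_mul => //.
      exact: continuous_cos.
    exact: continuous_sin.
  have pa : psmooth (fun x psi => a (arg x psi)).
    apply: psmooth_comp1 => //; apply: psmoothB; last exact: psmooth_cst.
    apply: psmoothD; apply: psmoothM => //; apply: psmooth_param.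
      exact: continuous_cos.
    exact: continuous_sin.
  have pam : psmooth (fun x v => a v * mu ((X x - c1) ^+ 2 + (Y x - c2) ^+ 2 - (v + p) ^+ 2)).
    by apply: psmoothM => //; exact: psmooth_param.
  have sI : smooth (fun x => itg (- eta) eta (fun v => a v * mu ((X x - c1) ^+ 2 + (Y x - c2) ^+ 2 - (v + p) ^+ 2))).
    exact: psmooth_itg ee pam.
  have HE x : itg (- eta) eta (fun v => a v * H x v) =
      itg (- eta) eta (fun v => a v * mu ((X x - c1) ^+ 2 + (Y x - c2) ^+ 2 - (v + p) ^+ 2)) * cut chi x.
    rewrite [RHS]mulrC -itgZ //; first by congr itg; apply/funext => v; rewrite /H; ring.
    exact: (@psmooth_slice _ _ _ _ x pam).
  have S2 : u (fun x => 2 * itg (- eta) eta (fun v => a v * mu ((X x - c1) ^+ 2 + (Y x - c2) ^+ 2 - (v + p) ^+ 2)) * cut chi x) = 0.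
    rewrite -S1 -(hole_eq (phi1 := fun x => itg 0 (2 * pi) (fun psi => a (arg x psi))) _ _ hchi).
    + by congr u; apply/funext => x; rewrite cut_out.
    + exact: psmooth_itg pi2 pa.
    + by apply: smoothM => //; exact: smooth_cst.
    + move=> x xd; rewrite /arg; apply: (@circle_integral _ a mu _ _ p eta (dl ^+ 2 / 2)) => //.
      * exact: smooth1_continuous.
      * by rewrite divr_gt0.
      (* These squares give (X - c1)^2 + (Y - c2)^2 >= (3/4) (X^2 + Y^2) - 3 p^2. With p <= dl / 8
         and X^2 + Y^2 >= dl^2 this exceeds (dl / 4)^2 + dl^2 / 2. *)
      * have q1 : 0 <= (X x / 2 - 2 * c1) ^+ 2 by exact: sqr_ge0.
        have q2 : 0 <= (Y x / 2 - 2 * c2) ^+ 2 by exact: sqr_ge0.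
        have e4 : (eta + p) ^+ 2 <= (dl / 4) ^+ 2 by nra.
        nra.
  rewrite (_ : (fun x => _) = (fun x => Z^-1 * 2^-1 * (2 * itg (- eta) eta (fun v => a v * mu ((X x - c1) ^+ 2 + (Y x - c2) ^+ 2 - (v + p) ^+ 2)) * cut chi x))).
    rewrite (functionalZ _ hu) ?S2 ?mulr0 //; apply: smoothM => //; apply: smoothM => //; exact: smooth_cst.
  by apply/funext => x; rewrite HE; field; rewrite gt_eqF.
Qed.


End Kernel.

Lemma smooth1_derive1n {R : realType} (f : R -> R) k : smooth1 f -> smooth1 (f^`(k))%classic.
Proof. by move=> sf; elim: k => // k IH; rewrite derive1nS; exact: smooth1_derive. Qed.

(** The argument of nu is affine in t, so differentiating in t brings down exactly -2 Z and replaces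
    nu by its derivative. *)
Lemma functional_deriv_shift {R : realType} {V : normedModType R} (K : set V) u
    (psi A Z : V -> R) (nu : R -> R) (t0 e : R) :
  smooth_functional K u -> smooth psi -> smooth A -> smooth Z -> smooth1 nu -> 0 < e ->
  (forall t, `|t - t0| <= e -> u (fun x => psi x * nu (A x - 2 * (t * Z x))) = 0) ->
  u (fun x => psi x * Z x * nu^`()%classic (A x - 2 * (t0 * Z x))) = 0.
Proof.
move=> hu spsi sA sZ snu e0 H0.
have pZ : psmooth (fun (x : V) (_ : R) => Z x) by exact: psmooth_const.
have pt : psmooth (fun (_ : V) (t : R) => t) by apply: psmooth_param => t; exact: cvg_id.
have parg : psmooth (fun (x : V) (t : R) => A x - 2 * (t * Z x)).
  by apply: psmoothB; [exact: psmooth_const|apply: psmoothZ; exact: psmoothM].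
have pG (f : R -> R) : smooth1 f ->
    psmooth (fun (x : V) (t : R) => psi x * f (A x - 2 * (t * Z x))).
  by move=> sf; apply: psmoothM; [exact: psmooth_const|exact: psmooth_comp1].
have sdnu := smooth1_derive snu.
have dG (x : V) (t : R) : is_derive t 1 (fun t : R => psi x * nu (A x - 2 * (t * Z x)))
    (-2 * Z x * (psi x * nu^`()%classic (A x - 2 * (t * Z x)))).
  have D0 : is_derive t 1 (fun t : R => A x - 2 * (t * Z x)) (-2 * Z x).
    have := is_deriveB (is_derive_cst (A x) t 1) (is_deriveZ (2 * Z x) (is_derive_id t 1)).
    rewrite /GRing.scale /= mulr1 sub0r => D.
    have -> : -2 * Z x = - (2 * Z x) by ring.
    rewrite (_ : (fun t : R => _) = (fun t : R => A x - 2 * Z x * t)); first exact: D.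
    by apply/funext => s; ring.
  have := is_deriveZ (psi x) (is_derive_comp1 D0 (smooth1_is_derive (A x - 2 * (t * Z x)) snu)).
  by move/is_derive_eq; apply; rewrite /GRing.scale /=; ring.
have pH : psmooth (fun x (t : R) => -2 * Z x * (psi x * nu^`()%classic (A x - 2 * (t * Z x)))).
  by apply: psmoothM; [exact: psmoothZ|exact: pG].
have HH := functional_deriv hu pH e0 (fun t => psmooth_smooth t (pG _ snu)) dG H0.
rewrite (_ : (fun x => _) = (fun x => - 2^-1 * (-2 * Z x * (psi x * nu^`()%classic (A x - 2 * (t0 * Z x)))))).
  by rewrite (functionalZ _ hu) ?HH ?mulr0 //; exact: (psmooth_smooth t0 pH).
by apply/funext => x; field.
Qed.

(** * Moments of the kernel against powers of X and Y *)

Section KernelMoments.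
Context {R : realType} {n : nat}.
Local Notation V := 'rV[R]_n.+2.
Variables (x0 kap : V) (u : (V -> R) -> R) (K : set V) (dl : R).
Hypothesis hu : smooth_functional K u.
Hypothesis dl0 : 0 < dl.
Local Notation L := (slab_coord x0 kap).
Local Notation cut := (slab_cut x0 kap).
Local Notation X := (slab_coord x0 kap 0).
Local Notation Y := (slab_coord x0 kap 1).
Variable mu : R -> R.
Hypothesis smu : smooth1 mu.
Hypothesis mu0 : forall t, 0 < mu t.
Hypothesis muE : forall t, dl ^+ 2 / 2 <= t -> mu t ^+ 2 * t = 1.
Variable chi : 'I_n.+2 -> R -> R.
Hypothesis schi : forall k, smooth1 (chi k).
Hypothesis off_hole : forall phi1 phi2, smooth phi1 -> smooth phi2 ->
  (forall x, dl ^+ 2 <= X x ^+ 2 + Y x ^+ 2 -> phi1 x = phi2 x) ->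
  u (fun x => phi1 x * cut chi x) = u (fun x => phi2 x * cut chi x).
Hypothesis shift : forall c1 c2 : R, `|c1| < dl / 16 -> `|c2| < dl / 16 ->
  u (fun x => mu (X x ^+ 2 + Y x ^+ 2 - 2 * (c1 * X x + c2 * Y x)) * cut chi x) = 0.

Let sX : smooth X. Proof. exact: smooth_slab_coord. Qed.
Let sY : smooth Y. Proof. exact: smooth_slab_coord. Qed.
Let scut : smooth (cut chi). Proof. exact: smooth_slab_cut. Qed.
Let sXY : smooth (fun x => X x ^+ 2 + Y x ^+ 2).
Proof. by apply: smoothD; exact: smoothX. Qed.

(** Each induction step differentiates in c1 or c2, so the vanishing is stated on an open square of
    parameters and not only at 0. *)
Lemma kernel_deriv a b (c1 c2 : R) : `|c1| < dl / 16 -> `|c2| < dl / 16 ->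
  u (fun x => cut chi x * X x ^+ a * Y x ^+ b *
    (mu^`(a + b))%classic (X x ^+ 2 + Y x ^+ 2 - 2 * (c1 * X x + c2 * Y x))) = 0.
Proof.
have room (c : R) : `|c| < dl / 16 -> exists2 e, 0 < e & forall t, `|t - c| <= e -> `|t| < dl / 16.
  move=> hc; exists ((dl / 16 - `|c|) / 2) => [|t tc]; first by lra.
  by have := ler_normD (t - c) c; rewrite subrK; lra.
have slin (c : R) Z : smooth Z -> smooth (fun x : V => 2 * (c * Z x)).
  by move=> sZ; apply: smoothM (smooth_cst _) _; exact: smoothM (smooth_cst _) _.
have sm i j : smooth (fun x => cut chi x * X x ^+ i * Y x ^+ j).
  by apply: smoothM; [apply: smoothM => //|]; exact: smoothX.
elim: a c1 c2 => [|a IHa]; last first.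
  move=> c1 c2 /room[e e0 he] hc2.
  have sA : smooth (fun x => X x ^+ 2 + Y x ^+ 2 - 2 * (c2 * Y x)) by apply: smoothB => //; exact: slin.
  rewrite -(functional_deriv_shift (t0 := c1) hu (sm a b) sA sX (smooth1_derive1n (a + b) smu) e0).
    congr u; apply/funext => x; rewrite addSn derive1nS exprS; congr (_ * _); first ring.
    by congr ((_^`())%classic _); ring.
  move=> t /he tc; rewrite -(IHa t c2 tc hc2); congr u; apply/funext => x.
  by congr (_ * (mu^`(_))%classic _); ring.
elim: b => [|b IHb] c1 c2 hc1 hc2.
  by rewrite -(shift hc1 hc2); congr u; apply/funext => x; rewrite /= !mulr1 mulrC.
have [e e0 he] := room _ hc2.
have sA : smooth (fun x => X x ^+ 2 + Y x ^+ 2 - 2 * (c1 * X x)) by apply: smoothB => //; exact: slin.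
rewrite -(functional_deriv_shift (t0 := c2) hu (sm 0%N b) sA sY (smooth1_derive1n (0 + b) smu) e0).
  congr u; apply/funext => x; rewrite addnS derive1nS exprS; congr (_ * _); first ring.
  by congr ((_^`())%classic _); ring.
move=> t /he tc; rewrite -(IHb c1 t hc1 tc); congr u; apply/funext => x.
by congr (_ * (mu^`(_))%classic _); ring.
Qed.

Local Notation m := (fun x => mu (X x ^+ 2 + Y x ^+ 2)).

Let sm : smooth m. Proof. exact: smooth_comp1. Qed.

Let sM a b k : smooth (fun x => X x ^+ a * Y x ^+ b * m x ^+ k).
Proof. by apply: smoothM; [apply: smoothM|]; exact: smoothX. Qed.

Let sMc a b k : smooth (fun x => X x ^+ a * Y x ^+ b * m x ^+ k * cut chi x).
Proof. exact: smoothM. Qed.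

(** For j = 0 this is [kernel_deriv] at c = 0, divided by the nonzero constant of
    [derive1n_inverse_sqrt]. Inserting (X^2 + Y^2) m^2 = 1 off the hole raises the degree by 2 and
    the exponent of m by 2, hence lowers j by 1. *)
Let moment_large a b j :
  u (fun x => X x ^+ a * Y x ^+ b * m x ^+ (2 * (a + b + j)).+1 * cut chi x) = 0.
Proof.
have d20 : 0 < dl ^+ 2 by exact: exprn_gt0.
elim: j a b => [|j IH] a b.
  have tau0 : 0 < dl ^+ 2 / 2 by rewrite divr_gt0.
  have [C C0 HC] := derive1n_inverse_sqrt tau0 smu mu0 muE (a + b).
  have c0 : `|0 : R| < dl / 16 by rewrite normr0 divr_gt0.
  have sD : smooth (fun x => X x ^+ a * Y x ^+ b * (mu^`(a + b))%classic (X x ^+ 2 + Y x ^+ 2)).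
    apply: smoothM; first by apply: smoothM; exact: smoothX.
    apply: smooth_comp1 => //; exact: smooth1_derive1n.
  suff E : C * u (fun x => X x ^+ a * Y x ^+ b * m x ^+ (2 * (a + b + 0)).+1 * cut chi x) = 0.
    by move/eqP: E; rewrite mulf_eq0 (negbTE C0) => /eqP.
  rewrite -(functionalZ _ hu) //.
  rewrite -[RHS](kernel_deriv a b c0 c0).
  rewrite -[RHS](_ : u (fun x => X x ^+ a * Y x ^+ b * (mu^`(a + b))%classic (X x ^+ 2 + Y x ^+ 2) * cut chi x) = _); last first.
    by congr u; apply/funext => x; rewrite !mul0r addr0 mulr0 subr0; ring.
  rewrite addn0 (off_hole (phi2 := fun x => C * (X x ^+ a * Y x ^+ b * m x ^+ (2 * (a + b)).+1)) sD).
  - by congr u; apply/funext => x; rewrite mulrA.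
  - by apply: smoothM => //; exact: smooth_cst.
  - by move=> x xd; rewrite HC; [ring|lra].
have E1 := IH a.+2 b; have E2 := IH a b.+2.
rewrite (off_hole (phi2 := fun x => X x ^+ a.+2 * Y x ^+ b * m x ^+ (2 * (a.+2 + b + j)).+1 +
  X x ^+ a * Y x ^+ b.+2 * m x ^+ (2 * (a + b.+2 + j)).+1)) //.
- rewrite (_ : (fun x => _) = (fun x =>
    X x ^+ a.+2 * Y x ^+ b * m x ^+ (2 * (a.+2 + b + j)).+1 * cut chi x +
    X x ^+ a * Y x ^+ b.+2 * m x ^+ (2 * (a + b.+2 + j)).+1 * cut chi x)).
    by rewrite (functionalD hu) // E1 E2 addr0.
  by apply/funext => x; rewrite mulrDl.
- exact: smoothD.
- move=> x xd; have M := muE (t := X x ^+ 2 + Y x ^+ 2) _.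
  have -> : (a.+2 + b + j = (a + b + j.+1).+1)%N by rewrite !addSn addnS.
  have -> : (a + b.+2 + j = (a + b + j.+1).+1)%N by rewrite !addnS !addSn.
  have -> : (2 * (a + b + j.+1).+1).+1 = ((2 * (a + b + j.+1)).+1 + 2)%N by rewrite mulnS addnC -addSn.
  have {}M := M (le_trans _ xd); move: M; set q := mu _ => M.
  rewrite exprD; set r := q ^+ _; rewrite -[LHS]mulr1 -[X in _ * X = _]M; last lra.
  by rewrite !exprS; ring.
Qed.

Lemma kernel_moment a b k : u (fun x => X x ^+ a * Y x ^+ b * m x ^+ (2 * k).+1 * cut chi x) = 0.
Proof.
(* Here p bounds by how much k falls short of a + b. Multiplying by a power of m^2 raises k, so the
   induction hypothesis supplies the vanishing demanded by [functional_positive]. *)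
have [p] : exists p, (a + b <= k + p)%N by exists (a + b)%N; exact: leq_addl.
elim: p k => [|p IH] k kp.
  by rewrite addn0 in kp; rewrite -(subnKC kp); exact: moment_large.
apply: (functional_positive (sigma := fun x => m x ^+ 2) hu) => //.
- exact: smoothX.
- by move=> x _; rewrite exprn_gt0.
move=> j; rewrite -(IH (k + j.+1)%N); last first.
  by apply: leq_trans kp _; rewrite -addnA leq_add2l addSn ltnS leq_addl.
congr u; apply/funext => x.
have -> : (2 * (k + j.+1)).+1 = ((2 * k).+1 + 2 * j.+1)%N by rewrite mulnDr addSn.
by rewrite exprD exprM; ring.
Qed.

End KernelMoments.

Section SlabDensity.
Context {R : realType} {n : nat}.
Local Notation V := 'rV[R]_n.+2.
Variables (u : (V -> R) -> R) (K W : set V).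
Hypothesis hu : smooth_functional K u.
Hypothesis hX : Xvanish W u.
Hypothesis hW : forall phi, smooth phi -> compact (closure [set x | phi x != 0]) ->
  closure [set x | phi x != 0] `<=` W -> u phi = 0.

Lemma slab_density (x0 kap : V) (eps : R) : kap 0 0 = 0 -> 0 < eps ->
  (forall x, `|x - x0| < 2 * eps -> W x) ->
  exists rho : V -> R, [/\ smooth rho, forall x, 0 <= rho x,
    forall x, (forall k : 'I_n.+2, (1 < k)%N -> slab_coord x0 kap k x = 0) -> 0 < rho x &
    forall phi, smooth phi -> u (fun x => rho x * phi x) = 0].
Proof.
move=> kap0 eps0 ballW.
have [dl dl0 [hole tube]] := slab_local kap0 hu hX hW eps0 ballW.
have tau0 : 0 < dl ^+ 2 / 2 by rewrite divr_gt0 // exprn_gt0.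
have [mu [smu mu0 muE]] := exists_inverse_sqrt tau0.
pose L := slab_coord x0 kap.
have sL k : smooth (L k) by exact: smooth_slab_coord.
pose b : 'I_n.+2 -> R -> R := fun=> bump dl.
have sb k : smooth1 (b k) by exact: smooth1_bump.
pose rho x := mu (L 0 x ^+ 2 + L 1 x ^+ 2) * slab_cut x0 kap b x.
have srho : smooth rho.
  apply: smoothM; last exact: smooth_slab_cut.
  by apply: smooth_comp1 => //; apply: smoothD; exact: smoothX.
exists rho; split => //.
- by move=> x; rewrite mulr_ge0 ?(ltW (mu0 _)) // prodr_ge0 // => k _; exact: bump_ge0.
- move=> x Lx; rewrite mulr_gt0 // prodr_gt0 // => k k1.
  by rewrite Lx // bump_gt0 // normr0.
apply: (functional_density (lin := fun i x => dotv x (slab_form kap i))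
  (c := fun i => - dotv x0 (slab_form kap i)) (w := slab_basis kap)) hu srho _.
- by move=> i; exact: linear_dotv.
- by move=> i; exact: continuous_dotvl.
- by move=> i j; exact: slab_dual.
- by move=> x; exact: slab_span.
(* Powers of the coordinates beyond the first two are absorbed into the cutoff, which is why the
   earlier lemmas allow a different profile for each coordinate. *)
move=> e; pose chi (k : 'I_n.+2) (t : R) := t ^+ e k * bump dl t.
have hchi : cut_family dl chi.
  split=> k; first by apply: smooth1M; [apply: smooth1X; exact: smooth1_id|exact: smooth1_bump].
  by move=> t td; rewrite /chi bump_eq0 ?mulr0 // ltW.
rewrite -[RHS](kernel_moment (x0 := x0) (kap := kap) hu dl0 smu mu0 muE hchi.1 _ _ (e 0) (e 1) 0).
- congr u; apply/funext => x.
  rewrite (bigD1 0) //= (bigD1 1) //= /rho /slab_cut /chi big_split /=.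
  rewrite [X in _ * (_ * (_ * X)) = _](eq_bigl (fun k : 'I_n.+2 => (1 < k)%N)); last by case=> -[|[|k]].
  rewrite /b /L /slab_coord muln0 expr1; set p := _ ^+ e 0; set q := _ ^+ e 1; set P := \prod_(_ < _ | _) _; set Q := \prod_(_ < _ | _) _.
  ring.
- by move=> p1 p2 s1 s2; exact: (hole_eq hu dl0 hole s1 s2 hchi).
- by move=> c1 c2 h1 h2; exact: (kernel_shift hu dl0 hole tube smu mu0 muE hchi h1 h2).
Qed.


Lemma slab_density_at (y : V) : open W -> W !=set0 ->
  exists rho : V -> R, [/\ smooth rho, forall x, 0 <= rho x, 0 < rho y &
    forall phi, smooth phi -> u (fun x => rho x * phi x) = 0].
Proof.
move=> oW [w Ww].
(* The slanted basis needs y - x0 to have a nonzero first entry; otherwise the base point is moved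
   along the first axis inside W. *)
have [x0 Wx0 x0y] : exists2 x0, W x0 & (y - x0) 0 0 != 0.
  have [E|E] := eqVneq ((y - w) 0 0) 0; last by exists w.
  have /nbhs_ballP[r /= r0 Hr] : nbhs w W by exact: open_nbhs_nbhs.
  exists (w + (r / 2) *: delta_mx 0 0).
    apply: Hr; rewrite -ball_normE /ball_ /= opprD addrA subrr add0r normrN normrZ.
    have d1 : `|delta_mx 0 0 : V| <= 1.
      apply: rV_norm_le => // k; rewrite mxE; case: (_ && _); rewrite ?normr1 ?normr0 //.
    rewrite gtr0_norm ?divr_gt0 //; have : r / 2 * `|delta_mx 0 0 : V| <= r / 2 by rewrite ler_piMr // ltW // divr_gt0.
    lra.
  move: E; rewrite !mxE !eqxx /= mulr1 => E.
  by rewrite opprD addrA E add0r oppr_eq0 gt_eqF // divr_gt0.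
have /nbhs_ballP[r /= r0 Hr] : nbhs x0 W by exact: open_nbhs_nbhs.
(* The vector e_0 + kap is y - x0 rescaled to have first entry 1, so y lies in the plane. *)
pose kap : V := \row_k (if k == 0 then 0 else (y - x0) 0 k / (y - x0) 0 0).
have kap0 : kap 0 0 = 0 by rewrite mxE eqxx.
have eps0 : 0 < r / 2 by rewrite divr_gt0.
have ballW x : `|x - x0| < 2 * (r / 2) -> W x.
  move=> H; apply: Hr; rewrite -ball_normE /ball_ /= distrC; lra.
have [rho [srho rho0 rhop rhou]] := slab_density kap0 eps0 ballW.
exists rho; split => //; apply: rhop => k k1.
rewrite slab_coordE [kap 0 k]mxE; case: eqP => k0; first by rewrite k0 in k1.
by field.
Qed.

Lemma functional_eq0 : open W -> W !=set0 -> forall phi, smooth phi -> u phi = 0.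
Proof.
move=> oW W0 phi sphi; have [cK _ _] := hu.
have [rho Hrho] := choice (fun y => slab_density_at y oW W0).
have srho y : smooth (rho y) by case: (Hrho y).
have rho0 y x : 0 <= rho y x by case: (Hrho y).
have rhop y : 0 < rho y y by case: (Hrho y).
have urho y psi : smooth psi -> u (fun x => rho y x * psi x) = 0.
  by case: (Hrho y) => _ _ _; apply.
move: cK; rewrite compact_cover => /(_ V setT (fun y => [set x | 0 < rho y x])).
case=> [y _|x Kx|D _ HD].
- apply: (open_comp (f := rho y) (D := [set t : R | 0 < t])); last exact: open_gt.
  by move=> x _; exact: smooth_continuous.
- by exists x => //=; exact: rhop.
pose sigma x := \sum_(y <- finmap.enum_fset D) rho y x.
have ssig : smooth sigma by apply: smooth_sum.
apply: (functional_positive (sigma := sigma) hu) => //.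
- move=> x /HD[y /= yD yx]; rewrite /sigma (big_rem y yD) /=.
  by rewrite ltr_pwDl // sumr_ge0.
move=> j; have spsi : smooth (fun x => phi x * sigma x ^+ j) by apply: smoothM => //; exact: smoothX.
rewrite (_ : (fun x => _) = (fun x => \sum_(y <- finmap.enum_fset D) rho y x * (phi x * sigma x ^+ j))).
  rewrite (functional_sum _ hu); first by rewrite big1_seq // => y _; exact: urho.
  by move=> y; exact: smoothM.
by apply/funext => x; rewrite -mulr_suml exprS -/(sigma x); ring.
Qed.

End SlabDensity.

(** * Complex distributions *)

Section RealParts.
Context {R : realType} {d : nat}.
Local Notation V := 'rV[R]_d.

Definition realc (g : V -> R) : V -> R[i] := fun x => Complex (g x) 0.

Lemma csmooth_realc g : smooth g -> csmooth (realc g).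
Proof. by move=> sg; split; [rewrite smoothE in sg|rewrite -smoothE; exact: smooth_cst]. Qed.

Lemma iterD_cst0 {W : normedModType R} (s : seq W) : iterD s (fun=> (0 : R)) = fun=> 0.
Proof. by elim: s => //= v s ->; apply/funext => x; exact: derive_cst. Qed.

Lemma normc_realc (a : R) : ComplexField.Normc.normc (Complex a 0) = `|a|.
Proof. by rewrite /ComplexField.Normc.normc expr0n addr0 sqrtr_sqr. Qed.

(** The finite list S collects the directions of all tuples of length at most N, and M counts these
    tuples. *)
Lemma smooth_seminorm_le (K : set V) N : exists (S : seq (seq V)) (M : R), 0 <= M /\
  forall g e, smooth g -> 0 <= e ->
    (forall s x, s \in S -> K x -> `|iterD s g x| <= e) ->
    `|smooth_seminorm K N (realc g)| <= M * e.
Proof.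
pose part k (s : k.-tuple 'I_d) : seq V := [seq delta_mx 0 i | i <- s].
exists (flatten [seq [seq part k s | s <- enum {: k.-tuple 'I_d}] | k <- iota 0 N.+1]).
exists (\sum_(k < N.+1) \sum_(s : k.-tuple 'I_d) 1); split.
  by apply: sumr_ge0 => k _; exact: sumr_ge0.
move=> g e sg e0 H; rewrite mulr_suml; apply: le_trans (ler_norm_sum _ _ _) (ler_sum _ _) => k _.
rewrite mulr_suml; apply: le_trans (ler_norm_sum _ _ _) (ler_sum _ _) => s _; rewrite mul1r.
have He x : K x -> 0 <= ComplexField.Normc.normc (partials s (realc g) x) <= e.
  move=> Kx; have -> : partials s (realc g) x = Complex (iterD (part k s) g x) (iterD (part k s) (fun=> 0) x) by [].
  rewrite iterD_cst0 normc_realc normr_ge0; apply: H => //.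
  apply/flattenP; exists [seq part k s | s <- enum {: k.-tuple 'I_d}].
    by apply/mapP; exists (k : nat) => //; rewrite mem_iota add0n ltn_ord.
  by apply/mapP; exists s => //; rewrite mem_enum.
(* For empty K every supremum in the seminorm is the default value 0. *)
have [[x Kx]|K0] := pselect (K !=set0); last first.
  rewrite (_ : [set _ | _ in _] = set0) ?sup0 ?normr0 //.
  by rewrite -subset0 => ? [x Kx _]; apply: K0; exists x.
have ub : ubound [set ComplexField.Normc.normc (partials s (realc g) x) | x in K] e.
  by move=> _ [y /He/andP[_ ?] <-].
rewrite ger0_norm; first by apply: ge_sup => //; eexists; exists x; [|reflexivity].
have /andP[h0 _] := He x Kx; apply: le_trans h0 _.
by apply: ub_le_sup; [exists e|exists x].
Qed.

Section Part.
Variables (f : cdistribution R d) (P : R[i] -> R).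
Hypothesis P_lin : forall (a : R) z w, P (Complex a 0 * z + w) = a * P z + P w.
Hypothesis P_le : forall z, `|P z| <= ComplexField.Normc.normc z.
(** [P] stands for the real or the imaginary part; real linearity and |P z| <= |z| treat both at
    once. *)
Let u (g : V -> R) := P (f (realc g)).

Lemma smooth_functional_part : exists K, smooth_functional K u.
Proof.
rewrite /u; case: f => p plin [K [N [c [cK Hc]]]] /=; exists K; split=> //.
  move=> a phi psi sphi spsi; rewrite -P_lin; congr P.
  rewrite -plin; [|exact: csmooth_realc..]; congr p; apply/funext => x.
  by apply/eqP; rewrite /realc eq_complex /=; apply/andP; split; apply/eqP; ring.
have [S [M [M0 HM]]] := smooth_seminorm_le K N.
exists S, (`|c| * M); split; first by rewrite mulr_ge0.
move=> g e sg e0 Hg; apply: le_trans (P_le _) (le_trans (Hc _ (csmooth_realc sg)) _).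
by rewrite (le_trans (ler_norm _)) // normrM -mulrA ler_wpM2l // HM.
Qed.

Lemma part0 : P 0 = 0.
Proof. by have := P_lin 1 0 0; rewrite mulr0 addr0 mul1r => E; lra. Qed.

Lemma part_vanishes_on W : distr_vanishes_on W f -> forall phi, smooth phi ->
  compact (closure [set x | phi x != 0]) -> closure [set x | phi x != 0] `<=` W -> u phi = 0.
Proof.
move=> fW phi sphi; rewrite /u (_ : [set x | phi x != 0] = [set p | setT p /\ realc phi p != 0]).
  by move=> cphi phiW; rewrite fW ?part0 //; exact: csmooth_realc.
apply/seteqP; split=> x /=; rewrite /realc eq_complex /= eqxx andbT; first by [].
by case.
Qed.

(** A globally smooth eta is its own local extension, with U the whole space, and its zero imaginary
    part integrates to 0. *)
Lemma Xvanish_part W : Xdistr_vanishes_on (lines_meeting W) f -> Xvanish W u.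
Proof.
move=> XfW eta seta; pose etac p := Complex (eta p) (0 : R).
rewrite (_ : [set _ | _] = [set p | oriented_lines p /\ etac p != 0]); last first.
  by apply/seteqP; split=> p /=; rewrite /etac eq_complex /= eqxx andbT.
move=> ceta etaW; rewrite /u -[RHS]part0 -(XfW etac _ ceta etaW).
  rewrite /Xdistr; congr (P (f _)); apply/funext => x; rewrite /Xstar /realc /=.
  congr Complex; transitivity (0 * sphere_integral (fun _ : V => (0 : R))); first by rewrite mul0r.
  rewrite -sphere_integralZ; last exact: cst_continuous.
  by congr sphere_integral; apply/funext => y; rewrite mul0r.
move=> p _; exists setT, etac; split=> //; first exact: openT.
by split; [rewrite smoothE in seta|rewrite -smoothE; exact: smooth_cst].
Qed.

End Part.
End RealParts.

Theorem theorem1p2 (R : realType) (d : nat) (hd : (2 <= d)%N)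
  (V : set 'rV[R]_d) (V_open : open V) (V_neq0 : V !=set0)
  (f : cdistribution R d) (f_V : distr_vanishes_on V f)
  (Xf_V : Xdistr_vanishes_on (lines_meeting V) f) :
  distr_eq0 f.
Proof.
(* The hypothesis 2 <= d supplies the two coordinates of the plane: the dimension becomes n.+2. *)
case: d hd V V_open V_neq0 f f_V Xf_V => [|[|n]] // _ V V_open V_neq0 f f_V Xf_V.
have part (P : R[i] -> R) : (forall (a : R) z w, P (Complex a 0 * z + w) = a * P z + P w) ->
    (forall z, `|P z| <= ComplexField.Normc.normc z) ->
    forall g, smooth g -> P (f (realc g)) = 0.
  move=> Pl Ple; have [K hu] := smooth_functional_part f Pl Ple.
  by apply: (functional_eq0 hu (Xvanish_part Pl Xf_V) (part_vanishes_on Pl f_V)).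
have f0 g : smooth g -> f (realc g) = 0.
  move=> sg; apply/eqP; rewrite eq_complex /=.
  apply/andP; split; apply/eqP; [apply: (part _ _ _ g sg)|apply: (part _ _ _ g sg)].
  - by move=> a [z1 z2] [w1 w2] /=; ring.
  - move=> [a b]; rewrite /= -sqrtr_sqr ler_sqrt ?lerDl ?sqr_ge0 //.
    by rewrite addr_ge0 ?sqr_ge0.
  - by move=> a [z1 z2] [w1 w2] /=; ring.
  - move=> [a b]; rewrite /= -sqrtr_sqr ler_sqrt ?lerDr ?sqr_ge0 //.
    by rewrite addr_ge0 ?sqr_ge0.
move=> phi [sre sim]; rewrite -smoothE in sre; rewrite -smoothE in sim.
(* Complex linearity with the scalar i reduces phi to its real and imaginary parts. *)
have -> : phi = (fun x => Complex 0 1 * realc (fun x => complex.Im (phi x)) x +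
    realc (fun x => complex.Re (phi x)) x).
  apply/funext => x; rewrite /realc; case: (phi x) => a b; apply/eqP; rewrite eq_complex /=.
  by apply/andP; split; apply/eqP; ring.
case: f f0 {f_V Xf_V part} => p plin pc /= f0.
by rewrite plin ?f0 ?mulr0 ?addr0 //; exact: csmooth_realc.
Qed.
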